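(* Let $G=N\rtimes H$ be a semidirect product of discrete groups with identity $e$, let $M$ be a normal subgroup of $N$, and let $P=\{a\in H: aMa^{-1}\subset M\}$. Assume that $H=PP^{-1}=P^{-1}P$, that $aMa^{-1}$ has finite index in $M$ for every $a\in P$, that $\bigcap_{a\in P}aMa^{-1}=\{e\}$, and that $N=\bigcup_{a\in P}a^{-1}Ma$. Let $\overline{N}\rtimes G|_{\overline{M}}$ be the restriction to $\overline{M}$ of the transformation groupoid $\overline{N}\rtimes G$, and let $\mathcal{G}_{tight}$ be the tight groupoid of the inverse semigroup $T$. Let $\phi:\overline{N}\rtimes G|_{\overline{M}}\to\mathcal{G}_{tight}$ be the map defined by $$\phi\big((x,a^{-1}mb)\big)=[(x,s_a^*u(m)s_b)]\qquad(a,b\in P,\ m\in M),$$ where $x\in\overline{M}$ is identified with the tight character of $T$ it determines. Then $\phi$ is a topological groupoid isomorphism.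
   Context: Write $M_a=aMa^{-1}$ for $a\in P$ (a normal subgroup of $M$). Algebra and inverse semigroup. $\mathfrak{A}[N\rtimes H,M]$ is the universal (unital) $C^*$-algebra generated by isometries $\{s_a:a\in P\}$ and unitaries $\{u(m):m\in M\}$ subject to: $s_as_b=s_{ab}$; $u(m)u(n)=u(mn)$; $s_au(m)=u(ama^{-1})s_a$; and, for every $a\in P$, $\sum_{k\in M/M_a}u(k)e_au(k)^{-1}=1$, where $e_a=s_as_a^*$. $F$ is the set of projections in the linear span of $\{u(k)e_bu(k)^{-1}:b\in P,k\in M\}$, and $T=\{s_a^*u(m)fu(m')s_{a'}:m,m'\in M,a,a'\in P,f\in F\}$, an inverse semigroup of partial isometries with $0$ whose set of projections is $F$. Tight groupoid. A character of $F$ is a nonzero semigroup homomorphism $x:F\to\{0,1\}$ with $x(0)=0$; $\widehat{F_0}$ is the set of characters with the topology from $\{0,1\}^F$. A character is maximal if its support $\{f:x(f)=1\}$ is maximal under inclusion among supports of characters; $\widehat{F_{tight}}$ is the closure in $\widehat{F_0}$ of the set of maximal characters. For $s\in T$ put $D_s=\{x\in\widehat{F_0}:x(ss^* )=1\}$ and, for $x\in D_s$, $(x.s)(f)=x(sfs^* )$. Let $\Sigma=\{(x,s):s\in T,x\in D_s\}$ with $(x,s)(y,t)=(x,st)$ when $y=x.s$, and $(x,s)^{-1}=(x.s,s^* )$. Put $(x,s)\sim(y,t)$ if $x=y$ and there is $f\in F$ with $x(f)=1$ and $fs=ft$; $[(x,s)]$ denotes the class of $(x,s)$. $\mathcal{G}=\Sigma/\!\sim$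 has the topology with basis $\{[(x,s)]:x\in U\}$, $s\in T$, $U\subset D_s$ open, and $\mathcal{G}_{tight}$ is its reduction to $\widehat{F_{tight}}$. The space $\overline{M}$. $\overline{M}=\{(r_a)\in\prod_{a\in P}M/M_a: r_{ab}\equiv r_a \bmod M_a \text{ for all }a,b\in P\}$, with the topology induced from the product topology (finite groups $M/M_a$ discrete); it is a compact topological group in which $M$ embeds via $r\mapsto(rM_a)_a$. An element $r\in\overline{M}$ is identified with the character of $F$ which is the indicator function of $A_r=\{f\in F: f\ge u(r_a)e_au(r_a)^{-1}\text{ for some }a\in P\}$; the map $r\mapsto 1_{A_r}$ is a homeomorphism $\overline{M}\to\widehat{F_{tight}}$. Action of $P$ on $\overline{M}$. For $a\in P$, $r\in\overline{M}$, the element $ara^{-1}\in\overline{M}$ is defined by: for $b\in P$ choose $c\in aP\cap bP$, write $c=a\alpha$ with $\alpha\in P$, and let $(ara^{-1})_b$ be the image of $r_\alpha$ under $M/M_\alpha\to M/M_c\to M/M_b$, where the first map is induced by conjugation by $a$ and the second is the quotient map. This is well defined. The group $\overline{N}$ and the action of $G$. $\overline{N}=(\overline{M}\times P)/\!\sim$, where $(x,a)\sim(y,b)$ if there are $\alpha,\beta\in P$ with $\alpha a=\beta b$ and $\alpha x\alpha^{-1}=\beta y\beta^{-1}$, with the quotient topology ($P$ discrete). Product: $[(x,a)][(y,b)]=[(\alpha x\alpha^{-1}\beta y\beta^{-1},\alpha a)]$ where $\alpha a=\beta b$. $\overline{N}$ is a locally compact Hausdorff group, and $\overline{M}$ is regarded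 as a compact open subgroup via $x\mapsto[(x,e)]$. For $a\in P$ let $\phi_a([(x,b)])=[(\beta x\beta^{-1},\alpha)]$, where $\alpha a=\beta b$; this is a homeomorphism of $\overline{N}$ with $\phi_a^{-1}([(x,b)])=[(x,ba)]$. For $m\in M$ let $\psi_m([(x,a)])=[(ama^{-1}x,a)]$. Every $g\in G$ has the form $g=a^{-1}mb$ with $a,b\in P$, $m\in M$, and $gx:=\phi_a^{-1}\psi_m\phi_b(x)$ is a well-defined left action of $G$ on $\overline{N}$. The associated right action is $x.g=g^{-1}x$. Transformation groupoid. $\overline{N}\rtimes G=\overline{N}\times G$ ($G$ discrete) with range $r(x,g)=x$, source $s(x,g)=x.g$, product $(x,g)(x.g,h)=(x,gh)$ and inverse $(x,g)^{-1}=(x.g,g^{-1})$; $\overline{N}\rtimes G|_{\overline{M}}=\{(x,g):x\in\overline{M},\ x.g\in\overline{M}\}$. *)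

(* Defs.v *)
From HB Require Import structures.
From mathcomp Require Import all_boot all_order all_algebra.
From mathcomp Require Import generic_quotient.
From mathcomp Require Import all_classical all_reals all_analysis.
From mathcomp Require Import complex.

Set Implicit Arguments.
Unset Strict Implicit.
Unset Printing Implicit Defensive.

Import GRing.Theory.

Local Open Scope classical_set_scope.

Local Ltac gsimp := rewrite ?(invgM, invgK, invg1);
  rewrite ?(mulgA, mulgK, mulgVK, mulgV, mulVg, mul1g, mulg1).

Section GroupData.
Local Open Scope group_scope.
Local Open Scope quotient_scope.
Variables (G : groupType) (N H M : set G).

Definition conjset (a : G) (K : set G) : set G := [set a * m * a^-1 | m in K].
Definition lcos (m : G) (K : set G) : set G := [set m * k | k in K].
Definition setmul (K L : set G) : set G := [set x * y | x in K & y in L].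

Definition Pset : set G := [set a | H a /\ conjset a M `<=` M].

(* M / M_a, a coset being represented by the set of its elements. *)
Definition cosets (a : G) : set (set G) := [set lcos m (conjset a M) | m in M].

(* The semidirect product is internal: N is normal in G, N and H meet
   trivially and G = NH. *)
Record CuntzLi_setting : Prop := {
  CL_N_subgroup : group_closed (mem N) ;
  CL_H_subgroup : group_closed (mem H) ;
  CL_N_normal : forall g : G, conjset g N `<=` N ;
  CL_NH_disjoint : N `&` H = [set 1] ;
  CL_NH_full : setmul N H = [set: G] ;
  CL_M_subgroup : group_closed (mem M) ;
  CL_M_sub : M `<=` N ;
  CL_M_normal : forall n : G, N n -> conjset n M `<=` M ;
  CL_H_PPV : H = [set a * b^-1 | a in Pset & b in Pset] ;
  CL_H_PVP : H = [set a^-1 * b | a in Pset & b in Pset] ;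
  CL_finite_index : forall a : G, Pset a -> finite_set (cosets a) ;
  CL_trivial_core : \bigcap_(a in Pset) conjset a M = [set 1] ;
  CL_N_union : N = \bigcup_(a in Pset) conjset a^-1 M
}.

Definition Mprod : topologicalType :=
  prod_topology (fun a : Pset => discrete_topology (cosets (val a))).

(* The image of a coset under M / M_c -> M / M_a is its product with M_a. *)
Definition Mbar_set : set Mprod := [set r | forall a b c : Pset,
  val c = val a * val b ->
  setmul (val (r c : cosets (val c))) (conjset (val a) M) =
  val (r a : cosets (val a))].

Definition Mbar : topologicalType := Mbar_set.

Definition coord (r : Mbar) (a : Pset) : set G :=
  val (val r a : cosets (val a)).


Section Setting.
Hypothesis h : CuntzLi_setting.

Let N1 : N 1. Proof. by have [/set_mem ? _] := CL_N_subgroup h. Qed.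

Let NB x y : N x -> N y -> N (x / y).
Proof.
have [_ B] := CL_N_subgroup h.
by move=> /mem_set Nx /mem_set Ny; exact: set_mem (B _ _ Nx Ny).
Qed.

Let H1 : H 1. Proof. by have [/set_mem ? _] := CL_H_subgroup h. Qed.

Let HB x y : H x -> H y -> H (x / y).
Proof.
have [_ B] := CL_H_subgroup h.
by move=> /mem_set Hx /mem_set Hy; exact: set_mem (B _ _ Hx Hy).
Qed.

Let HV x : H x -> H x^-1. Proof. by move/(HB H1); rewrite mul1g. Qed.

Let HM x y : H x -> H y -> H (x * y).
Proof. by move=> Hx Hy; rewrite -(invgK y); apply: HB => //; exact: HV. Qed.

Let M1 : M 1. Proof. by have [/set_mem ? _] := CL_M_subgroup h. Qed.

Let MB x y : M x -> M y -> M (x / y).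
Proof.
have [_ B] := CL_M_subgroup h.
by move=> /mem_set Mx /mem_set My; exact: set_mem (B _ _ Mx My).
Qed.

Let MV x : M x -> M x^-1. Proof. by move/(MB M1); rewrite mul1g. Qed.

Let MM x y : M x -> M y -> M (x * y).
Proof. by move=> Mx My; rewrite -(invgK y); apply: MB => //; exact: MV. Qed.

Let MP a m : Pset a -> M m -> M (a * m * a^-1).
Proof. by move=> [_ +] Mm; apply; exists m. Qed.

Lemma Pset1 : Pset 1.
Proof. by split=> // x [m Mm <-]; rewrite mul1g invg1 mulg1. Qed.

Lemma PsetM a b : Pset a -> Pset b -> Pset (a * b).
Proof.
move=> aP bP; split; first by apply: HM; [case: aP|case: bP].
move=> x [m Mm <-]; rewrite invgM !mulgA -(mulgA a) -(mulgA a).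
by apply: MP => //; apply: MP.
Qed.

Definition Pmul (a b : Pset) : Pset :=
  SigSub (mem_set (PsetM (set_valP a) (set_valP b))).
Definition Pone : Pset := SigSub (mem_set Pset1).
Definition Mconj (a : Pset) (m : M) : M :=
  SigSub (mem_set (MP (set_valP a) (set_valP m))).

Lemma ore_right (a b : Pset) :
  {p : Pset * Pset | val a * val p.1 = val b * val p.2}.
Proof.
apply/cid; have : H ((val a)^-1 * val b).
  by apply: HM; [apply: HV|]; [case: (set_valP a)|case: (set_valP b)].
rewrite (CL_H_PPV h) => -[c Pc [d Pd E]].
exists (SigSub (mem_set Pc), SigSub (mem_set Pd)) => /=.
by rewrite -[RHS](mulVKg (val a)) (mulgA _ _ d) -E -mulgA mulVg mulg1.
Qed.

Lemma ore_left (a b : Pset) :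
  {p : Pset * Pset | val p.1 * val a = val p.2 * val b}.
Proof.
apply/cid; have : H (val a * (val b)^-1).
  by apply: HM; [|apply: HV]; [case: (set_valP a)|case: (set_valP b)].
rewrite (CL_H_PVP h) => -[c Pc [d Pd E]].
exists (SigSub (mem_set Pc), SigSub (mem_set Pd)) => /=.
by rewrite -[LHS](mulgVK (val b)) -(mulgA c) -E mulVKg.
Qed.

(* M_a as a subgroup of M. *)
Let Ma1 a : conjset a M 1.
Proof. by exists 1 => //; rewrite mulg1 mulgV. Qed.

Let MaB a x y : conjset a M x -> conjset a M y -> conjset a M (x / y).
Proof.
move=> [m Mm <-] [n Mn <-]; exists (m / n); first exact: MB.
by rewrite !invgM invgK !mulgA mulgVK.
Qed.

Let MaV a x : conjset a M x -> conjset a M x^-1.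
Proof. by move/(MaB (Ma1 a)); rewrite mul1g. Qed.

Let MaM a x y : conjset a M x -> conjset a M y -> conjset a M (x * y).
Proof. by move=> Mx My; rewrite -(invgK y); apply: MaB => //; exact: MaV. Qed.

Let Ma_sub a b : Pset b -> conjset (a * b) M `<=` conjset a M.
Proof.
move=> Pb x [m Mm <-]; exists (b * m * b^-1); first exact: MP.
by rewrite invgM !mulgA.
Qed.

Let Ma_normal a k x : Pset a -> M k -> conjset a M x ->
  conjset a M (k^-1 * x * k).
Proof.
move=> Pa Mk [m Mm <-].
exists ((a^-1 * k^-1 * a) * m * (a^-1 * k^-1 * a)^-1); last by gsimp.
apply: (CL_M_normal h); last by exists m.
apply: (CL_N_normal h (g := a^-1)); exists k^-1; last by rewrite invgK.
by apply: (CL_M_sub h); exact: MV.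
Qed.

Let lcosE a m x : lcos m (conjset a M) x <-> conjset a M (m^-1 * x).
Proof.
split=> [[k Mk <-]|Mx]; first by rewrite mulKg.
by exists (m^-1 * x) => //; rewrite mulVKg.
Qed.

Let lcos_eq a m n : conjset a M (m^-1 * n) ->
  lcos m (conjset a M) = lcos n (conjset a M).
Proof.
move=> Mmn; apply/seteqP; split=> x /lcosE Mx; apply/lcosE.
  rewrite (_ : n^-1 * x = (m^-1 * n)^-1 * (m^-1 * x)); last by gsimp.
  by apply: MaM => //; exact: MaV.
rewrite (_ : m^-1 * x = (m^-1 * n) * (n^-1 * x)); last by gsimp.
exact: MaM.
Qed.

Lemma coord_coset (r : Mbar) (a : Pset) : cosets (val a) (coord r a).
Proof. exact: set_valP. Qed.

Lemma coord_sub (r : Mbar) (a : Pset) m : coord r a m -> M m.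
Proof.
have [k Mk <-] := coord_coset r a => -[_ [n Mn <-] <-].
by apply: MM => //; apply: MP => //; exact: set_valP.
Qed.

Lemma coord_ex (r : Mbar) (a : Pset) : exists m, coord r a m.
Proof. by have [k Mk <-] := coord_coset r a; exists k; apply/lcosE; rewrite mulVg. Qed.

Lemma coordE (r : Mbar) (a : Pset) m : coord r a m ->
  coord r a = lcos m (conjset (val a) M).
Proof.
by have [k Mk <-] := coord_coset r a => /lcosE ?; exact: lcos_eq.
Qed.

Lemma coord_compat (r : Mbar) (a b c : Pset) m : val c = val a * val b ->
  coord r c m -> coord r a m.
Proof.
move=> cE rm; rewrite /coord -(set_valP r a b c cE).
by exists m => //; exists 1 => //; rewrite mulg1.
Qed.

Lemma Mbar_eq (r r' : Mbar) :
  (forall a, exists m, coord r a m /\ coord r' a m) -> r = r'.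
Proof.
move=> rr'; apply: val_inj; apply: functional_extensionality_dep => a.
apply: val_inj; have [m [rm r'm]] := rr' a.
by rewrite -[LHS]/(coord r a) -[RHS]/(coord r' a) (coordE rm) (coordE r'm).
Qed.

Section MkMbar.
Variable f : Pset -> set G.
Hypothesis fcos : forall a, cosets (val a) (f a).
Hypothesis fcompat : forall a b c : Pset, val c = val a * val b ->
  exists2 m, f c m & f a m.

Lemma mk_Mbar_subproof : Mbar_set
  (fun a => SigSub (mem_set (fcos a)) : discrete_topology (cosets (val a))).
Proof.
move=> a b c cE /=.
have [m] := fcompat cE.
have [k Mk <-] := fcos c; have [l Ml <-] := fcos a => /lcosE km /lcosE lm.
rewrite (lcos_eq km) (lcos_eq lm); apply/seteqP; split=> x.
  move=> [_ [y cy <-] [z az <-]]; rewrite -mulgA; exists (y * z) => //.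
  by apply: MaM => //; move: cy; rewrite cE; apply: Ma_sub; exact: set_valP.
move=> [y ay <-]; exists m; first by exists 1 => //; rewrite mulg1.
by exists y.
Qed.

Definition mk_Mbar : Mbar := SigSub (mem_set mk_Mbar_subproof).

End MkMbar.

Lemma iM_subproof1 (m : M) (a : Pset) :
  cosets (val a) (lcos (val m) (conjset (val a) M)).
Proof. by exists (val m) => //; exact: set_valP. Qed.

Lemma iM_subproof2 (m : M) (a b c : Pset) : val c = val a * val b ->
  exists2 k, lcos (val m) (conjset (val c) M) k &
             lcos (val m) (conjset (val a) M) k.
Proof. by move=> _; exists (val m); apply/lcosE; rewrite mulVg. Qed.

(* The embedding of M in its completion. *)
Definition iM (m : M) : Mbar :=
  mk_Mbar (iM_subproof1 m) (@iM_subproof2 m).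

Lemma Mbar_mul_subproof1 (r r' : Mbar) (a : Pset) :
  cosets (val a) (setmul (coord r a) (coord r' a)).
Proof.
have [m rm] := coord_ex r a; have [n r'n] := coord_ex r' a.
have [Mm Mn] := (coord_sub rm, coord_sub r'n).
exists (m * n); first exact: MM.
rewrite (coordE rm) (coordE r'n); apply/seteqP; split=> x.
  move=> [y ay <-]; exists m; first by exists 1 => //; rewrite mulg1.
  by exists (n * y); [exists y|rewrite mulgA].
move=> [_ [y ay <-] [_ [z az <-] <-]]; exists (n^-1 * y * n * z).
  by apply: MaM => //; apply: Ma_normal => //; exact: set_valP.
by rewrite !mulgA mulgK.
Qed.

Lemma Mbar_mul_subproof2 (r r' : Mbar) (a b c : Pset) :
  val c = val a * val b ->
  exists2 k, setmul (coord r c) (coord r' c) k &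
             setmul (coord r a) (coord r' a) k.
Proof.
move=> cE; have [m rm] := coord_ex r c; have [n r'n] := coord_ex r' c.
exists (m * n); first by exists m => //; exists n.
exists m; first exact: coord_compat cE rm.
by exists n => //; exact: coord_compat cE r'n.
Qed.

Definition Mbar_mul (r r' : Mbar) : Mbar :=
  mk_Mbar (Mbar_mul_subproof1 r r') (@Mbar_mul_subproof2 r r').

(* conj_image a K b is the image of the coset K under
   M / M_alpha -> M / M_c -> M / M_b, where c = a alpha. *)
Definition conj_image (a : G) (K : set G) (b : G) : set G :=
  setmul (conjset a K) (conjset b M).

Definition conj_coord (a : Pset) (r : Mbar) (b : Pset) : set G :=
  conj_image (val a) (coord r (sval (ore_right a b)).1) (val b).

Lemma conj_imageE (a b alpha beta : Pset) (r : Mbar) m :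
  val a * val alpha = val b * val beta -> coord r alpha m ->
  conj_image (val a) (coord r alpha) (val b) =
  lcos (val a * m * (val a)^-1) (conjset (val b) M).
Proof.
move=> E rm; rewrite (coordE rm); apply/seteqP; split=> x.
  move=> [_ [_ [_ [y My <-] <-] <-] [z bz <-]]; apply/lcosE.
  set w := (X in conjset _ _ X).
  have -> : w = (val a * val alpha * y * (val a * val alpha)^-1) * z.
    by rewrite /w; gsimp.
  apply: MaM => //; rewrite E; apply: Ma_sub; first exact: (set_valP beta).
  by exists y.
move=> [y by_ <-]; exists (val a * m * (val a)^-1); last by exists y.
exists m => //; apply/lcosE; rewrite mulVg; exact: Ma1.
Qed.

Lemma conj_image_indep (a b alpha beta alpha' beta' : Pset) (r : Mbar) :
  val a * val alpha = val b * val beta ->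
  val a * val alpha' = val b * val beta' ->
  conj_image (val a) (coord r alpha) (val b) =
  conj_image (val a) (coord r alpha') (val b).
Proof.
move=> E E'; have [[d d'] /= dE] := ore_right alpha alpha'.
have [m rm] := coord_ex r (Pmul alpha d).
have rm1 : coord r alpha m by apply: coord_compat rm; exact: erefl.
have rm2 : coord r alpha' m by exact: (coord_compat (c := Pmul alpha d) dE) rm.
by rewrite (conj_imageE E rm1) (conj_imageE E' rm2).
Qed.

Lemma conj_coordE (a b alpha beta : Pset) (r : Mbar) :
  val a * val alpha = val b * val beta ->
  conj_coord a r b = conj_image (val a) (coord r alpha) (val b).
Proof.
move=> E; rewrite /conj_coord; case: ore_right => -[p q] /= E'.
exact: conj_image_indep E' E.
Qed.

Lemma Pact_subproof1 (a : Pset) (r : Mbar) (b : Pset) :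
  cosets (val b) (conj_coord a r b).
Proof.
rewrite /conj_coord; case: ore_right => -[p q] /= E.
have [m rm] := coord_ex r p; rewrite (conj_imageE E rm).
exists (val a * m * (val a)^-1) => //; apply: MP; first exact: set_valP.
exact: coord_sub rm.
Qed.

Lemma Pact_subproof2 (a : Pset) (r : Mbar) (b c d : Pset) :
  val d = val b * val c ->
  exists2 k, conj_coord a r d k & conj_coord a r b k.
Proof.
move=> dE; have [[p q] /= E] := ore_right a d.
have E' : val a * val p = val b * val (Pmul c q) by rewrite E dE /= mulgA.
have [m rm] := coord_ex r p.
exists (val a * m * (val a)^-1).
  by rewrite (conj_coordE r E) (conj_imageE E rm); apply/lcosE; rewrite mulVg.
by rewrite (conj_coordE r E') (conj_imageE E' rm); apply/lcosE; rewrite mulVg.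
Qed.

(* The element a r a^{-1} of the completion. *)
Definition Pact (a : Pset) (r : Mbar) : Mbar :=
  mk_Mbar (Pact_subproof1 a r) (@Pact_subproof2 a r).

Lemma Pact_coord (a b alpha beta : Pset) (r : Mbar) :
  val a * val alpha = val b * val beta ->
  coord (Pact a r) b = conj_image (val a) (coord r alpha) (val b).
Proof. exact: conj_coordE. Qed.

Lemma Pact_mem (a b alpha beta : Pset) (r : Mbar) m :
  val a * val alpha = val b * val beta -> coord r alpha m ->
  coord (Pact a r) b (val a * m * (val a)^-1).
Proof.
move=> E rm; rewrite (Pact_coord r E) (conj_imageE E rm).
by apply/lcosE; rewrite mulVg.
Qed.

Lemma Pact1 (r : Mbar) : Pact Pone r = r.
Proof.
apply: Mbar_eq => a; have [m rm] := coord_ex r a; exists m; split=> //.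
have E : val Pone * val a = val a * val Pone by rewrite /= mul1g mulg1.
by have := Pact_mem E rm; rewrite /= invg1 mul1g mulg1.
Qed.

Lemma PactM (a b c : Pset) (r : Mbar) : val c = val a * val b ->
  Pact c r = Pact a (Pact b r).
Proof.
move=> cE; apply: Mbar_eq => d.
have [[p q] /= E1] := ore_right a d.
have [[p' q'] /= E2] := ore_right b p.
have [m rm] := coord_ex r p'; exists (val c * m * (val c)^-1); split.
  apply: (@Pact_mem c d p' (Pmul q q')) => //=.
  by rewrite cE mulgA -E1 -!mulgA E2.
have := Pact_mem E1 (Pact_mem E2 rm); rewrite cE.
by congr (coord _ _ _); gsimp.
Qed.

Lemma Pact_iM (a : Pset) (m : M) : Pact a (iM m) = iM (Mconj a m).
Proof.
apply: Mbar_eq => b; have [[p q] /= E] := ore_right a b.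
exists (val a * val m * (val a)^-1); split.
  by apply: Pact_mem E _; apply/lcosE; rewrite mulVg.
by apply/lcosE; rewrite mulVg.
Qed.

Lemma Pact_mul (a : Pset) (r r' : Mbar) :
  Pact a (Mbar_mul r r') = Mbar_mul (Pact a r) (Pact a r').
Proof.
apply: Mbar_eq => b; have [[p q] /= E] := ore_right a b.
have [m rm] := coord_ex r p; have [n r'n] := coord_ex r' p.
exists (val a * (m * n) * (val a)^-1); split.
  by apply: Pact_mem E _; exists m => //; exists n.
exists (val a * m * (val a)^-1); first exact: Pact_mem E rm.
exists (val a * n * (val a)^-1); first exact: Pact_mem E r'n.
by gsimp.
Qed.

Definition Npre : topologicalType := (Mbar * discrete_topology Pset)%type.

Definition Nrel (p q : Npre) : bool := `[< exists alpha beta : Pset,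
  val alpha * val (p.2 : Pset) = val beta * val (q.2 : Pset) /\
  Pact alpha p.1 = Pact beta q.1 >].

Lemma Nrel_equiv : equiv_class_of Nrel.
Proof.
split=> [[x a]|[x a] [y b]|[y b] [x a] [z c]].
- by apply/asboolP; exists Pone, Pone.
- by apply/asboolP/asboolP => -[al [be [E1 E2]]]; exists be, al.
move=> /asboolP[al [be /= [E1 E2]]] /asboolP[ga [de /= [E3 E4]]].
have [[p q] /= E] := ore_left be ga; apply/asboolP.
exists (Pmul p al), (Pmul q de) => /=; split.
  by rewrite -!mulgA E1 -E3 !mulgA E.
rewrite (@PactM p al (Pmul p al)) // (@PactM q de (Pmul q de)) // E2 -E4.
by rewrite -(@PactM p be (Pmul p be)) //; exact: PactM.
Qed.

Canonical Nrel_equiv_rel := EquivRelPack Nrel_equiv.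

Definition Nbar : topologicalType :=
  quotient_topology {eq_quot Nrel_equiv_rel}.

Definition Ncl (x : Mbar) (a : Pset) : Nbar :=
  (\pi_({eq_quot Nrel_equiv_rel}) ((x, a) : Npre))%qT.

Lemma Ncl_eq (x y : Mbar) (a b : Pset) :
  Ncl x a = Ncl y b <-> exists alpha beta : Pset,
    val alpha * val a = val beta * val b /\ Pact alpha x = Pact beta y.
Proof.
split=> [/eqquotP/asboolP//|E].
by apply/eqquotP/asboolP.
Qed.

Lemma Ncl_repr (X : Nbar) : {p : Mbar * Pset | X = Ncl p.1 p.2}.
Proof.
exists (repr (X : {eq_quot Nrel_equiv_rel})); rewrite /Ncl.
by rewrite -surjective_pairing; apply/esym; exact: reprK.
Qed.

(* The embedding of Mbar in Nbar. *)
Definition iN (x : Mbar) : Nbar := Ncl x Pone.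

(* Representatives and common multiples are choices; NphiE, Nphi_invE and NpsiE
   show that they are irrelevant. *)
Definition Nphi (a : Pset) (X : Nbar) : Nbar :=
  let: (x, b) := sval (Ncl_repr X) in
  let: (alpha, beta) := sval (ore_left a b) in
  Ncl (Pact beta x) alpha.

Definition Nphi_inv (a : Pset) (X : Nbar) : Nbar :=
  let: (x, b) := sval (Ncl_repr X) in Ncl x (Pmul b a).

Definition Npsi (m : M) (X : Nbar) : Nbar :=
  let: (x, a) := sval (Ncl_repr X) in Ncl (Mbar_mul (iM (Mconj a m)) x) a.

Lemma NphiE (a alpha beta b : Pset) (x : Mbar) :
  val alpha * val a = val beta * val b ->
  Nphi a (Ncl x b) = Ncl (Pact beta x) alpha.
Proof.
move=> E; rewrite /Nphi; case: Ncl_repr => -[y c] /= /Ncl_eq[ga [de [E1 E2]]].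
case: ore_left => -[al' be'] /= E3; apply/Ncl_eq.
have [[p q] /= E4] := ore_left al' alpha.
have E5 : val (Pmul p be') * val c = val (Pmul q beta) * val b.
  by rewrite /= -!mulgA -E3 -E !mulgA E4.
have [[t w] /= E6] := ore_left (Pmul q beta) ga.
exists (Pmul t p), (Pmul t q) => /=; split; first by rewrite -!mulgA E4.
rewrite -(@PactM _ _ (Pmul (Pmul t p) be')) //.
rewrite -(@PactM _ _ (Pmul (Pmul t q) beta)) //.
rewrite (@PactM w ga (Pmul (Pmul t q) beta) x); last by rewrite /= -E6 /= mulgA.
rewrite E2; apply: PactM => /=; apply: (@mulIg _ (val c)).
transitivity (val w * (val ga * val b)); last by rewrite E1 mulgA.
rewrite mulgA -E6 /= -(mulgA (val t) (val q * _)) -[in RHS]E5 /=.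
by rewrite !mulgA.
Qed.

Lemma Nphi_invE (a b : Pset) (x : Mbar) :
  Nphi_inv a (Ncl x b) = Ncl x (Pmul b a).
Proof.
rewrite /Nphi_inv; case: Ncl_repr => -[y c] /= /Ncl_eq[ga [de [E1 E2]]].
by apply/Ncl_eq; exists de, ga; rewrite /= !mulgA E1 E2.
Qed.

Lemma NpsiE (m : M) (a : Pset) (x : Mbar) :
  Npsi m (Ncl x a) = Ncl (Mbar_mul (iM (Mconj a m)) x) a.
Proof.
rewrite /Npsi; case: Ncl_repr => -[y c] /= /Ncl_eq[ga [de [E1 E2]]].
apply/Ncl_eq; exists de, ga; split=> //; rewrite !Pact_mul !Pact_iM E2.
congr (Mbar_mul (iM _) _); apply: val_inj => /=.
rewrite -[RHS](_ : (val ga * val a) * val m * (val ga * val a)^-1 = _).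
  by rewrite E1; gsimp.
by gsimp.
Qed.

Lemma Nphi_invK (a : Pset) : cancel (Nphi_inv a) (Nphi a).
Proof.
move=> X; have [[x b] /= ->] := Ncl_repr X; rewrite Nphi_invE.
by rewrite (@NphiE _ b Pone) ?Pact1 //= mul1g.
Qed.

Lemma NphiK (a : Pset) : cancel (Nphi a) (Nphi_inv a).
Proof.
move=> X; have [[x b] /= ->] := Ncl_repr X.
have [[al be] /= E] := ore_left a b.
rewrite (NphiE _ E) Nphi_invE; apply/Ncl_eq; exists Pone, be.
by rewrite /= mul1g Pact1.
Qed.

Lemma NphiM (a b c : Pset) (X : Nbar) : val c = val a * val b ->
  Nphi c X = Nphi a (Nphi b X).
Proof.
move=> cE; have [[x d] /= ->] := Ncl_repr X.
have [[al be] /= E] := ore_left b d; rewrite (NphiE _ E).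
have [[ga de] /= E'] := ore_left a al; rewrite (NphiE _ E').
rewrite (@NphiE _ ga (Pmul de be)); last by rewrite cE /= mulgA E' -!mulgA E.
by congr Ncl; exact: PactM.
Qed.

Lemma Nphi_psi (a : Pset) (m : M) (X : Nbar) :
  Nphi a (Npsi m X) = Npsi (Mconj a m) (Nphi a X).
Proof.
have [[x d] /= ->] := Ncl_repr X.
have [[al be] /= E] := ore_left a d; rewrite NpsiE !(NphiE _ E) NpsiE.
congr Ncl; rewrite Pact_mul Pact_iM; congr (Mbar_mul (iM _) _).
apply: val_inj => /=.
rewrite -[LHS](_ : (val be * val d) * val m * (val be * val d)^-1 = _).
  by rewrite -E; gsimp.
by gsimp.
Qed.

Lemma G_decomp (g : G) :
  {t : Pset * M * Pset | g = (val t.1.1)^-1 * val t.1.2 * val t.2}.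
Proof.
apply/cid; have : [set: G] g by [].
rewrite -(CL_NH_full h) => -[n Nn [k Hk <-]].
move: Nn; rewrite {1}(CL_N_union h) => -[a Pa [m Mm <-]].
move: Hk; rewrite {1}(CL_H_PVP h) => -[c Pc [d Pd <-]].
have [[p q] /= E] := ore_left (SigSub (mem_set Pa)) (SigSub (mem_set Pc)).
have Mpm : M (val p * m * (val p)^-1) by apply: MP => //; exact: set_valP.
exists (Pmul p (SigSub (mem_set Pa)), SigSub (mem_set Mpm),
        Pmul q (SigSub (mem_set Pd))) => /=.
have -> : val q = val p * a * c^-1 by rewrite E mulgK.
by gsimp.
Qed.

(* The decomposition g = a^{-1} m b is a choice; gactE shows that it is
   irrelevant. *)
Definition gact (g : G) (X : Nbar) : Nbar :=
  let: (a, m, b) := sval (G_decomp g) in Nphi_inv a (Npsi m (Nphi b X)).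

Let NV x : N x -> N x^-1. Proof. by move/(NB N1); rewrite mul1g. Qed.

Lemma NH_uniq (n n' k k' : G) : N n -> N n' -> H k -> H k' ->
  n * k = n' * k' -> n = n' /\ k = k'.
Proof.
move=> Nn Nn' Hk Hk' E; suff kk : k = k' by move: E; rewrite kk => /mulIg.
have : (N `&` H) (k / k').
  split; last exact: HB.
  have -> : k / k' = n^-1 / n'^-1.
    rewrite invgK; apply: (mulgI n); rewrite mulVKg.
    by apply: (mulIg k'); rewrite -mulgA mulgVK.
  by apply: NB; exact: NV.
by rewrite (CL_NH_disjoint h) => /divg1_eq.
Qed.

Lemma gactE (a b : Pset) (m : M) (X : Nbar) :
  gact ((val a)^-1 * val m * val b) X = Nphi_inv a (Npsi m (Nphi b X)).
Proof.
have red (p c d : Pset) (n : M) : Nphi_inv c (Npsi n (Nphi d X)) =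
    Nphi_inv (Pmul p c) (Npsi (Mconj p n) (Nphi (Pmul p d) X)).
  apply: (can_inj (NphiK (Pmul p c))); rewrite Nphi_invK.
  rewrite (@NphiM p c (Pmul p c)) // Nphi_invK Nphi_psi.
  by rewrite -(@NphiM p d (Pmul p d)).
rewrite /gact; case: G_decomp => -[[c n] d] /= E.
have [[p q] /= E'] := ore_left c a.
rewrite (red p c) (red q a); have -> : Pmul p c = Pmul q a by exact: val_inj.
have NM (k : M) : N (val k) by apply: (CL_M_sub h); exact: set_valP.
have HP (k : Pset) : H (val k) by case: (set_valP k).
have [E1 E2] : val (Mconj p n) = val (Mconj q m) /\
               val (Pmul p d) = val (Pmul q b).
  apply: (NH_uniq (NM (Mconj p n)) (NM (Mconj q m))
                  (HP (Pmul p d)) (HP (Pmul q b))) => /=.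
  have -> : val p * val n * (val p)^-1 * (val p * val d) =
      val p * val c * ((val c)^-1 * val n * val d) by gsimp.
  by rewrite -E E'; gsimp.
by rewrite (val_inj E1) (val_inj E2).
Qed.

End Setting.
End GroupData.

(* A groupoid is given by the graphs of its partial product and of its
   inverse: gmul g h k means that (g, h) is composable with product k. *)
Record groupoid_data := GroupoidData {
  gcar :> topologicalType ;
  gmul : gcar -> gcar -> gcar -> Prop ;
  ginv : gcar -> gcar -> Prop
}.

Definition topological_groupoid_iso (X Y : groupoid_data) (f : X -> Y) : Prop :=
  [/\ (exists2 g : Y -> X, cancel f g /\ cancel g f & continuous g),
      continuous f,
      (forall x y z : X, gmul x y z <-> gmul (f x) (f y) (f z)) &
      (forall x y : X, ginv x y <-> ginv (f x) (f y))].

Section TransformationGroupoid.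
Local Open Scope group_scope.
Variables (G : groupType) (N H M : set G) (h : CuntzLi_setting N H M).

Definition NG : topologicalType := (Nbar h * discrete_topology G)%type.

(* The right action x.g = g^{-1} x. *)
Definition gact_right (x : Nbar h) (g : G) : Nbar h := gact g^-1 x.

Definition NG_restriction_set : set NG :=
  [set p | range (iN h) p.1 /\ range (iN h) (gact_right p.1 p.2)].

Definition NG_restriction : groupoid_data :=
  @GroupoidData NG_restriction_set
    (fun p q r => (val q).1 = gact_right (val p).1 (val p).2 /\
       val r = ((val p).1, ((val p).2 : G) * (val q).2))
    (fun p q => val q = (gact_right (val p).1 (val p).2, ((val p).2 : G)^-1)).

End TransformationGroupoid.

Local Open Scope ring_scope.

(* Unital C*-algebras over the complex numbers R[i]; they are nonzero, like all
   algebras of the library. *)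
HB.mixin Record Algebra_isCStarAlgebra (R : realType) (A : Type)
    of GRing.Algebra R[i] A := {
  star : A -> A ;
  cnorm : A -> R ;
  starK : involutive star ;
  starD : {morph star : x y / x + y} ;
  starZ : forall (c : R[i]) (x : A), star (c *: x) = conjc c *: star x ;
  starM : forall x y : A, star (x * y) = star y * star x ;
  cnorm_eq0 : forall x : A, cnorm x = 0 -> x = 0 ;
  cnormD : forall x y : A, cnorm (x + y) <= cnorm x + cnorm y ;
  cnormZ : forall (c : R[i]) (x : A),
    cnorm (c *: x) = ComplexField.Normc.normc c * cnorm x ;
  cnormM : forall x y : A, cnorm (x * y) <= cnorm x * cnorm y ;
  cnorm_star : forall x : A, cnorm (star x * x) = cnorm x ^+ 2 ;
  cnorm_complete : forall x : nat -> A,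
    (forall e : R, 0 < e -> exists n0 : nat, forall m n : nat,
       (n0 <= m)%N -> (n0 <= n)%N -> cnorm (x m - x n) < e) ->
    exists l : A, forall e : R, 0 < e -> exists n0 : nat, forall n : nat,
       (n0 <= n)%N -> cnorm (x n - l) < e
}.

#[short(type="cstarAlgType")]
HB.structure Definition CStarAlgebra (R : realType) :=
  {A of GRing.Algebra R[i] A & Algebra_isCStarAlgebra R A}.

Section CuntzLiAlgebra.
Variables (R : realType) (G : groupType) (H M : set G).
Local Notation P := (Pset H M).

Section Relations.
Variables (A : cstarAlgType R) (s : P -> A) (u : M -> A).

Definition erange (a : P) : A := s a * star (s a).

(* ks lists, without repetition, one representative of each coset in M/M_a. *)
Definition transversal (a : P) (ks : seq M) : Prop :=
  [/\ uniq ks,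
      (forall m : M, exists2 k, k \in ks &
         conjset (val a) M ((val k)^-1 * val m)%g) &
      (forall k l : M, k \in ks -> l \in ks ->
         conjset (val a) M ((val k)^-1 * val l)%g -> k = l)].

Record CuntzLi_relations : Prop := {
  CLr_isometry : forall a : P, star (s a) * s a = 1 ;
  CLr_unitary : forall m : M, star (u m) * u m = 1 /\ u m * star (u m) = 1 ;
  CLr_sM : forall a b c : P, val c = (val a * val b)%g -> s a * s b = s c ;
  CLr_uM : forall m n k : M, val k = (val m * val n)%g -> u m * u n = u k ;
  CLr_su : forall (a : P) (m n : M), val n = (val a * val m * (val a)^-1)%g ->
    s a * u m = u n * s a ;
  CLr_sum : forall (a : P) (ks : seq M), transversal a ks ->
    \sum_(k <- ks) u k * erange a * star (u k) = 1
}.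

End Relations.

(* (A, s, u) is the universal C*-algebra of the relations. *)
Record CuntzLi_universal (A : cstarAlgType R) (s : P -> A) (u : M -> A) :
    Prop := {
  CLu_relations : CuntzLi_relations s u ;
  CLu_exists : forall (B : cstarAlgType R) (t : P -> B) (v : M -> B),
    CuntzLi_relations t v ->
    exists f : {lrmorphism A -> B}, [/\ {morph f : x / star x},
      (forall a, f (s a) = t a) & (forall m, f (u m) = v m)] ;
  CLu_unique : forall (B : cstarAlgType R) (f g : {lrmorphism A -> B}),
    {morph f : x / star x} -> {morph g : x / star x} ->
    (forall a, f (s a) = g (s a)) -> (forall m, f (u m) = g (u m)) -> f =1 g
}.

Section TightGroupoid.
Variables (A : cstarAlgType R) (s : P -> A) (u : M -> A).

Definition Fspan : set A := [set f | exists (n : nat) (c : 'I_n -> R[i])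
  (k : 'I_n -> M) (b : 'I_n -> P),
  f = \sum_(i < n) c i *: (u (k i) * erange s (b i) * star (u (k i)))].

Definition Fset : set A := [set f | [/\ Fspan f, f * f = f & star f = f]].

Definition Tset : set A := [set t | exists (a a' : P) (m m' : M) (f : A),
  Fset f /\ t = star (s a) * u m * f * u m' * s a'].

Definition Fchar : topologicalType := {ptws Fset -> bool}.

(* supp x f says that f lies in F and x(f) = 1. *)
Definition supp (x : Fchar) : set A :=
  [set val f | f in [set f : Fset | x f]].

(* Characters of F, as a subset of {0,1}^F. *)
Definition Fhat : set Fchar := [set x : Fchar |
  [/\ exists f : Fset, x f,
      (forall f g k : Fset, val k = val f * val g -> x k = x f && x g) &
      (forall z : Fset, val z = 0 -> x z = false)]].

Definition Fmax : set Fchar := [set x : Fchar | Fhat x /\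
  forall y, Fhat y -> supp x `<=` supp y -> supp x = supp y].

Definition Ftight : set Fchar := Fhat `&` closure Fmax.

Definition Dset (t : A) : set Fchar := [set x : Fchar | Fhat x /\ supp x (t * star t)].

Definition char_act (x : Fchar) (t : A) : Fchar :=
  fun f : Fset => `[< supp x (t * val f * star t) >].

Definition Sigma : set (Fchar * A) := [set p | Tset p.2 /\ Dset p.2 p.1].

Definition germ_rel (p q : Fchar * A) : Prop :=
  p.1 = q.1 /\ exists f : A, supp p.1 f /\ f * p.2 = f * q.2.

(* The class of (x,t) in Sigma, as the set of its elements. *)
Definition germ (x : Fchar) (t : A) : set (Fchar * A) :=
  [set q | Sigma q /\ germ_rel (x, t) q].

Definition germs : Type := [set germ p.1 p.2 | p in Sigma].

HB.instance Definition _ := Choice.on germs.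

Definition germ_val (g : germs) : set (Fchar * A) := val g.

(* The sets {[(x,t)] : x in U}, for t in T and U a subset of D_t which is open
   in the space Fhat; they are a basis of the topology they generate. *)
Definition germ_basis : set (set germs) := [set B | exists t U V,
  [/\ Tset t, open V, U = V `&` Fhat, U `<=` Dset t &
      B = [set g | exists2 x, U x & germ_val g = germ x t]]].

HB.instance Definition _ := isSubBaseTopological.Build germs germ_basis id.

Definition Gtight_set : set germs := [set g | exists x t,
  [/\ Sigma (x, t), germ_val g = germ x t, Ftight x & Ftight (char_act x t)]].

Definition Gtight : groupoid_data :=
  @GroupoidData Gtight_set
    (fun g1 g2 g3 => exists x t y w, [/\ Sigma (x, t) /\ Sigma (y, w),
       germ_val (val g1) = germ x t, germ_val (val g2) = germ y w,
       y = char_act x t & germ_val (val g3) = germ x (t * w)])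
    (fun g1 g2 => exists x t, [/\ Sigma (x, t), germ_val (val g1) = germ x t &
       germ_val (val g2) = germ (char_act x t) (star t)]).

(* The indicator function of A_r; f >= p is the order of projections, fp = p. *)
Definition Mbar_char (r : Mbar H M) : Fchar := fun f : Fset =>
  `[< exists (a : P) (k : M), coord r a (val k) /\
      val f * (u k * erange s a * star (u k)) = u k * erange s a * star (u k) >].

End TightGroupoid.
End CuntzLiAlgebra.

Arguments Sigma {R G H M A} s u.
Arguments germ {R G H M A} s u x t.
Arguments Mbar_char {R G H M A} s u r.

(* Main.v *)
(* Every element of T is f t_g with f in F, where t_g = s_a^* u(m) s_b depends
   only on g = a^{-1} m b.  For r in the completion of M, the character of r
   contains t_g t_g^* iff r.g is again a point y of that completion, and t_g then
   carries the character of r to the character of y; hence phi is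
   (r, g) |-> [(r, t_g)], and it is onto because the tight characters are exactly
   those of the points r.  It is injective because A maps to the operators on
   l2(M x G) that arise from s_a (n, k) = (a n a^{-1}, a k) and
   u(m) (n, k) = (m n, m k), in which t_g shifts the G-coordinate by g. *)

(* [A] is known only through its universal property, so two of its words can be told apart only in a
   concrete C*-algebra that satisfies the relations. This is why bounded operators on l2 are
   constructed in full, with adjoint, norm and completeness. The M-coordinate realizes the coset
   relations, the G-coordinate separates the t_g. From the resulting map one retains only that an
   element of A with two different degrees cannot be compressed to 1.

   The relations say that the projections u(k) e_a u(k)^{-1}, k in M/M_a, sum to 1; their
   orthogonality has to be derived, here from norm estimates. Once it is known, each f in F is a
   combination of projections of a single level a, because H = PP^{-1} lets two levels be refined to
   a common one. Questions about F, its characters and the topologies are then decided at one fine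
   enough level: f has the value 0 or 1 on each projection of that level, and a point r of the
   completion selects exactly one of them through its coordinate r_a. *)
Require Import Defs.
From HB Require Import structures.
From mathcomp Require Import all_boot all_order all_algebra generic_quotient.
From mathcomp Require Import all_classical all_reals all_analysis.
From mathcomp Require Import finmap complex ring lra.

Set Implicit Arguments.
Unset Strict Implicit.
Unset Printing Implicit Defensive.

Import Order.TTheory GRing.Theory Num.Theory.
Import numFieldNormedType.Exports.

Local Open Scope ring_scope.

(** * Bounded operators on a Hilbert space form a C*-algebra *)

(* Only the real part [rip] of the inner product is recorded; [ripZl] makes it
   the real part of a sesquilinear form. *)
Record hilbertSpace (R : realType) := HilbertSpace {
  hcar :> lmodType R[i] ;
  rip : hcar -> hcar -> R ;
  ripC : forall x y, rip x y = rip y x ;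
  ripDl : forall x y z, rip (x + y) z = rip x z + rip y z ;
  ripZl : forall c x y, rip (c *: x) y = rip x (conjc c *: y) ;
  ripRl : forall (c : R) x y, rip (c%:C%C *: x) y = c * rip x y ;
  rip_ge0 : forall x, 0 <= rip x x ;
  rip_eq0 : forall x, rip x x = 0 -> x = 0 ;
  hilbert_nontrivial : exists x : hcar, x <> 0 ;
  hilbert_complete : forall x : nat -> hcar,
    (forall e : R, 0 < e -> exists n0 : nat, forall m n : nat,
       (n0 <= m)%N -> (n0 <= n)%N -> rip (x m - x n) (x m - x n) < e) ->
    exists l : hcar, forall e : R, 0 < e -> exists n0 : nat, forall n : nat,
       (n0 <= n)%N -> rip (x n - l) (x n - l) < e
}.

Section HilbertTheory.
Variables (R : realType) (E : hilbertSpace R).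
Implicit Types (x y z : E) (c : R[i]).

Definition hnorm x := Num.sqrt (rip x x).

Lemma ripDr x y z : rip x (y + z) = rip x y + rip x z.
Proof. by rewrite ripC ripDl !(ripC x). Qed.

Lemma rip0l y : rip 0 y = 0.
Proof. by apply: (addrI (rip 0 y)); rewrite -ripDl !addr0. Qed.

Lemma ripNl x y : rip (- x) y = - rip x y.
Proof. by apply: (addrI (rip x y)); rewrite -ripDl !subrr rip0l. Qed.

Lemma ripBl x y z : rip (x - y) z = rip x z - rip y z.
Proof. by rewrite ripDl ripNl. Qed.

Lemma ripBr x y z : rip x (y - z) = rip x y - rip x z.
Proof. by rewrite ripC ripBl !(ripC x). Qed.

Lemma ripRr (c : R) x y : rip x (c%:C%C *: y) = c * rip x y.
Proof. by rewrite ripC ripRl ripC. Qed.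

Lemma ripZr c x y : rip x (c *: y) = rip (conjc c *: x) y.
Proof. by rewrite ripZl conjcK. Qed.

Lemma rip_inj x y : (forall z, rip x z = rip y z) -> x = y.
Proof.
by move=> xy; apply/subr0_eq/rip_eq0; rewrite ripBl !ripBr !xy subrr.
Qed.

Lemma hnorm_ge0 x : 0 <= hnorm x. Proof. exact: sqrtr_ge0. Qed.

Lemma hnorm_sqr x : hnorm x ^+ 2 = rip x x.
Proof. by rewrite sqr_sqrtr // rip_ge0. Qed.

Lemma hnorm0 : hnorm 0 = 0. Proof. by rewrite /hnorm rip0l sqrtr0. Qed.

Lemma hnorm_eq0 x : hnorm x = 0 -> x = 0.
Proof. by move=> x0; apply: rip_eq0; rewrite -hnorm_sqr x0 expr0n. Qed.

Lemma hnormN x : hnorm (- x) = hnorm x.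
Proof. by rewrite /hnorm ripNl ripC ripNl opprK. Qed.

(** Cauchy-Schwarz for the real form: expand the nonnegative square of x minus its real projection
    onto y. *)
Lemma rip_le_hnorm x y : `|rip x y| <= hnorm x * hnorm y.
Proof.
have [y0|y_neq0] := eqVneq (rip y y) 0.
  by rewrite (rip_eq0 y0) ripC rip0l normr0 mulr_ge0 ?hnorm_ge0.
have y_gt0 : 0 < rip y y by rewrite lt_def y_neq0 rip_ge0.
rewrite -(@ler_pXn2r _ 2) ?nnegrE ?mulr_ge0 ?hnorm_ge0 //.
rewrite exprMn !hnorm_sqr real_normK ?num_real //.
have := rip_ge0 (x - (rip x y / rip y y)%:C%C *: y).
rewrite !(ripBl, ripBr, ripRl, ripRr) (ripC y x).
set a := rip x x; set b := rip x y; set d := rip y y in y_neq0 y_gt0 *.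
have -> : a - b / d * b - b / d * (b - b / d * d) = (a * d - b ^+ 2) / d.
  by field.
by rewrite pmulr_lge0 ?invr_gt0 // subr_ge0.
Qed.

Lemma hnormD x y : hnorm (x + y) <= hnorm x + hnorm y.
Proof.
rewrite -(@ler_pXn2r _ 2) ?nnegrE ?addr_ge0 ?hnorm_ge0 //.
rewrite hnorm_sqr ripDl !ripDr (ripC y x) sqrrD !hnorm_sqr.
have := le_trans (ler_norm _) (rip_le_hnorm x y); lra.
Qed.

Lemma hnormB x y : hnorm (x - y) <= hnorm x + hnorm y.
Proof. by rewrite -(hnormN y) hnormD. Qed.

Lemma conjc_mul_normc c :
  conjc c * c = (ComplexField.Normc.normc c ^+ 2)%:C%C.
Proof.
case: c => a b /=; rewrite sqr_sqrtr ?addr_ge0 ?sqr_ge0 //.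
by apply/eqP; rewrite eq_complex /=; apply/andP; split; apply/eqP; ring.
Qed.

Lemma normc_ge0 c : 0 <= ComplexField.Normc.normc c.
Proof. by case: c => a b; exact: sqrtr_ge0. Qed.

Lemma hnormZ c x : hnorm (c *: x) = ComplexField.Normc.normc c * hnorm x.
Proof.
apply/eqP; rewrite -(@eqrXn2 _ 2) ?mulr_ge0 ?hnorm_ge0 ?normc_ge0 //.
by rewrite exprMn !hnorm_sqr ripZl scalerA conjc_mul_normc ripRr.
Qed.

End HilbertTheory.

Section BoundedOperators.
Variables (R : realType) (E : hilbertSpace R).

(** Carrying the adjoint as data makes [star] explicit and makes additivity a consequence ([bfunD]),
    so homogeneity is the only linearity field. *)
Record bop := Bop {
  bfun : E -> E ;
  badj : E -> E ;
  bfun_adj : forall x y, rip (bfun x) y = rip x (badj y) ;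
  bfunZ : forall c x, bfun (c *: x) = c *: bfun x ;
  bfun_bounded : exists2 C : R, 0 <= C & forall x, hnorm (bfun x) <= C * hnorm x
}.

HB.instance Definition _ := gen_eqMixin bop.
HB.instance Definition _ := gen_choiceMixin bop.

(** The adjoint is determined by the operator, and the remaining fields are propositions. *)
Lemma bopP (S T : bop) : bfun S =1 bfun T -> S = T.
Proof.
move=> ST; have ST' : badj S = badj T.
  apply: funext => y; apply: rip_inj => x.
  by rewrite ![rip _ x]ripC -!bfun_adj ST.
case: S T ST ST' => f f' a l b [g g' a' l' b'] /= /funext fg fg'.
by case: _ / fg a' l' b'; case: _ / fg' => *; congr Bop; exact: Prop_irrelevance.
Qed.

Lemma bfun_adjr (T : bop) x y : rip x (bfun T y) = rip (badj T x) y.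
Proof. by rewrite ripC bfun_adj ripC. Qed.

Lemma bfunD (T : bop) x y : bfun T (x + y) = bfun T x + bfun T y.
Proof.
by apply: rip_inj => z; rewrite ripDl !bfun_adj ripDl.
Qed.

Lemma bfun0 (T : bop) : bfun T 0 = 0.
Proof. by apply: (addrI (bfun T 0)); rewrite -bfunD !addr0. Qed.

Definition bnorm (T : bop) : R :=
  inf [set C : R | 0 <= C /\ forall x, hnorm (bfun T x) <= C * hnorm x].

Lemma bnorm_le (T : bop) C : 0 <= C ->
  (forall x, hnorm (bfun T x) <= C * hnorm x) -> bnorm T <= C.
Proof. by move=> C0 TC; apply: ge_inf => //; exists 0 => ? []. Qed.

Lemma bnorm_ge0 (T : bop) : 0 <= bnorm T.
Proof.
by apply: lb_le_inf => [|? []//]; have [C C0 TC] := bfun_bounded T; exists C.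
Qed.

Lemma le_bnorm (T : bop) x : hnorm (bfun T x) <= bnorm T * hnorm x.
Proof.
have [x0|x_neq0] := eqVneq (hnorm x) 0.
  by rewrite x0 (hnorm_eq0 x0) bfun0 hnorm0 mulr0.
have x_gt0 : 0 < hnorm x by rewrite lt_def x_neq0 hnorm_ge0.
rewrite -ler_pdivrMr //; apply: lb_le_inf => [|C [_ TC]].
  by have [C C0 TC] := bfun_bounded T; exists C.
by rewrite ler_pdivrMr.
Qed.

(** With S the adjoint of T, |Sx|^2 = <TSx, x> <= |T| |Sx| |x|; divide by |Sx|. *)
Lemma badj_bounded (T : bop) x : hnorm (badj T x) <= bnorm T * hnorm x.
Proof.
have [x0|x_neq0] := eqVneq (hnorm (badj T x)) 0.
  by rewrite x0 mulr_ge0 ?bnorm_ge0 ?hnorm_ge0.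
have x_gt0 : 0 < hnorm (badj T x) by rewrite lt_def x_neq0 hnorm_ge0.
rewrite -(ler_pM2r x_gt0) -expr2 hnorm_sqr -bfun_adj.
apply: le_trans (le_trans (ler_norm _) (rip_le_hnorm _ _)) _.
by rewrite mulrAC ler_wpM2r ?hnorm_ge0 // le_bnorm.
Qed.

Lemma badjZ (T : bop) c x : badj T (c *: x) = c *: badj T x.
Proof.
apply: rip_inj => y; rewrite ripC -bfun_adj ripZr -bfunZ bfun_adj.
by rewrite -ripZr ripC.
Qed.

Lemma boundedI (f : E -> E) (C : R) : 0 <= C ->
  (forall x, hnorm (f x) <= C * hnorm x) ->
  exists2 C : R, 0 <= C & forall x, hnorm (f x) <= C * hnorm x.
Proof. by exists C. Qed.

Definition bstar (T : bop) : bop :=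
  Bop (fun x y => esym (bfun_adjr T x y)) (badjZ T)
      (boundedI (bnorm_ge0 T) (badj_bounded T)).

Lemma bzero_adj (x y : E) : rip (0 : E) y = rip x 0.
Proof. by rewrite rip0l ripC rip0l. Qed.

Lemma bzeroZ c (x : E) : 0 = c *: (0 : E).
Proof. by rewrite scaler0. Qed.

Lemma bzero_bounded :
  exists2 C : R, 0 <= C & forall x : E, hnorm (0 : E) <= C * hnorm x.
Proof. by exists 0 => // x; rewrite hnorm0 mul0r. Qed.

Definition bzero : bop :=
  @Bop (fun=> 0) (fun=> 0) bzero_adj bzeroZ bzero_bounded.

Lemma bone_bounded :
  exists2 C : R, 0 <= C & forall x : E, hnorm x <= C * hnorm x.
Proof. by exists 1 => // x; rewrite mul1r. Qed.

Definition bone : bop :=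
  @Bop id id (fun _ _ => erefl) (fun _ _ => erefl) bone_bounded.

Lemma badd_adj (S T : bop) x y :
  rip (bfun S x + bfun T x) y = rip x (badj S y + badj T y).
Proof. by rewrite ripDl ripDr !bfun_adj. Qed.

Lemma baddZ (S T : bop) c x :
  bfun S (c *: x) + bfun T (c *: x) = c *: (bfun S x + bfun T x).
Proof. by rewrite !bfunZ scalerDr. Qed.

Lemma badd_le (S T : bop) x :
  hnorm (bfun S x + bfun T x) <= (bnorm S + bnorm T) * hnorm x.
Proof.
by apply: le_trans (hnormD _ _) _; rewrite mulrDl lerD ?le_bnorm.
Qed.

Definition badd (S T : bop) : bop :=
  Bop (badd_adj S T) (baddZ S T)
      (boundedI (addr_ge0 (bnorm_ge0 S) (bnorm_ge0 T)) (badd_le S T)).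

Lemma bscale_adj k (T : bop) x y :
  rip (k *: bfun T x) y = rip x (conjc k *: badj T y).
Proof. by rewrite ripZl bfun_adj badjZ. Qed.

Lemma bscaleZ k (T : bop) c x : k *: bfun T (c *: x) = c *: (k *: bfun T x).
Proof. by rewrite bfunZ !scalerA mulrC. Qed.

Lemma bscale_le k (T : bop) x :
  hnorm (k *: bfun T x) <= (ComplexField.Normc.normc k * bnorm T) * hnorm x.
Proof. by rewrite hnormZ -mulrA ler_wpM2l ?normc_ge0 ?le_bnorm. Qed.

Definition bscale k (T : bop) : bop :=
  Bop (bscale_adj k T) (bscaleZ k T)
      (boundedI (mulr_ge0 (normc_ge0 k) (bnorm_ge0 T)) (bscale_le k T)).

Lemma bmul_adj (S T : bop) x y :
  rip (bfun S (bfun T x)) y = rip x (badj T (badj S y)).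
Proof. by rewrite !bfun_adj. Qed.

Lemma bmulZ (S T : bop) c x :
  bfun S (bfun T (c *: x)) = c *: bfun S (bfun T x).
Proof. by rewrite !bfunZ. Qed.

Lemma bmul_le (S T : bop) x :
  hnorm (bfun S (bfun T x)) <= (bnorm S * bnorm T) * hnorm x.
Proof.
by apply: le_trans (le_bnorm _ _) _; rewrite -mulrA ler_wpM2l ?bnorm_ge0 ?le_bnorm.
Qed.

Definition bmul (S T : bop) : bop :=
  Bop (bmul_adj S T) (bmulZ S T)
      (boundedI (mulr_ge0 (bnorm_ge0 S) (bnorm_ge0 T)) (bmul_le S T)).

Lemma baddA : associative badd.
Proof. by move=> S T U; apply: bopP => x /=; rewrite addrA. Qed.
Lemma baddC : commutative badd.
Proof. by move=> S T; apply: bopP => x /=; rewrite addrC. Qed.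
Lemma badd0 : left_id bzero badd.
Proof. by move=> S; apply: bopP => x /=; rewrite add0r. Qed.
Lemma baddN : left_inverse bzero (bscale (-1)) badd.
Proof. by move=> S; apply: bopP => x /=; rewrite scaleN1r addNr. Qed.

HB.instance Definition _ := GRing.isZmodule.Build bop baddA baddC badd0 baddN.

Lemma bmulA : associative bmul. Proof. by move=> S T U; exact: bopP. Qed.
Lemma bmul1r : left_id bone bmul. Proof. by move=> S; exact: bopP. Qed.
Lemma bmulr1 : right_id bone bmul. Proof. by move=> S; exact: bopP. Qed.
Lemma bmulDl : left_distributive bmul badd.
Proof. by move=> S T U; exact: bopP. Qed.
Lemma bmulDr : right_distributive bmul badd.
Proof. by move=> S T U; apply: bopP => x /=; rewrite bfunD. Qed.
Lemma bone_neq0 : bone != bzero.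
Proof.
by apply/eqP => /(congr1 bfun) e; have [x] := hilbert_nontrivial E;
  rewrite -[x]/(bfun bone x) e.
Qed.

HB.instance Definition _ := GRing.Zmodule_isNzRing.Build bop
  bmulA bmul1r bmulr1 bmulDl bmulDr bone_neq0.

Lemma bscaleA a b (T : bop) : bscale a (bscale b T) = bscale (a * b) T.
Proof. by apply: bopP => x /=; rewrite scalerA. Qed.
Lemma bscale1 : left_id 1 bscale.
Proof. by move=> T; apply: bopP => x /=; rewrite scale1r. Qed.
Lemma bscaleDr : right_distributive bscale +%R.
Proof. by move=> a S T; apply: bopP => x /=; rewrite scalerDr. Qed.
Lemma bscaleDl (T : bop) : {morph bscale^~ T : a b / a + b}.
Proof. by move=> a b; apply: bopP => x /=; rewrite scalerDl. Qed.

HB.instance Definition _ := GRing.Zmodule_isLmodule.Build R[i] bop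
  bscaleA bscale1 bscaleDr bscaleDl.

Lemma bscaleAl (a : R[i]) (S T : bop) : a *: (S * T) = a *: S * T.
Proof. exact: bopP. Qed.

HB.instance Definition _ := GRing.Lmodule_isLalgebra.Build R[i] bop bscaleAl.

Lemma bscaleAr (a : R[i]) (S T : bop) : a *: (S * T) = S * (a *: T).
Proof. by apply: bopP => x /=; rewrite bfunZ. Qed.

HB.instance Definition _ := GRing.Lalgebra_isAlgebra.Build R[i] bop bscaleAr.

Lemma bstarK : involutive bstar. Proof. by move=> T; exact: bopP. Qed.
Lemma bstarD : {morph bstar : x y / x + y}.
Proof. by move=> S T; exact: bopP. Qed.
Lemma bstarZ c (T : bop) : bstar (c *: T) = conjc c *: bstar T.
Proof. exact: bopP. Qed.
Lemma bstarM (S T : bop) : bstar (S * T) = bstar T * bstar S.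
Proof. exact: bopP. Qed.

Lemma bnorm_eq0 (T : bop) : bnorm T = 0 -> T = 0.
Proof.
move=> T0; apply: bopP => x; apply: hnorm_eq0; apply/le_anti.
by rewrite hnorm_ge0 andbT; apply: le_trans (le_bnorm _ _) _; rewrite T0 mul0r.
Qed.

Lemma bnormD (S T : bop) : bnorm (S + T) <= bnorm S + bnorm T.
Proof.
by apply: bnorm_le; [rewrite addr_ge0 ?bnorm_ge0|exact: badd_le].
Qed.

Lemma bnormM (S T : bop) : bnorm (S * T) <= bnorm S * bnorm T.
Proof.
by apply: bnorm_le; [rewrite mulr_ge0 ?bnorm_ge0|exact: bmul_le].
Qed.

Lemma bnormZ_le c (T : bop) :
  bnorm (c *: T) <= ComplexField.Normc.normc c * bnorm T.
Proof.
by apply: bnorm_le; [rewrite mulr_ge0 ?bnorm_ge0 ?normc_ge0|exact: bscale_le].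
Qed.

Lemma bnormZ c (T : bop) :
  bnorm (c *: T) = ComplexField.Normc.normc c * bnorm T.
Proof.
have [->|c0] := eqVneq c 0.
  rewrite scale0r ComplexField.Normc.normc0 mul0r; apply/le_anti.
  by rewrite bnorm_ge0 bnorm_le // => x; rewrite mul0r hnorm0.
apply/le_anti; rewrite bnormZ_le /=.
have n_gt0 : 0 < ComplexField.Normc.normc c.
  rewrite lt_def normc_ge0 andbT; apply: contra_neq c0.
  exact: ComplexField.Normc.eq0_normc.
have := bnormZ_le c^-1 (c *: T).
rewrite scalerA mulVf // scale1r ComplexField.Normc.normcV.
by rewrite [_^-1 * _]mulrC ler_pdivlMr // mulrC.
Qed.

Lemma bnorm_bstar (T : bop) : bnorm (bstar T) = bnorm T.
Proof.
have le S : bnorm (bstar S) <= bnorm S.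
  by apply: bnorm_le; [exact: bnorm_ge0|exact: badj_bounded].
by apply/le_anti; rewrite le -{1}(bstarK T) le.
Qed.

(** With S the adjoint of T, |Tx|^2 = <STx, x> <= |ST| |x|^2, so the square root of |ST| bounds T.
    The other inequality is submultiplicativity together with [bnorm_bstar]. *)
Lemma bnorm_bstar_mul (T : bop) : bnorm (bstar T * T) = bnorm T ^+ 2.
Proof.
apply/le_anti; rewrite (le_trans (bnormM _ _)) ?bnorm_bstar ?expr2 //=.
rewrite -expr2 -(@sqr_sqrtr _ (bnorm (bstar T * T))) ?bnorm_ge0 //.
rewrite ler_pXn2r ?nnegrE ?bnorm_ge0 ?sqrtr_ge0 //.
apply: bnorm_le => [|x]; first exact: sqrtr_ge0.
rewrite -(@ler_pXn2r _ 2) ?nnegrE ?mulr_ge0 ?sqrtr_ge0 ?hnorm_ge0 //.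
rewrite hnorm_sqr exprMn sqr_sqrtr ?bnorm_ge0 // bfun_adj ripC.
apply: le_trans (le_trans (ler_norm _) (rip_le_hnorm _ _)) _.
by rewrite expr2 mulrA ler_wpM2r ?hnorm_ge0 // (le_bnorm (bstar T * T)).
Qed.

Lemma bfun_cvg (T : nat -> bop) :
  (forall e : R, 0 < e -> exists n0 : nat, forall m n : nat,
     (n0 <= m)%N -> (n0 <= n)%N -> bnorm (T m - T n) < e) ->
  exists L : E -> E, forall x (e : R), 0 < e -> exists n0 : nat,
    forall n : nat, (n0 <= n)%N -> hnorm (bfun (T n) x - L x) < e.
Proof.
move=> cT.
suff /choice[L LP] : forall x, exists l, forall e : R, 0 < e ->
    exists n0 : nat, forall n : nat, (n0 <= n)%N -> hnorm (bfun (T n) x - l) < e.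
  by exists L.
move=> x; have [|l lP] := @hilbert_complete _ E (fun n => bfun (T n) x).
  (* [hilbert_complete] measures squared norms, hence the square root; the +1 keeps the denominator
     positive when x = 0. *)
  move=> e e0; have d0 : 0 < Num.sqrt e / (hnorm x + 1).
    by rewrite divr_gt0 ?sqrtr_gt0 // ltr_wpDl ?hnorm_ge0.
  have [n0 n0P] := cT _ d0; exists n0 => m n mn nn.
  have -> : bfun (T m) x - bfun (T n) x = bfun (T m - T n) x.
    by rewrite /= scaleN1r.
  rewrite -hnorm_sqr -[ltRHS]sqr_sqrtr ?ltW //.
  rewrite ltr_pXn2r ?nnegrE ?hnorm_ge0 ?sqrtr_ge0 //.
  apply: le_lt_trans (le_bnorm _ _) _.
  have := n0P _ _ mn nn; rewrite ltr_pdivlMr ?ltr_wpDl ?hnorm_ge0 //.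
  by apply: le_lt_trans; rewrite ler_wpM2l ?bnorm_ge0 // lerDl.
exists l => e e0; have [n0 n0P] := lP _ (exprn_gt0 2 e0); exists n0 => n /n0P.
by rewrite -hnorm_sqr ltr_pXn2r ?nnegrE ?hnorm_ge0 // ltW.
Qed.

(** The operators and their adjoints converge pointwise, to L and L'. Adjointness and homogeneity
    pass to the limit, and so does the Cauchy estimate, which is uniform in x and gives both the
    boundedness of L and convergence in norm. *)
Lemma bnorm_complete (T : nat -> bop) :
  (forall e : R, 0 < e -> exists n0 : nat, forall m n : nat,
     (n0 <= m)%N -> (n0 <= n)%N -> bnorm (T m - T n) < e) ->
  exists L : bop, forall e : R, 0 < e -> exists n0 : nat, forall n : nat,
    (n0 <= n)%N -> bnorm (T n - L) < e.
Proof.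
move=> cT; have [L LP] := bfun_cvg cT.
have [|L' L'P] := @bfun_cvg (fun n => bstar (T n)).
  move=> e /cT[n0 n0P]; exists n0 => m n mn nn.
  rewrite -bnorm_bstar; have -> : bstar (bstar (T m) - bstar (T n)) = T m - T n.
    apply: bopP => x /=; congr (_ + _ *: _); apply/eqP.
    by rewrite eq_complex /= !oppr0 !eqxx.
  exact: n0P.
have near x y e : 0 < e -> exists n,
    [/\ hnorm (bfun (T n) x - L x) < e, hnorm (bfun (T n) y - L y) < e &
        hnorm (bfun (bstar (T n)) y - L' y) < e].
  move=> e0; have [n1 n1P] := LP x _ e0; have [n2 n2P] := LP y _ e0.
  have [n3 n3P] := L'P y _ e0.
  exists (maxn n1 (maxn n2 n3)).
  by split; [apply: n1P|apply: n2P|apply: n3P]; rewrite !leq_max leqnn ?orbT.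
have small (r C : R) : 0 <= C -> (forall e, 0 < e -> r <= C * e) -> r <= 0.
  move=> C0 rP; rewrite leNgt; apply/negP => r0.
  have := rP (r / (2 * (C + 1))).
  have C1 : 0 < 2 * (C + 1) by lra.
  rewrite divr_gt0 // => /(_ isT); rewrite mulrA ler_pdivlMr //; nra.
have Ladj x y : rip (L x) y = rip x (L' y).
  apply/subr0_eq/normr0_eq0/le_anti; rewrite normr_ge0 andbT.
  apply: (@small _ (hnorm y + hnorm x)); first by rewrite addr_ge0 ?hnorm_ge0.
  move=> e e0; have [n [ne _ ne']] := near x y _ e0.
  have -> : rip (L x) y - rip x (L' y) =
      - rip (bfun (T n) x - L x) y + rip x (bfun (bstar (T n)) y - L' y).
    by rewrite ripBl ripBr /= bfun_adj; ring.
  apply: le_trans (ler_normD _ _) _; rewrite normrN mulrDl lerD //.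
    by apply: le_trans (rip_le_hnorm _ _) _;
      rewrite mulrC ler_wpM2l ?hnorm_ge0 ?ltW.
  by apply: le_trans (rip_le_hnorm _ _) _; rewrite ler_wpM2l ?hnorm_ge0 ?ltW.
have LZ c x : L (c *: x) = c *: L x.
  apply/subr0_eq/hnorm_eq0/le_anti; rewrite hnorm_ge0 andbT.
  apply: (@small _ (1 + ComplexField.Normc.normc c)).
    by rewrite addr_ge0 ?normc_ge0.
  move=> e e0; have [n [ne ne' _]] := near (c *: x) x _ e0.
  have -> : L (c *: x) - c *: L x =
      c *: (bfun (T n) x - L x) - (bfun (T n) (c *: x) - L (c *: x)).
    by rewrite bfunZ scalerBr opprB [RHS]addrC addrA subrK.
  apply: le_trans (hnormB _ _) _; rewrite hnormZ mulrDl mul1r addrC.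
  by apply: lerD; [exact: ltW|rewrite ler_wpM2l ?normc_ge0 // ltW].
have Lle e : 0 < e -> exists n0, forall n, (n0 <= n)%N ->
    forall x, hnorm (bfun (T n) x - L x) <= e * hnorm x.
  move=> e0; have [n0 n0P] := cT _ e0; exists n0 => n nn x.
  rewrite -subr_le0; apply: (@small _ 1) => // d d0; rewrite mul1r.
  have [n1 n1P] := LP x _ d0; pose m := maxn n0 n1.
  have := n1P m (leq_maxr _ _); have := n0P n m nn (leq_maxl _ _).
  move=> nm mL; rewrite lerBlDl.
  have -> : bfun (T n) x - L x = bfun (T n - T m) x + (bfun (T m) x - L x).
    by rewrite /= scaleN1r addrA subrK.
  apply: le_trans (hnormD _ _) _; apply: lerD; last exact: ltW.
  apply: le_trans (le_bnorm _ _) _.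
  by rewrite ler_wpM2r ?hnorm_ge0 // ltW.
have Lbd : exists2 C : R, 0 <= C & forall x, hnorm (L x) <= C * hnorm x.
  have [n0 n0P] := Lle 1 ltr01; exists (bnorm (T n0) + 1).
    by rewrite addr_ge0 ?bnorm_ge0.
  move=> x; have -> : L x = bfun (T n0) x - (bfun (T n0) x - L x).
    by rewrite opprB addrC subrK.
  apply: le_trans (hnormB _ _) _; rewrite mulrDl lerD ?le_bnorm //.
  exact: n0P.
exists (Bop Ladj LZ Lbd) => e e0; have e2 : 0 < e / 2 by rewrite divr_gt0.
have [n0 n0P] := Lle _ e2; exists n0 => n nn.
apply: (@le_lt_trans _ _ (e / 2)); last by lra.
by apply: bnorm_le => [|x]; [exact: ltW|rewrite /= scaleN1r n0P].
Qed.

HB.instance Definition _ := Algebra_isCStarAlgebra.Build R bop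
  bstarK bstarD bstarZ bstarM bnorm_eq0 bnormD bnormZ bnormM bnorm_bstar_mul
  bnorm_complete.

End BoundedOperators.

(** * The Hilbert space of square-summable functions *)

Section SquareModulus.
Variable R : realType.
Implicit Types z w : R[i].

Definition sqmod z : R := complex.Re z ^+ 2 + complex.Im z ^+ 2.

Lemma sqmod_ge0 z : 0 <= sqmod z.
Proof. by rewrite addr_ge0 ?sqr_ge0. Qed.

Lemma sqmod_eq0 z : sqmod z = 0 -> z = 0.
Proof.
case: z => a b /eqP; rewrite paddr_eq0 ?sqr_ge0 // !sqrf_eq0 /=.
by move=> /andP[/eqP-> /eqP->].
Qed.

Lemma sqmod0 : sqmod 0 = 0. Proof. by rewrite /sqmod /= expr0n addr0. Qed.

Lemma sqmodM z w : sqmod (z * w) = sqmod z * sqmod w.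
Proof. by case: z w => [a b] [c d]; rewrite /sqmod /=; ring. Qed.

Lemma sqmodD_le z w : sqmod (z + w) <= 2 * sqmod z + 2 * sqmod w.
Proof.
case: z w => [a b] [c d]; rewrite /sqmod /= -subr_ge0.
have -> : 2 * (a ^+ 2 + b ^+ 2) + 2 * (c ^+ 2 + d ^+ 2) -
  ((a + c) ^+ 2 + (b + d) ^+ 2) = (a - c) ^+ 2 + (b - d) ^+ 2 by ring.
by rewrite addr_ge0 ?sqr_ge0.
Qed.

Lemma sqmod_real (c : R) : sqmod c%:C%C = c ^+ 2.
Proof. by rewrite /sqmod /= expr0n addr0. Qed.

End SquareModulus.

Section SquareSummable.
Variables (R : realType) (Y : choiceType).
Local Notation C := R[i].

Definition sqsum (D : set Y) (f : Y -> C) : \bar R :=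
  \esum_(y in D) (sqmod (f y))%:E.

Definition l2_pred : {pred Y -> C} := fun f => `[< (sqsum setT f < +oo)%E >].

Lemma sqsum_ge0 D f : (0 <= sqsum D f)%E.
Proof. by apply: esum_ge0 => y _; rewrite lee_fin sqmod_ge0. Qed.

Lemma le_sqsum D (f g : Y -> C) :
  (forall y, D y -> sqmod (f y) <= sqmod (g y)) -> (sqsum D f <= sqsum D g)%E.
Proof. by move=> fg; apply: le_esum => y Dy; rewrite lee_fin fg. Qed.

Lemma esumZ (D : set Y) (c : R) (g : Y -> R) : 0 <= c -> (forall y, 0 <= g y) ->
  (\esum_(y in D) (c * g y)%:E)%R = (c%:E * \esum_(y in D) (g y)%:E)%E.
Proof.
move=> c0 g0; rewrite /esum -ereal_supZl //; last first.
  by apply/set0P; exists 0%E; exists set0; [exact: fsets_set0|rewrite fsbig_set0].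
congr (ereal_sup _); rewrite image_comp; apply: eq_imagel => A _ /=.
by rewrite ge0_mule_fsumr.
Qed.

Lemma sqsumZ D (c : C) f : sqsum D (c *: f) = ((sqmod c)%:E * sqsum D f)%E.
Proof.
rewrite /sqsum -esumZ ?sqmod_ge0 //; last by move=> y; exact: sqmod_ge0.
by apply: eq_esum => y _; rewrite sqmodM.
Qed.

Lemma l2_submod : submod_closed l2_pred.
Proof.
split=> [|c f g /asboolP f2 /asboolP g2]; apply/asboolP.
  by rewrite /sqsum esum1 ?ltry // => y _; rewrite sqmod0.
(* Scaling by 2 multiplies [sqmod] by 4, which absorbs the factor 2 of [sqmodD_le]. *)
apply: (@le_lt_trans _ _ (sqsum setT ((2 : C) *: (c *: f)) +
                          sqsum setT ((2 : C) *: g))%E).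
  rewrite /sqsum -esumD => [|y _|y _]; rewrite ?lee_fin ?sqmod_ge0 //.
  apply: le_esum => y _; rewrite lee_fin.
  apply: le_trans (sqmodD_le _ _) _; rewrite !sqmodM.
  have -> : sqmod (2 : C) = 4 by rewrite /sqmod /=; ring.
  by rewrite -!sqmodM lerD // ler_wpM2r ?sqmod_ge0 // ler_nat.
have fin (a : C) h : (sqsum setT h < +oo -> sqsum setT (a *: h) < +oo)%E.
  move=> h2; rewrite sqsumZ lte_mul_pinfty ?lee_fin ?sqmod_ge0 //.
by apply: lte_add_pinfty (fin _ _ (fin _ _ f2)) (fin _ _ g2).
Qed.

HB.instance Definition _ := GRing.isSubmodClosed.Build C (Y -> C) l2_pred l2_submod.

Record l2 := L2 { l2fun : Y -> C ; l2fun_pred : l2fun \in l2_pred }.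

HB.instance Definition _ := [isSub for l2fun].
HB.instance Definition _ := [Choice of l2 by <:].
HB.instance Definition _ := [SubChoice_isSubLmodule of l2 by <:].


Lemma l2P x y : l2fun x =1 l2fun y -> x = y.
Proof. by move=> xy; apply: val_inj; exact: funext. Qed.

Definition l2N x : R := fine (sqsum setT (l2fun x)).

Lemma l2N_E x : sqsum setT (l2fun x) = (l2N x)%:E.
Proof.
by rewrite fineK // ge0_fin_numE ?sqsum_ge0 //; apply/asboolP/(l2fun_pred x).
Qed.

Lemma l2N_ge0 x : 0 <= l2N x.
Proof. by rewrite -lee_fin -l2N_E sqsum_ge0. Qed.

Lemma l2NZ c x : l2N (c *: x) = sqmod c * l2N x.
Proof. by apply: EFin_inj; rewrite -l2N_E EFinM -l2N_E -sqsumZ. Qed.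

Lemma l2N_sum (s : seq l2) :
  (\sum_(x <- s) l2N x)%:E = (\esum_(y in setT) (\sum_(x <- s) sqmod (l2fun x
    y))%:E)%R.
Proof.
under eq_esum do rewrite -sumEFin.
rewrite esum_sum => [|i j _ _]; last by rewrite lee_fin sqmod_ge0.
by rewrite -sumEFin; apply: eq_bigr => x _; rewrite -l2N_E.
Qed.

Lemma l2N_pointwise (s t : seq l2) :
  (forall y, \sum_(x <- s) sqmod (l2fun x y) = \sum_(x <- t) sqmod (l2fun x y)) ->
  \sum_(x <- s) l2N x = \sum_(x <- t) l2N x.
Proof.
by move=> st; apply: EFin_inj; rewrite !l2N_sum; apply: eq_esum => y _; rewrite st.
Qed.

(* By polarization, so that its algebra reduces to pointwise identities between
   squared moduli (l2N_pointwise). *)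
Definition l2rip x y : R := (l2N (x + y) - l2N x - l2N y) / 2.

Lemma l2rip_self x : l2rip x x = l2N x.
Proof.
rewrite /l2rip -mulr2n -scaler_nat l2NZ.
have -> : sqmod (2%:R : C) = 4 by rewrite /sqmod /=; ring.
by field.
Qed.

Lemma l2ripC x y : l2rip x y = l2rip y x.
Proof. by rewrite /l2rip (addrC x y) [in LHS]addrAC. Qed.

Lemma l2funD x y t : l2fun (x + y) t = l2fun x t + l2fun y t.
Proof. by []. Qed.

Lemma l2funZ c x t : l2fun (c *: x) t = c * l2fun x t.
Proof. by []. Qed.

(** Under polarization, additivity is the identity |x+y+z|^2 + |x|^2 + |y|^2 + |z|^2 = |x+y|^2 +
    |x+z|^2 + |y+z|^2, which holds pointwise. *)
Lemma l2ripDl x y z : l2rip (x + y) z = l2rip x z + l2rip y z.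
Proof.
have : \sum_(w <- [:: x + y + z; x; y; z]) l2N w =
       \sum_(w <- [:: x + y; x + z; y + z]) l2N w.
  apply: l2N_pointwise => t; rewrite !big_cons !big_nil !l2funD.
  by case: (l2fun x t) (l2fun y t) (l2fun z t) => [? ?] [? ?] [? ?];
    rewrite /sqmod /=; ring.
by rewrite !big_cons !big_nil /l2rip; lra.
Qed.

Lemma l2ripZl c x y : l2rip (c *: x) y = l2rip x (conjc c *: y).
Proof.
have : \sum_(w <- [:: c *: x + y; x; conjc c *: y]) l2N w =
       \sum_(w <- [:: x + conjc c *: y; c *: x; y]) l2N w.
  apply: l2N_pointwise => t; rewrite !big_cons !big_nil !(l2funD, l2funZ).
  by case: (l2fun x t) (l2fun y t) c => [? ?] [? ?] [? ?];
    rewrite /sqmod /=; ring.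
by rewrite !big_cons !big_nil /l2rip; lra.
Qed.

(** [l2N_pointwise] compares sums with unit coefficients only, so a coefficient c has to enter by
    scaling vectors with its square root; hence the sign condition. *)
Lemma l2ripRl_ge0 (c : R) x y : 0 <= c -> l2rip (c%:C%C *: x) y = c * l2rip x y.
Proof.
move=> c0; have -> : c = Num.sqrt c ^+ 2 by rewrite sqr_sqrtr.
set k := Num.sqrt c.
have : \sum_(w <- [:: (k ^+ 2)%:C%C *: x + y; k%:C%C *: x; k%:C%C *: y]) l2N w =
       \sum_(w <- [:: k%:C%C *: (x + y); (k ^+ 2)%:C%C *: x; y]) l2N w.
  apply: l2N_pointwise => t; rewrite !big_cons !big_nil !(l2funD, l2funZ).
  by case: (l2fun x t) (l2fun y t) => [? ?] [? ?]; rewrite /sqmod /=; ring.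
by rewrite !big_cons !big_nil /l2rip !(l2NZ k%:C%C) !sqmod_real; lra.
Qed.

Lemma l2ripNl x y : l2rip (- x) y = - l2rip x y.
Proof.
have r0 : l2rip 0 y = 0.
  by have := l2ripDl 0 0 y; rewrite addr0 => /eqP; rewrite -subr_eq0; lra.
by have := l2ripDl x (- x) y; rewrite subrr r0; lra.
Qed.

Lemma l2ripRl (c : R) x y : l2rip (c%:C%C *: x) y = c * l2rip x y.
Proof.
have [c0|c0] := leP 0 c; first exact: l2ripRl_ge0.
have -> : c%:C%C *: x = - ((- c)%:C%C *: x).
  by rewrite rmorphN scaleNr opprK.
by rewrite l2ripNl l2ripRl_ge0 ?oppr_ge0 ?ltW // mulNr opprK.
Qed.

Lemma l2rip_ge0 x : 0 <= l2rip x x.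
Proof. by rewrite l2rip_self l2N_ge0. Qed.

Lemma sum_sqmod_le_l2N x (s : seq Y) : uniq s ->
  \sum_(y <- s) sqmod (l2fun x y) <= l2N x.
Proof.
move=> us; rewrite -lee_fin -l2N_E; apply: esum_ge; exists [set` s]%classic.
  by split=> //; exact: finite_seq.
by rewrite -fsbig_seq // sumEFin.
Qed.

Lemma sqmod_le_l2N x y : sqmod (l2fun x y) <= l2N x.
Proof. by have := @sum_sqmod_le_l2N x [:: y] isT; rewrite big_seq1. Qed.

Lemma l2rip_eq0 x : l2rip x x = 0 -> x = 0.
Proof.
rewrite l2rip_self => x0; apply: l2P => y; apply/sqmod_eq0/le_anti.
by rewrite sqmod_ge0 andbT -x0 sqmod_le_l2N.
Qed.

Lemma sqsum_le (f : Y -> C) (B : R) :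
  (forall s : seq Y, uniq s -> \sum_(y <- s) sqmod (f y) <= B) ->
  (sqsum setT f <= B%:E)%E.
Proof.
move=> fB; apply: ge_ereal_sup => _ [A [finA _] <-].
by rewrite fsbig_finite //= sumEFin lee_fin fB // finmap.fset_uniq.
Qed.

Lemma real_complete (a : nat -> R) :
  (forall e : R, 0 < e -> exists n0 : nat, forall m n : nat,
     (n0 <= m)%N -> (n0 <= n)%N -> `|a m - a n| < e) ->
  exists l, forall e : R, 0 < e -> exists n0 : nat, forall n : nat,
     (n0 <= n)%N -> `|a n - l| < e.
Proof.
move=> ca; have /cvg_ex[l al] : cvgn a.
  apply: cauchy_cvg; apply: cauchy_exP => e e0.
  have [n0 n0P] := ca _ e0; exists (a n0); exists n0 => // n /= nn.
  exact: n0P.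
exists l => e e0; have /cvgrPdist_lt/(_ _ e0)[n0 _ n0P] := al.
by exists n0 => n /n0P; rewrite distrC.
Qed.

Lemma sqr_ltr_norm (a e : R) : 0 < e -> (`|a| < e) = (a ^+ 2 < e ^+ 2).
Proof.
move=> e0; rewrite -[a ^+ 2]real_normK ?num_real //.
by rewrite ltr_pXn2r ?nnegrE // ltW.
Qed.

(** Each coordinate converges. The Cauchy bound passes to the limit on every finite set s of
    coordinates, with an auxiliary index m that depends on s while the bound does not. *)
Lemma l2_complete (x : nat -> l2) :
  (forall e : R, 0 < e -> exists n0 : nat, forall m n : nat,
     (n0 <= m)%N -> (n0 <= n)%N -> l2rip (x m - x n) (x m - x n) < e) ->
  exists l : l2, forall e : R, 0 < e -> exists n0 : nat, forall n : nat,
     (n0 <= n)%N -> l2rip (x n - l) (x n - l) < e.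
Proof.
move=> cx.
have /choice[f fP] : forall y, exists z : C, forall e : R, 0 < e ->
    exists n0 : nat, forall n : nat, (n0 <= n)%N -> sqmod (l2fun (x n) y - z) < e.
  move=> y.
  have cy (p : C -> R) : (forall z w, (p z - p w) ^+ 2 <= sqmod (z - w)) ->
      exists l, forall e : R, 0 < e -> exists n0 : nat, forall n : nat,
      (n0 <= n)%N -> `|p (l2fun (x n) y) - l| < e.
    move=> pP; apply: real_complete => e e0.
    have [n0 n0P] := cx _ (exprn_gt0 2 e0); exists n0 => m n mn nn.
    rewrite sqr_ltr_norm //; apply: le_lt_trans (n0P m n mn nn).
    apply: le_trans (pP _ _) _; rewrite l2rip_self.
    exact: (sqmod_le_l2N (x m - x n) y).
  have [|a aP] := cy (@complex.Re R).
    by move=> [? ?] [? ?]; rewrite /sqmod /= lerDl sqr_ge0.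
  have [|b bP] := cy (@complex.Im R).
    by move=> [? ?] [? ?]; rewrite /sqmod /= lerDr sqr_ge0.
  exists (Complex a b) => e e0.
  have d0 : 0 < Num.sqrt (e / 2) by rewrite sqrtr_gt0 divr_gt0.
  have [n0 n0P] := aP _ d0; have [n1 n1P] := bP _ d0.
  exists (maxn n0 n1) => n; rewrite geq_max => /andP[/n0P nn /n1P nn'].
  move: nn nn'; rewrite !sqr_ltr_norm // sqr_sqrtr; last by rewrite ltW ?divr_gt0.
  by case: (l2fun (x n) y) => c d; rewrite /sqmod /=; lra.
have sumP (s : seq Y) (e : R) : 0 < e -> exists n0 : nat, forall n : nat,
    (n0 <= n)%N -> \sum_(y <- s) sqmod (l2fun (x n) y - f y) < e.
  elim: s e => [|y s IH] e e0; first by exists 0%N => n _; rewrite big_nil.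
  have e2 : 0 < e / 2 by rewrite divr_gt0.
  have [n0 n0P] := IH _ e2; have [n1 n1P] := fP y _ e2.
  exists (maxn n0 n1) => n; rewrite geq_max => /andP[/n0P nn /n1P nn'].
  by rewrite big_cons; lra.
have near (e : R) : 0 < e -> exists n0 : nat, forall n : nat, (n0 <= n)%N ->
    (sqsum setT (fun y => (l2fun (x n) y - f y)%R) <= e%:E)%E.
  (* Two contributions below e/4, each doubled by [sqmodD_le], add up to at most e. *)
  move=> e0; have e4 : 0 < e / 4 by rewrite divr_gt0.
  have [n0 n0P] := cx _ e4; exists n0 => n nn; apply: sqsum_le => s us.
  have [n1 n1P] := sumP s _ e4; pose m := maxn n0 n1.
  have := n0P n m nn (leq_maxl _ _); have := n1P m (leq_maxr _ _).
  rewrite l2rip_self; have := sum_sqmod_le_l2N (x n - x m) us.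
  set S1 := \sum_(_ <- _) _ => S1le S2lt Nlt.
  apply: (@le_trans _ _ (2 * S1 +
    2 * \sum_(y <- s) sqmod (l2fun (x m) y - f y))); last by lra.
  rewrite !mulr_sumr -big_split /=; apply: ler_sum => y _.
  have -> : l2fun (x n) y - f y =
      l2fun (x n - x m) y + (l2fun (x m) y - f y).
    by rewrite addrA subrK.
  exact: sqmodD_le.
have f2 : f \in l2_pred.
  have [n0 /(_ _ (leqnn _)) n0P] := near 1 ltr01.
  have g2 : (fun y => l2fun (x n0) y - f y) \in l2_pred.
    by apply/asboolP; apply: le_lt_trans n0P (ltry _).
  have -> : f = l2fun (x n0) - (fun y => l2fun (x n0) y - f y).
    by apply: funext => y; rewrite /= !fctE opprB addrC subrK.
  by apply: rpredB => //; exact: l2fun_pred.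
exists (L2 f2) => e e0; have e2 : 0 < e / 2 by rewrite divr_gt0.
have [n0 n0P] := near _ e2; exists n0 => n /n0P nn.
rewrite l2rip_self; apply: (@le_lt_trans _ _ (e / 2)); last by lra.
by rewrite -lee_fin -l2N_E.
Qed.

Lemma l2_delta_pred (y0 : Y) :
  (fun y => if y == y0 then 1 else 0 : C) \in l2_pred.
Proof.
apply/asboolP; apply: (@le_lt_trans _ _ 1%:E); last exact: ltry.
apply: sqsum_le => s us.
rewrite (bigID (pred1 y0)) /= [X in _ + X]big1 ?addr0; last first.
  by move=> y /negPf->; rewrite sqmod0.
rewrite (eq_bigr (fun=> 1)); last first.
  by move=> y /= ->; rewrite /sqmod /=; ring.
rewrite big_const_seq iter_addr_0 count_uniq_mem //.
by case: (_ \in _); rewrite ?mulr0n ?mulr1n.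
Qed.

Definition l2delta (y0 : Y) : l2 := L2 (l2_delta_pred y0).

Lemma l2_nontrivial (y0 : Y) : exists x : l2, x <> 0.
Proof.
exists (l2delta y0) => /(congr1 (fun x => l2fun x y0)) /= /eqP.
by rewrite eqxx oner_eq0.
Qed.

Definition l2hilbert (y0 : Y) : hilbertSpace R :=
  HilbertSpace l2ripC l2ripDl l2ripZl l2ripRl l2rip_ge0 l2rip_eq0
    (l2_nontrivial y0) l2_complete.

End SquareSummable.

(** * Isometries of l2 induced by injections *)

Section PushForward.
Variables (R : realType) (Y : choiceType) (y0 : Y) (f : Y -> Y).
Hypothesis f_inj : injective f.
Local Notation C := R[i].
Local Notation E := (l2hilbert R y0).

(** The isometry sending the basis vector at z to the one at f z. *)
Definition pushfun (x : Y -> C) (y : Y) : C :=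
  if pselect (exists z, f z = y) is left e then x (sval (cid e)) else 0.

Lemma pushfun_range (x : Y -> C) z : pushfun x (f z) = x z.
Proof.
rewrite /pushfun; case: pselect => [e|[]]; last by exists z.
by case: cid => t /= /f_inj ->.
Qed.

Lemma pushfun_out (x : Y -> C) y : ~ (exists z, f z = y) -> pushfun x y = 0.
Proof. by rewrite /pushfun; case: pselect. Qed.

Lemma sqsum_split (g : Y -> C) :
  (sqsum setT g = sqsum setT (g \o f) + sqsum (~` range f) g)%E.
Proof.
rewrite /sqsum (esumID (range f)) => [|y _]; last by rewrite lee_fin sqmod_ge0.
by rewrite !setTI esum_image // => ? ? _ _; exact: f_inj.
Qed.

Lemma sqsum_pushfun (x : Y -> C) : sqsum setT (pushfun x) = sqsum setT x.
Proof.
rewrite sqsum_split [X in (_ + X)%E](_ : _ = 0%E).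
  by rewrite adde0; apply: eq_esum => y _; rewrite /= pushfun_range.
rewrite /sqsum esum1 // => y ny; rewrite pushfun_out ?sqmod0 // => -[z zy].
by apply: ny; exists z.
Qed.

Lemma pushfun_pred (x : l2 R Y) : pushfun (l2fun x) \in @l2_pred R Y.
Proof. by apply/asboolP; rewrite sqsum_pushfun l2N_E ltry. Qed.

Lemma pullfun_le (x : Y -> C) : (sqsum setT (x \o f) <= sqsum setT x)%E.
Proof. by rewrite (sqsum_split x) leeDl // sqsum_ge0. Qed.

Lemma pullfun_pred (x : l2 R Y) : l2fun x \o f \in @l2_pred R Y.
Proof. by apply/asboolP; apply: le_lt_trans (pullfun_le _) _;
  rewrite l2N_E ltry. Qed.

Definition push (x : E) : E := L2 (pushfun_pred x).
Definition pull (x : E) : E := L2 (pullfun_pred x).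

Lemma l2N_push (x : E) : l2N (push x) = l2N x.
Proof. by rewrite /l2N sqsum_pushfun. Qed.

(** In polarized form both sides agree over the range of f, where points correspond through f; off
    the range [push x] vanishes and only the mass of y is left on either side. *)
Lemma push_pull_adj (x y : E) : rip (push x) y = rip x (pull y).
Proof.
rewrite /= /l2rip l2N_push.
suff : l2N (push x + (y : l2 R Y)) + l2N (pull y) = l2N ((x : l2 R Y) + pull y)
  + l2N y.
  by rewrite /=; lra.
apply: EFin_inj; rewrite !EFinD -!l2N_E (sqsum_split (l2fun (push x + _))).
rewrite (sqsum_split (l2fun y)) addeAC addeA; congr (_ + _ + _)%E; last first.
  apply: eq_esum => t nt; rewrite l2funD /= pushfun_out ?add0r // => -[z zt].
  by apply: nt; exists z.
by apply: eq_esum => t _; rewrite /= !fctE pushfun_range.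
Qed.

Lemma pushZ c (x : E) : push (c *: x) = c *: push x.
Proof.
apply: l2P => y; rewrite l2funZ /=; have [[z <-]|ny] := pselect (exists z, f z = y).
  by rewrite !pushfun_range.
by rewrite !pushfun_out // mulr0.
Qed.

Lemma push_le (x : E) : hnorm (push x) <= 1 * hnorm x.
Proof. by rewrite mul1r /hnorm /= !l2rip_self l2N_push. Qed.

Definition push_op : bop E :=
  Bop push_pull_adj pushZ (boundedI ler01 push_le).

Lemma push_op_isometry : star push_op * push_op = 1.
Proof. by apply: bopP => x; apply: l2P => y; rewrite /= pushfun_range. Qed.

Lemma push_op_range (x : E) y :
  l2fun (bfun (push_op * star push_op) x) y =
  if pselect (exists z, f z = y) then l2fun x y else 0.
Proof.
rewrite /=; case: pselect => [e|ny] /=; last by rewrite pushfun_out.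
by have [z <-] := e; rewrite pushfun_range.
Qed.

End PushForward.

Lemma push_op_comp (R : realType) (Y : choiceType) (y0 : Y) (f g h : Y -> Y)
  (f_inj : injective f) (g_inj : injective g) (h_inj : injective h) :
  h =1 f \o g ->
  push_op R y0 f_inj * push_op R y0 g_inj = push_op R y0 h_inj.
Proof.
move=> fg; apply: bopP => x; apply: l2P => y /=.
have [[z <-]|ny] := pselect (exists z, h z = y).
by rewrite (pushfun_range h_inj) fg /= (pushfun_range f_inj) (pushfun_range g_inj).
rewrite (pushfun_out (f := h)) //.
have [[z zy]|ny'] := pselect (exists z, f z = y); last by rewrite pushfun_out.
rewrite -zy (pushfun_range f_inj) pushfun_out // => -[t tz].
by apply: ny; exists t; rewrite fg /= tz.
Qed.

(** * The representation on l2(M x G) *)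

Section SettingBasics.
Local Open Scope group_scope.
Local Open Scope classical_set_scope.
Variables (G : groupType) (N H M : set G) (h : CuntzLi_setting N H M).
Local Notation P := (Pset H M).

Lemma M_1 : M 1. Proof. by have [/set_mem ? _] := CL_M_subgroup h. Qed.

Lemma M_div x y : M x -> M y -> M (x / y).
Proof.
have [_ B] := CL_M_subgroup h.
by move=> /mem_set Mx /mem_set My; exact: set_mem (B _ _ Mx My).
Qed.

Lemma M_inv x : M x -> M x^-1. Proof. by move/(M_div M_1); rewrite mul1g. Qed.

Lemma M_mul x y : M x -> M y -> M (x * y).
Proof. by move=> Mx My; rewrite -(invgK y); apply: M_div => //; exact: M_inv. Qed.

Definition Mone : M := SigSub (mem_set M_1).
Definition Mmul (m n : M) : M := SigSub (mem_set (M_mul (set_valP m) (set_valP n))).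
Definition Minv (m : M) : M := SigSub (mem_set (M_inv (set_valP m))).

Lemma conjset1 a : conjset a M 1.
Proof. by exists 1; [exact: M_1|rewrite mulg1 mulgV]. Qed.

Lemma conjset_mul a x y : conjset a M x -> conjset a M y -> conjset a M (x * y).
Proof.
move=> [m Mm <-] [n Mn <-]; exists (m * n); first exact: M_mul.
by rewrite !mulgA mulgVK.
Qed.

Lemma conjset_inv a x : conjset a M x -> conjset a M x^-1.
Proof.
move=> [m Mm <-]; exists m^-1; first exact: M_inv.
by rewrite !invgM invgK mulgA.
Qed.

Definition congM (a x y : G) : Prop := conjset a M (x^-1 * y).

Lemma congM_refl a x : congM a x x.
Proof. by rewrite /congM mulVg; exact: conjset1. Qed.

Lemma congM_sym a x y : congM a x y -> congM a y x.
Proof. by move/conjset_inv; rewrite invgM invgK. Qed.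

Lemma congM_trans a x y z : congM a x y -> congM a y z -> congM a x z.
Proof. by move=> xy /(conjset_mul xy); rewrite mulgA mulgK. Qed.

Lemma congM_mull a m x y : congM a (m * x) (m * y) <-> congM a x y.
Proof. by rewrite /congM invgM -mulgA mulKg. Qed.

Lemma congM_conj a b x y :
  congM (b * a) (b * x * b^-1) (b * y * b^-1) <-> congM a x y.
Proof.
have -> : congM (b * a) (b * x * b^-1) (b * y * b^-1) =
    conjset (b * a) M (b * (x^-1 * y) * b^-1).
  by rewrite /congM !invgM invgK !mulgA mulgVK.
split=> -[m Mm E]; exists m => //.
  apply: (mulgI b); apply: (mulIg b^-1); rewrite -E invgM !mulgA //.
by rewrite -E invgM !mulgA.
Qed.

Lemma P_H (a : P) : H (val a). Proof. by case: (set_valP a). Qed.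

End SettingBasics.

Section Representation.
Local Open Scope classical_set_scope.
Variables (R : realType) (G : groupType) (N H M : set G).
Variable h : CuntzLi_setting N H M.
Local Notation P := (Pset H M).
Local Notation Y := (M * G)%type.
Local Notation E := (l2hilbert R ((Mone h, 1%g) : Y)).

Definition shift_s (a : P) (y : Y) : Y := (Mconj a y.1, val a * y.2)%g.
Definition shift_u (m : M) (y : Y) : Y := (Mmul h m y.1, val m * y.2)%g.

Lemma shift_s_inj a : injective (shift_s a).
Proof.
move=> [m x] [n y] [/mulIg/mulgI mn /mulgI ->].
by rewrite (val_inj mn).
Qed.

Lemma shift_u_inj m : injective (shift_u m).
Proof.
move=> [n x] [k y] [/mulgI mn /mulgI ->].
by rewrite (val_inj mn).
Qed.

Definition rep_s (a : P) : bop E := push_op R _ (@shift_s_inj a).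
Definition rep_u (m : M) : bop E := push_op R _ (@shift_u_inj m).

Lemma shift_us_inj m a : injective (shift_u m \o shift_s a).
Proof. by move=> x y /shift_u_inj/shift_s_inj. Qed.

(** The range projection of u(m) s_a is therefore restriction to m M_a x G, and the summation
    relation becomes the partition of M into cosets of M_a. *)
Lemma shift_us_range m a (y : Y) :
  (exists z, (shift_u m \o shift_s a) z = y) <-> congM M (val a) (val m) (val y.1).
Proof.
case: y => n x /=; split=> [[[k z] [<- _]]|].
  by exists (val k); [exact: set_valP|rewrite /= mulKg].
move=> [k Mk E]; exists (SigSub (mem_set Mk), (val a)^-1 * (val m)^-1 * x)%g.
congr (_, _) => /=; last by rewrite !mulgA mulgK mulgV mul1g.
by apply: val_inj; rewrite /= E mulVKg.
Qed.

Lemma bfun_sum (I : Type) (r : seq I) (T : I -> bop E) x :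
  bfun (\sum_(i <- r) T i) x = \sum_(i <- r) bfun (T i) x.
Proof. by elim/big_rec2: _ => // i S z _ <-. Qed.

Lemma l2fun_sum (I : Type) (r : seq I) (x : I -> l2 R Y) y :
  l2fun (\sum_(i <- r) x i) y = \sum_(i <- r) l2fun (x i) y.
Proof. by elim/big_rec2: _ => // i S z _ <-. Qed.

Lemma rep_relations : CuntzLi_relations rep_s rep_u.
Proof.
split.
- by move=> a; exact: push_op_isometry.
- move=> m; split; first exact: push_op_isometry.
  apply: bopP => x; apply: l2P => y; rewrite push_op_range; case: pselect => // -[].
  exists (Mmul h (Minv h m) y.1, (val m)^-1 * y.2)%g.
  rewrite /shift_u /= mulVKg [RHS]surjective_pairing; congr (_, _).
  by apply: val_inj; rewrite /= mulVKg.
- move=> a b c cE; apply: push_op_comp => y; rewrite /shift_s /= cE -mulgA.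
  by congr (_, _); apply: val_inj; rewrite /= cE invgM !mulgA.
- move=> m n k kE; apply: push_op_comp => y; rewrite /shift_u /= kE -mulgA.
  by congr (_, _); apply: val_inj; rewrite /= kE !mulgA.
- move=> a m n nE.
  have inj : injective (shift_s a \o shift_u m).
    by move=> x y /shift_s_inj/shift_u_inj.
  rewrite (@push_op_comp _ _ _ _ _ _ _ _ inj) //; apply/esym/push_op_comp => y /=.
  rewrite /shift_s /shift_u /= nE !mulgA mulgVK; congr (_, _).
  by apply: val_inj; rewrite /= nE !mulgA mulgVK.
move=> a ks [uks ex un]; apply: bopP => x; apply: l2P => y.
(* In the sum evaluated at y only the term of k, the representative of the coset of [y.1],
   survives. *)
have [k kks ky] := ex y.1.
rewrite bfun_sum l2fun_sum (bigD1_seq k) //.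
have term m : l2fun (bfun (rep_u m * erange rep_s a * star (rep_u m)) x) y =
    if pselect (congM M (val a) (val m) (val y.1)) then l2fun x y else 0.
  have E : rep_u m * rep_s a = push_op R _ (@shift_us_inj m a).
    exact: push_op_comp.
  have -> : rep_u m * erange rep_s a * star (rep_u m) =
      (rep_u m * rep_s a) * star (rep_u m * rep_s a).
    by rewrite starM /erange !mulrA.
  rewrite E push_op_range; have rE := shift_us_range m a y.
  by case: pselect => e1; case: pselect => e2 //=; [case: e2|case: e1]; apply/rE.
rewrite term big1_seq => [|l /andP[lk lks]].
  by case: pselect => //= _; rewrite addr0.
rewrite term; case: pselect => //= ly; have kl : k = l;
  last by rewrite kl eqxx in lk.
by apply: un => //; exact: (congM_trans h ky (congM_sym h ly)).
Qed.

(* T maps functions supported on M x {k} to functions supported on M x {gk}. *)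
Definition bdeg (g : G) (T : bop E) : Prop := forall (x : E) (n : M) (k : G),
  (forall n' : M, l2fun x (n', g^-1 * k)%g = 0) -> l2fun (bfun T x) (n, k) = 0.

Lemma bdeg_push (f : Y -> Y) (f_inj : injective f) g :
  (forall y, (f y).2 = g * y.2)%g ->
  bdeg g (push_op R _ f_inj) /\ bdeg g^-1%g (star (push_op R _ f_inj)).
Proof.
move=> fg; split=> x n k x0 /=.
  have [[[n' k'] E]|ny] := pselect (exists z, f z = (n, k));
    last by rewrite pushfun_out.
  rewrite -E pushfun_range //; have -> : k' = (g^-1 * k)%g; last exact: x0.
  by have := fg (n', k'); rewrite E /= => ->; rewrite mulKg.
rewrite (surjective_pairing (f _)) fg /=; move: (x0 (f (n, k)).1).
by rewrite invgK.
Qed.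

Lemma bdegM g g' S T : bdeg g S -> bdeg g' T -> bdeg (g * g')%g (S * T).
Proof.
move=> Sg Tg x n k x0; apply: Sg => n'; apply: Tg => n''.
by rewrite mulgA -invgM.
Qed.

Lemma bdegD g S T : bdeg g S -> bdeg g T -> bdeg g (S + T).
Proof.
by move=> Sg Tg x n k x0;
  rewrite (l2funD (bfun S x) (bfun T x)) (Sg _ _ _ x0) (Tg _ _ _ x0) addr0.
Qed.

Lemma bdegZ g c T : bdeg g T -> bdeg g (c *: T).
Proof. by move=> Tg x n k x0;
  rewrite (l2funZ c (bfun T x)) (Tg _ _ _ x0) mulr0. Qed.

Lemma restrict_pred (D : set Y) (x : l2 R Y) :
  (fun y => if pselect (D y) then l2fun x y else 0) \in @l2_pred R Y.
Proof.
apply/asboolP; apply: (@le_lt_trans _ _ (sqsum setT (l2fun x))); last first.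
  by rewrite l2N_E ltry.
by apply: le_sqsum => y _; case: pselect => //= _; rewrite sqmod0 sqmod_ge0.
Qed.

(** Cut x into its restriction to the slice M x {g^{-1} k} and the rest. At (n, k) the image of the
    first vanishes by degree g', since the slices for g and g' differ, and that of the rest by
    degree g. *)
Lemma bdeg_uniq g g' T : bdeg g T -> bdeg g' T -> g <> g' -> T = 0.
Proof.
move=> Tg Tg' gg'; apply: bopP => x; apply: l2P => -[n k] /=.
pose D := [set y : Y | y.2 = g^-1 * k]%g.
pose x1 : E := L2 (restrict_pred D x).
have -> : x = x1 + (x - x1) by rewrite addrC subrK.
rewrite bfunD; rewrite l2funD (Tg' x1) ?add0r.
  apply: Tg => n'; rewrite /= !fctE /=.
  by case: pselect => /= [_|[]//]; rewrite subrr.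
move=> n' /=; case: pselect => //= /mulIg/invg_inj gE.
by case: gg'.
Qed.

End Representation.

(** What is retained of the representation once its degrees are pulled back to A. The last field
    speaks of [y * x * z] because an element of two degrees is only known to vanish in the
    representation, where 1 does not. *)
Record graded (R : realType) (G : groupType) (H M : set G)
  (A : cstarAlgType R) (s : Pset H M -> A) (u : M -> A)
  (D : G -> A -> Prop) : Prop := {
  gradedM : forall g g' x y, D g x -> D g' y -> D (g * g')%g (x * y) ;
  gradedD : forall g x y, D g x -> D g y -> D g (x + y) ;
  gradedZ : forall g c x, D g x -> D g (c *: x) ;
  graded_s : forall a, D (val a) (s a) /\ D (val a)^-1%g (star (s a)) ;
  graded_u : forall m, D (val m) (u m) /\ D (val m)^-1%g (star (u m)) ;
  graded_uniq : forall g g' x y z, D g x -> D g' x -> g <> g' -> y * x * z <> 1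
}.

Lemma CuntzLi_graded (R : realType) (G : groupType) (N H M : set G)
  (h : CuntzLi_setting N H M) (A : cstarAlgType R) (s : Pset H M ->
    A) (u : M -> A) :
  CuntzLi_universal s u -> exists D, graded s u D.
Proof.
move=> hA; have [f [fstar fs fu]] := CLu_exists hA (rep_relations R h).
exists (fun g x => bdeg g (f x)); split.
- by move=> g g' x y fx fy; rewrite rmorphM; exact: bdegM.
- by move=> g x y fx fy; rewrite rmorphD; exact: bdegD.
- by move=> g c x fx; rewrite linearZ; exact: bdegZ.
- by move=> a; rewrite fstar fs; exact: bdeg_push.
- by move=> a; rewrite fstar fu; exact: bdeg_push.
move=> g g' x y z fx fx' gg' E.
have := oner_neq0 (bop (l2hilbert R ((Mone h, 1%g) : (M * G)%type))).
have fx0 : f x = 0 := bdeg_uniq fx fx' gg'.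
by rewrite -(rmorph1 f) -E !rmorphM /= fx0 mulr0 mul0r eqxx.
Qed.

(** * Projections with sum 1 in a C*-algebra are orthogonal *)

Section CStarBasics.
Variables (R : realType) (A : cstarAlgType R).
Local Notation C := R[i].
Implicit Types (x y p q k : A) (z w : C).

Lemma star1 : star 1 = 1 :> A.
Proof. by rewrite -[LHS]mulr1 -{2}[1]starK -starM mulr1 starK. Qed.

Lemma star0 : star 0 = 0 :> A.
Proof. by apply: (addrI (star 0)); rewrite -starD !addr0. Qed.

Lemma starN x : star (- x) = - star x.
Proof. by apply: (addrI (star x)); rewrite -starD !subrr star0. Qed.

Lemma cnorm0 : cnorm (0 : A) = 0.
Proof. by rewrite -(scale0r (0 : A)) cnormZ ComplexField.Normc.normc0 mul0r. Qed.

Lemma normcN1 : ComplexField.Normc.normc (-1 : C) = 1.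
Proof. by rewrite /= oppr0 sqrrN expr1n expr0n addr0 sqrtr1. Qed.

Lemma cnormN x : cnorm (- x) = cnorm x.
Proof. by rewrite -scaleN1r cnormZ normcN1 mul1r. Qed.

Lemma cnorm_ge0 x : 0 <= cnorm x.
Proof. by have := cnormD x (- x); rewrite subrr cnorm0 cnormN; lra. Qed.

Lemma cnorm_half x y : cnorm x <= 1 -> cnorm y <= 1 ->
  cnorm ((2^-1 : C) *: (x + y)) <= 1.
Proof.
move=> x1 y1; rewrite cnormZ.
have -> : (2^-1 : C) = (2^-1 : R)%:C%C by rewrite fmorphV rmorph_nat.
have -> : ComplexField.Normc.normc (2^-1 : R)%:C%C = 2^-1.
  by rewrite /= expr0n addr0 sqrtr_sqr ger0_norm.
by have := cnormD x y; lra.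
Qed.

Lemma cnorm_mulrn x n : cnorm (x *+ n) <= cnorm x *+ n.
Proof.
elim: n => [|n IH]; first by rewrite !mulr0n cnorm0.
by rewrite !mulrS (le_trans (cnormD _ _)) // lerD2l.
Qed.

Lemma cnorm_sum (I : Type) (r : seq I) (Q : pred I) (f : I -> A) :
  cnorm (\sum_(i <- r | Q i) f i) <= \sum_(i <- r | Q i) cnorm (f i).
Proof.
elim/big_rec2: _ => [|i a b _ ab]; first by rewrite cnorm0.
by apply: le_trans (cnormD _ _) _; rewrite lerD2l.
Qed.

Definition projection p := p * p = p /\ star p = p.

Lemma projection_norm p : projection p -> cnorm p <= 1.
Proof.
move=> [pp sp]; have := cnorm_star p; rewrite sp pp => E.
have := cnorm_ge0 p; nra.
Qed.

Lemma projection_compl p : projection p -> projection (1 - p).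
Proof.
move=> [pp sp]; split; last by rewrite starD starN star1 sp.
by rewrite mulrBr mulr1 mulrBl mul1r pp subrr subr0.
Qed.

Section Corner.
Variables p k : A.
Hypotheses (p_proj : projection p) (k_sa : star k = k) (pk : p * k = k) (kp : k
  * p = k).

Lemma corner_mul z w :
  (p + z *: k) * (p + w *: k) = p + (z + w) *: k + (z * w) *: (k * k).
Proof.
have [pp _] := p_proj.
rewrite mulrDl !mulrDr pp -!scalerAr -!scalerAl pk kp scalerA (mulrC w z).
by rewrite (addrC z w) scalerDl !addrA.
Qed.

Lemma corner_square z : cnorm (p + z *: k) <= 1 ->
  cnorm (p + (z + z) *: k + (z * z) *: (k * k)) <= 1.
Proof.
move=> z1; rewrite -corner_mul; apply: le_trans (cnormM _ _) _.
by have := cnorm_ge0 (p + z *: k); nra.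
Qed.

(** The mean of the squares of two elements of norm at most 1 has norm at most 1. *)
Lemma corner_half z w : cnorm (p + z *: k) <= 1 -> cnorm (p + w *: k) <= 1 ->
  cnorm (p + (z + w) *: k + (2^-1 * (z * z + w * w)) *: (k * k)) <= 1.
Proof.
move=> /corner_square z1 /corner_square w1; have := cnorm_half z1 w1.
have pp2 : p + p = (2 : C) *: p by rewrite scaler_nat mulr2n.
congr (cnorm _ <= 1); rewrite addrACA (addrACA p) -!scalerDl pp2 !scalerDr.
rewrite !scalerA mulVf ?pnatr_eq0 // scale1r; congr (_ + _ *: _ + _).
by field.
Qed.

(* The squares of p + z k and p + w k have the average p + (z + w) k. *)
Lemma corner_step z w : z * z + w * w = 0 ->
  cnorm (p + z *: k) <= 1 -> cnorm (p + w *: k) <= 1 ->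
  cnorm (p + (z + w) *: k) <= 1.
Proof.
by move=> zw z1 w1; have := corner_half z1 w1; rewrite zw mulr0 scale0r addr0.
Qed.

Lemma corner_conj z : cnorm (p + z *: k) ^+ 2 =
  cnorm (p + (conjc z + z) *: k + (conjc z * z) *: (k * k)).
Proof. by rewrite -cnorm_star starD starZ k_sa p_proj.2 corner_mul. Qed.

(** For z = i or -i one has |p + zk|^2 = |p + k^2|, and p + k^2 is the mean of the squares of p + k
    and p - k. *)
Lemma corner_i z : z * z = -1 -> conjc z = - z ->
  cnorm (p + 1 *: k) <= 1 -> cnorm (p + (-1) *: k) <= 1 ->
  cnorm (p + z *: k) <= 1.
Proof.
move=> zz cz p1 n1; rewrite -(@ler_pXn2r _ 2) ?nnegrE ?cnorm_ge0 // expr1n.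
rewrite corner_conj cz mulNr zz opprK addNr.
have := corner_half p1 n1; rewrite subrr.
by have -> : 2^-1 * (1 * 1 + (-1) * (-1)) = 1 :> C by field.
Qed.

(** Call z admissible if |p + zk| <= 1. Then 1, i and -i are admissible; 1^2 + i^2 = 0 makes 1 + i
    admissible, likewise 1 - i; and (1+i)^2 + (1-i)^2 = 0 makes their sum 2 admissible. *)
Lemma corner_double :
  cnorm (p + 1 *: k) <= 1 -> cnorm (p + (-1) *: k) <= 1 ->
  cnorm (p + 2 *: k) <= 1.
Proof.
move=> p1 n1; have ii : 'i%C * 'i%C = -1 :> C by rewrite -expr2 sqr_i.
have ci : conjc 'i%C = - 'i%C :> C.
  by apply/eqP; rewrite eq_complex /= oppr0 !eqxx.
have i1 := corner_i ii ci p1 n1.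
have mi1 : cnorm (p + (- 'i%C) *: k) <= 1.
  by apply: corner_i => //; [rewrite mulrNN|apply/eqP;
    rewrite eq_complex /= !oppr0 !eqxx].
have -> : (2 : C) = (1 + 'i%C) + (1 - 'i%C) by ring.
have e1 : (1 * 1 + 'i%C * 'i%C = 0 :> C) by rewrite ii mulr1 subrr.
have e2 : (1 * 1 + (- 'i%C) * (- 'i%C) = 0 :> C) by rewrite mulrNN.
apply: corner_step; [|exact: corner_step|exact: corner_step].
have -> : (1 + 'i%C) * (1 + 'i%C) + (1 - 'i%C) * (1 - 'i%C) =
  2 * (1 * 1 + 'i%C * 'i%C) :> C by ring.
by rewrite e1 mulr0.
Qed.

End Corner.

(* Both inequalities persist under doubling k. *)
Lemma corner_eq0 p k : projection p -> star k = k -> p * k = k -> k * p = k ->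
  cnorm (p + k) <= 1 -> cnorm (p - k) <= 1 -> k = 0.
Proof.
move=> pP sk pk kp p1 n1.
have p2 n : (2 ^+ n : C) = (2 ^+ n : R)%:C%C by rewrite rmorphXn rmorph_nat.
have pow n : cnorm (p + (2 ^+ n : C) *: k) <= 1 /\ cnorm (p - (2 ^+ n : C) *:
  k) <= 1.
  elim: n => [|n [IH1 IH2]]; first by rewrite expr0 scale1r.
  pose l := (2 ^+ n : C) *: k.
  have sl : star l = l.
    by rewrite /l starZ sk p2 conjc_real.
  have pl : p * l = l by rewrite /l -scalerAr pk.
  have lp : l * p = l by rewrite /l -scalerAl kp.
  have l1 : cnorm (p + 1 *: l) <= 1 by rewrite scale1r.
  have l2 : cnorm (p + (-1) *: l) <= 1 by rewrite scaleN1r.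
  rewrite exprS -scalerA -/l; split; first exact: corner_double.
  rewrite -scalerN; apply: corner_double => //.
  - by rewrite starN sl.
  - by rewrite mulrN pl.
  - by rewrite mulNr lp.
  - by rewrite scalerN scale1r -scaleN1r.
  - by rewrite scaleN1r opprK -(scale1r l).
apply: cnorm_eq0; apply/le_anti; rewrite cnorm_ge0 andbT leNgt; apply/negP => k0.
(* As n <= 2^n, the norm of 2^n k exceeds 2, although 2^n k is the difference of p + 2^n k and p. *)
have [n nP] : exists n : nat, 2 < cnorm k * n%:R.
  exists (Num.bound (2 / cnorm k)).
  rewrite mulrC -ltr_pdivrMr //.
  by apply: archi_boundP; rewrite divr_ge0 // ltW.
have := (pow n).1; have := cnormD (p + (2 ^+ n : C) *: k) (- p).
rewrite addrAC subrr add0r cnormN cnormZ.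
have -> : ComplexField.Normc.normc (2 ^+ n : C) = 2 ^+ n.
  by rewrite p2 /= expr0n addr0 sqrtr_sqr ger0_norm // exprn_ge0.
have := projection_norm pP.
have : cnorm k * n%:R <= 2 ^+ n * cnorm k.
  by rewrite mulrC ler_wpM2r ?cnorm_ge0 // -natrX ler_nat ltnW // ltn_expl.
lra.
Qed.

Lemma sumr_const_seq (V : zmodType) (I : Type) (r : seq I) (x : V) :
  \sum_(i <- r) x = x *+ size r.
Proof. by rewrite big_const_seq iter_addr_0 count_predT. Qed.

(** Compressed by p = [f i], the other projections become positive elements with sum 0. That they
    vanish is obtained from norm estimates in place of positivity. *)
Lemma projections_orthogonal (I : eqType) (r : seq I) (f : I -> A) (i j : I) :
  uniq r -> (forall l, l \in r -> projection (f l)) ->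
  \sum_(l <- r) f l = 1 -> i \in r -> j \in r -> i != j -> f i * f j = 0.
Proof.
move=> ur fP f1 ir jr ij; have [pp sp] := fP i ir.
(* The x l with l != i sum to 0 and satisfy |p - x l| <= 1; hence
   |n p + x j|, |n p - x j| <= n for large n. *)
pose p := f i; pose x l := p * f l * p.
have px l : p * x l = x l by rewrite /x !mulrA pp.
have xp l : x l * p = x l by rewrite /x -mulrA pp.
have le l : l \in r -> cnorm (p - x l) <= 1.
  move=> lr; have -> : p - x l = p * (1 - f l) * p.
    by rewrite mulrBr mulr1 mulrBl pp.
  have p1 := projection_norm (fP i ir); have p0 := cnorm_ge0 p.
  have := projection_norm (projection_compl (fP l lr)).
  have := cnorm_ge0 (1 - f l); have := cnormM (p * (1 - f l)) p.
  have := cnormM p (1 - f l); rewrite -/p in p1 *; nra.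
pose t := [seq l <- r | (l != i) && (l != j)].
have sum0 : x j + \sum_(l <- t) x l = 0.
  have : p * (\sum_(l <- r) f l) * p = p by rewrite f1 mulr1.
  rewrite mulr_sumr mulr_suml (bigD1_seq i) //= -/p pp pp => /(canRL (addKr p)).
  rewrite addNr => E; rewrite -[RHS]E -[RHS]big_filter [RHS](bigD1_seq j)
    ?filter_uniq //=.
    by rewrite big_filter_cond big_filter.
  by rewrite mem_filter eq_sym ij.
have tr l : l \in t -> l \in r by rewrite mem_filter => /andP[].
have norm_sum : cnorm (\sum_(l <- t) (p - x l)) <= (size t)%:R.
  apply: le_trans (cnorm_sum _ _ _) _; rewrite -sumr_const_seq.
  by rewrite !big_seq; apply: ler_sum => l /tr/le.
(* Both n p + x j and n p - x j are sums of n terms of norm at most 1 each or in total: p with the p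
   - x l for l in t, respectively n - 1 copies of p with p - x j. *)
pose n := (size t).+1.
have n0 : (n%:R : C) != 0 by rewrite pnatr_eq0.
have VE : (n%:R^-1 : C) = (n%:R^-1 : R)%:C%C by rewrite fmorphV rmorph_nat.
have normVn y : cnorm ((n%:R^-1 : C) *: y) = n%:R^-1 * cnorm y.
  rewrite cnormZ; congr (_ * _).
  by rewrite VE /= expr0n addr0 sqrtr_sqr ger0_norm.
have Vn y : (n%:R^-1 : C) *: (y *+ n) = y.
  by rewrite -(scaler_nat _ y) scalerA mulVf ?scale1r.
have p1 := projection_norm (fP i ir); rewrite -/p in p1.
have k0 : (n%:R^-1 : C) *: x j = 0.
  apply: (@corner_eq0 p) => //.
  - rewrite starZ /x !starM sp (fP j jr).2 mulrA; congr (_ *: _).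
    by rewrite VE conjc_real.
  - by rewrite -scalerAr px.
  - by rewrite -scalerAl xp.
  - rewrite -{1}(Vn p) -scalerDr normVn mulrC ler_pdivrMr ?ltr0n // mul1r.
    have -> : p *+ n + x j = p + \sum_(l <- t) (p - x l).
      rewrite big_split /= sumr_const_seq sumrN mulrS -addrA; congr (_ + (_ + _)).
      by apply/eqP; rewrite -subr_eq0 opprK sum0.
    by apply: le_trans (cnormD _ _) _; rewrite /n mulrS lerD.
  rewrite -{1}(Vn p) -scalerBr normVn mulrC ler_pdivrMr ?ltr0n // mul1r.
  have -> : p *+ n - x j = p *+ size t + (p - x j) by rewrite addrA -mulrSr.
  apply: le_trans (cnormD _ _) _; rewrite /n mulrSr lerD ?le //.
  by apply: le_trans (cnorm_mulrn _ _) _; rewrite lerMn2r p1 orbT.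
have xj0 : x j = 0.
  by rewrite -[x j]scale1r -(mulfV n0) -scalerA k0 scaler0.
have fjp : f j * p = 0.
  apply: cnorm_eq0; apply/eqP; rewrite -sqrf_eq0 -cnorm_star starM sp (fP j jr).2.
  by rewrite mulrA -(mulrA p) (fP j jr).1 -/(x j) xj0 cnorm0.
by rewrite -[LHS]starK starM sp (fP j jr).2 fjp star0.
Qed.

End CStarBasics.

(** * The projections F and the partial isometries t_g *)

Section CuntzLiAlgebraTheory.
Local Open Scope classical_set_scope.
Variables (R : realType) (G : groupType) (N H M : set G).
Variable h : CuntzLi_setting N H M.
Variables (A : cstarAlgType R) (s : Pset H M -> A) (u : M -> A).
Hypothesis rel : CuntzLi_relations s u.
Local Notation P := (Pset H M).
Local Notation C := R[i].
Local Notation cong := (congM M).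

Lemma s_isom a : star (s a) * s a = 1. Proof. exact: (CLr_isometry rel). Qed.
Lemma u_isom m : star (u m) * u m = 1. Proof. exact: (CLr_unitary rel m).1. Qed.
Lemma u_coisom m : u m * star (u m) = 1. Proof. exact: (CLr_unitary rel m).2. Qed.
Lemma s_mul a b : s a * s b = s (Pmul h a b). Proof. exact: (CLr_sM rel). Qed.
Lemma u_mul m n : u m * u n = u (Mmul h m n). Proof. exact: (CLr_uM rel). Qed.
Lemma s_u a m : s a * u m = u (Mconj a m) * s a. Proof. exact: (CLr_su rel). Qed.

Lemma isom_idem_eq1 (x : A) : star x * x = 1 -> x * x = x -> x = 1.
Proof. by move=> xx x2; rewrite -[LHS]mul1r -xx -mulrA x2. Qed.

Lemma u1 : u (Mone h) = 1.
Proof.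
apply: isom_idem_eq1; first exact: u_isom.
by apply: (CLr_uM rel) => //=; rewrite mulg1.
Qed.

Lemma s1 : s (Pone h) = 1.
Proof.
apply: isom_idem_eq1; first exact: s_isom.
by apply: (CLr_sM rel) => //=; rewrite mulg1.
Qed.

Lemma star_u m : star (u m) = u (Minv h m).
Proof.
have um : u m * u (Minv h m) = 1.
  by rewrite -u1; apply: (CLr_uM rel) => //=; rewrite mulgV.
by rewrite -[LHS]mulr1 -um mulrA u_isom mul1r.
Qed.

Definition pr (k : M) (a : P) : A := u k * erange s a * star (u k).

Lemma prE k a : pr k a = (u k * s a) * star (u k * s a).
Proof. by rewrite starM /pr /erange !mulrA. Qed.

Lemma us_isom k a : star (u k * s a) * (u k * s a) = 1.
Proof. by rewrite starM mulrA -(mulrA (star (s a))) u_isom mulr1 s_isom. Qed.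

Lemma pr_projection k a : projection (pr k a).
Proof.
rewrite prE; split; last by rewrite starM starK.
by rewrite mulrA -(mulrA (u k * s a)) us_isom mulr1.
Qed.

Lemma prK k a : pr k a * pr k a = pr k a. Proof. exact: (pr_projection k a).1. Qed.
Lemma star_pr k a : star (pr k a) = pr k a. Proof. exact: (pr_projection k
  a).2. Qed.

Lemma pr_neq0 k a : pr k a != 0.
Proof.
apply/eqP => k0; have := us_isom k a.
have -> : u k * s a = pr k a * (u k * s a) by rewrite prE -mulrA us_isom mulr1.
by rewrite k0 mul0r mulr0 => /eqP; rewrite eq_sym oner_eq0.
Qed.

Lemma u_pr m k a : u m * pr k a * star (u m) = pr (Mmul h m k) a.
Proof. by rewrite /pr -u_mul starM !mulrA. Qed.

Lemma s_pr (b : P) k (a c : P) : val c = (val b * val a)%g ->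
  s b * pr k a * star (s b) = pr (Mconj b k) c.
Proof.
move=> cE; have E : s b * (u k * s a) = u (Mconj b k) * s c.
  by rewrite mulrA s_u -mulrA (CLr_sM rel cE).
by rewrite !prE mulrA -mulrA -starM E.
Qed.

(** If l = k a n a^{-1}, then u(l) s_a = u(k) s_a u(n), and the unitary u(n) cancels in the range
    projection. *)
Lemma pr_congM k l a : cong (val a) (val k) (val l) -> pr k a = pr l a.
Proof.
move=> [m Mm E]; pose n : M := SigSub (mem_set Mm).
have E' : u l * s a = u k * s a * u n.
  rewrite -mulrA s_u mulrA; congr (_ * _); apply/esym/(CLr_uM rel) => //=.
  by rewrite E mulVKg.
by rewrite !prE E' (starM _ (u n)) mulrA -(mulrA (u k * s a)) u_coisom mulr1.
Qed.

Lemma transversal_ex (a : P) : exists ks : seq M, Defs.transversal a ks.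
Proof.
have lcosP m x : lcos m (conjset (val a) M) x <-> cong (val a) m x.
  split=> [[k Mk <-]|Mx]; first by rewrite /congM mulKg.
  by exists (m^-1 * x)%g => //; rewrite mulVKg.
have /finite_seqP[S SE] := CL_finite_index h (set_valP a).
have repP (K : set G) : exists k : M, cosets M (val a) K -> K (val k).
  have [[m Mm <-]|nK] := pselect (cosets M (val a) K); last by exists (Mone h).
  by exists (SigSub (mem_set Mm)) => _; apply/lcosP; exact: (congM_refl h).
have [rep rP] := choice repP.
have SP K : K \in S -> cosets M (val a) K by move=> KS; rewrite SE.
have repE K m : K \in S -> K m -> cong (val a) (val (rep K)) m.
  move=> /SP KS; have := rP _ KS; have [k Mk <-] := KS.
  move=> /lcosP kr /lcosP km; exact: (congM_trans h (congM_sym h kr) km).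
exists [seq rep K | K <- undup S]; split.
- rewrite map_inj_in_uniq ?undup_uniq // => K K'; rewrite !mem_undup => KS KS' E.
  apply/seteqP; split=> x Kx.
    have := repE _ _ KS Kx; rewrite E; have := rP _ (SP _ KS').
    have [k Mk <-] := SP _ KS' => /lcosP kr rx; apply/lcosP.
    exact: (congM_trans h kr rx).
  have := repE _ _ KS' Kx; rewrite -E; have := rP _ (SP _ KS).
  have [k Mk <-] := SP _ KS => /lcosP kr rx; apply/lcosP.
  exact: (congM_trans h kr rx).
- move=> m; pose K := lcos (val m) (conjset (val a) M).
  have KS : K \in S.
    by have : cosets M (val a) K by [exists (val m) => //; exact: set_valP];
      rewrite SE.
  exists (rep K); first by apply: map_f; rewrite mem_undup.
  by apply: repE => //; apply/lcosP; exact: (congM_refl h).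
move=> k l /mapP[K + ->] /mapP[K' + ->]; rewrite !mem_undup => KS KS' kl.
congr rep; have := rP _ (SP _ KS); have := rP _ (SP _ KS').
have [x Mx xE] := SP _ KS; have [y My yE] := SP _ KS'.
rewrite -{1}xE -{1}yE => /lcosP yr /lcosP xr.
have xy : cong (val a) x y.
  exact: (congM_trans h (congM_trans h xr kl) (congM_sym h yr)).
rewrite -xE -yE; apply/seteqP; split=> z /lcosP zz; apply/lcosP.
  exact: (congM_trans h (congM_sym h xy) zz).
exact: (congM_trans h xy zz).
Qed.

Lemma pr_orth k l a : ~ cong (val a) (val k) (val l) -> pr k a * pr l a = 0.
Proof.
move=> kl; have [ks tks] := transversal_ex a; have [uks ex un] := tks.
have [k' k'ks kk'] := ex k; have [l' l'ks ll'] := ex l.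
rewrite -(pr_congM kk') -(pr_congM ll').
apply: (@projections_orthogonal _ _ _ ks (fun k => pr k a)) => //.
- by move=> m _; exact: pr_projection.
- exact: (CLr_sum rel).
apply/eqP => kl'; apply: kl; rewrite kl' in kk'.
exact: (congM_trans h (congM_sym h kk') ll').
Qed.

Lemma sum_pr a ks : Defs.transversal a ks -> \sum_(k <- ks) pr k a = 1.
Proof. exact: (CLr_sum rel). Qed.

Lemma pr_ext a (x y : A) : (forall k, x * pr k a = y * pr k a) -> x = y.
Proof.
move=> xy; have [ks tks] := transversal_ex a.
rewrite -[x]mulr1 -[y]mulr1 -(sum_pr tks) !mulr_sumr.
by apply: eq_bigr => k _.
Qed.

Section Refine.
Variables (a b c : P).
Hypothesis bE : val b = (val a * val c)%g.

(** From u(l) s_b = u(l) s_a s_c, the range of u(l) s_b lies in that of u(l) s_a. *)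
Lemma pr_sub k l : cong (val a) (val k) (val l) -> pr k a * pr l b = pr l b.
Proof.
move=> /pr_congM ->; have E : u l * s b = u l * s a * s c.
  by rewrite -(CLr_sM rel bE) mulrA.
rewrite !prE E; move: (u l * s a) (us_isom l a) => v vv.
by rewrite !mulrA -(mulrA v (star v)) vv mulr1.
Qed.

Lemma pr_disj k l : ~ cong (val a) (val k) (val l) -> pr k a * pr l b = 0.
Proof.
by move=> kl; rewrite -(pr_sub (congM_refl h _ _)) mulrA pr_orth // mul0r.
Qed.

Lemma pr_subr k l : cong (val a) (val k) (val l) -> pr l b * pr k a = pr l b.
Proof. by move=> kl; rewrite -[LHS]starK starM !star_pr pr_sub ?star_pr. Qed.

End Refine.

(** By [FspanP] these f exhaust the span defining F: f is a function on M/M_a, with value c on the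
    coset of k. Recording both products makes f commute with the projections of its level. *)
Definition diag (a : P) (f : A) : Prop :=
  forall k, exists c : C, f * pr k a = c *: pr k a /\ pr k a * f = c *: pr k a.

Lemma diag_pr k a : diag a (pr k a).
Proof.
move=> l; have [kl|kl] := pselect (cong (val a) (val k) (val l)).
  by exists 1; rewrite (pr_congM kl) scale1r prK.
exists 0; rewrite scale0r; split; apply: pr_orth => // lk.
by apply: kl; exact: (congM_sym h).
Qed.

Lemma diag_sub (a b c : P) f : val b = (val a * val c)%g -> diag a f -> diag b f.
Proof.
move=> bE af k; have [z [fk kf]] := af k; exists z.
have kk := congM_refl h (val a) (val k).
split; first by rewrite -{1}(pr_sub bE kk) mulrA fk -scalerAl (pr_sub bE kk).
by rewrite -{1}(pr_subr bE kk) -mulrA kf -scalerAr (pr_subr bE kk).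
Qed.

Lemma diag_zero a : diag a 0.
Proof. by move=> k; exists 0; rewrite mul0r mulr0 scale0r. Qed.

Lemma diagD a f g : diag a f -> diag a g -> diag a (f + g).
Proof.
move=> af ag k; have [z [E1 E2]] := af k; have [w [E3 E4]] := ag k.
by exists (z + w); rewrite mulrDl mulrDr E1 E2 E3 E4 scalerDl.
Qed.

Lemma diagZ a z f : diag a f -> diag a (z *: f).
Proof.
move=> af k; have [w [E1 E2]] := af k; exists (z * w).
by rewrite -scalerAl -scalerAr E1 E2 scalerA.
Qed.

Lemma diagM a f g : diag a f -> diag a g -> diag a (f * g).
Proof.
move=> af ag k; have [z [E1 E2]] := af k; have [w [E3 E4]] := ag k.
exists (w * z); split; first by rewrite -mulrA E3 -scalerAr E1 scalerA.
by rewrite mulrA E2 -scalerAl E4 scalerA mulrC.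
Qed.

Lemma diag_comm a f g : diag a f -> diag a g -> f * g = g * f.
Proof.
move=> af ag; apply: (@pr_ext a) => k; have [z [E1 _]] := af k;
  have [w [E3 _]] := ag k.
by rewrite -!mulrA E1 E3 -!scalerAr E1 E3 !scalerA mulrC.
Qed.

Lemma diag_common a b f g : diag a f -> diag b g ->
  exists c : P, [/\ diag c f, diag c g & exists d : P, val c = (val a * val d)%g].
Proof.
move=> af bg; have [[p q] /= E] := ore_right h a b; exists (Pmul h a p); split.
- exact: (diag_sub (c := p)) af.
- by apply: (diag_sub (c := q)) bg; rewrite /= E.
- by exists p.
Qed.

Lemma FspanP f : Fspan s u f <-> exists a, diag a f.
Proof.
split=> [[n [c [k [b ->]]]]|[a af]].
  elim/big_ind: _ => [|x y [a ax] [a' ay]|i _].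
  - by exists (Pone h); exact: diag_zero.
  - have [d [dx dy _]] := diag_common ax ay; exists d; exact: diagD.
  - by exists (b i); apply/diagZ/diag_pr.
have [ks tks] := transversal_ex a; have [c cP] := choice af.
exists (size ks), (fun i => c (nth (Mone h) ks i)), (fun i => nth (Mone h) ks i).
exists (fun=> a); rewrite -[LHS]mulr1 -(sum_pr tks) mulr_sumr.
rewrite (big_nth (Mone h)) big_mkord; apply: eq_bigr => i _.
exact: (cP _).1.
Qed.

Local Notation F := (Fset s u).

Lemma Fset_diag f : F f -> exists a, diag a f.
Proof. by move=> [/FspanP]. Qed.

(** Idempotence forces each eigenvalue z to satisfy z^2 = z, and f stays diagonal at every level
    finer than a. *)
Lemma Fset_dichotomy f : F f ->
  exists a : P, forall (b c : P) k, val b = (val a * val c)%g ->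
  (f * pr k b = pr k b /\ pr k b * f = pr k b) \/ (f * pr k b = 0 /\ pr k b * f
    = 0).
Proof.
move=> [/FspanP[a af] ff _]; exists a => b c k /diag_sub/(_ af)/(_ k)[z [E1 E2]].
have : (z * z - z) *: pr k b == 0.
  by rewrite scalerBl -scalerA -E1 scalerAr -E1 mulrA ff subrr.
rewrite scaler_eq0 (negPf (pr_neq0 k b)) orbF -{3}[z]mulr1 -mulrBr mulf_eq0
  subr_eq0.
move=> /orP[|] /eqP z01; rewrite z01 ?scale0r ?scale1r in E1 E2; tauto.
Qed.

Lemma Fset_comm f g : F f -> F g -> f * g = g * f.
Proof.
move=> /Fset_diag[a af] /Fset_diag[b bg]; have [c [cf cg _]] := diag_common af bg.
exact: diag_comm cf cg.
Qed.

Lemma Fset_mul f g : F f -> F g -> F (f * g).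
Proof.
move=> Ff Fg; have fg := Fset_comm Ff Fg.
have [[Sf ff sf] [Sg gg sg]] := (Ff, Fg).
split; [|by rewrite {1}fg -mulrA (mulrA f) ff mulrA -fg -mulrA gg|by rewrite
  starM sf sg fg].
move/FspanP: Sf => [a af]; move/FspanP: Sg => [b bg]; apply/FspanP.
by have [c [cf cg _]] := diag_common af bg; exists c; exact: diagM.
Qed.

Lemma Fset_pr k a : F (pr k a).
Proof.
by split; [apply/FspanP; exists a; exact: diag_pr|exact: prK|exact: star_pr].
Qed.

Lemma Fset0 : F 0.
Proof.
split; [|by rewrite mul0r|exact: star0].
by apply/FspanP; exists (Pone h); exact: diag_zero.
Qed.

Lemma Fset1 : F 1.
Proof.
have -> : 1 = pr (Mone h) (Pone h) by rewrite prE u1 s1 !mul1r star1.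
exact: Fset_pr.
Qed.

Lemma Fset_u_conj m f : F f -> F (u m * f * star (u m)).
Proof.
move=> [[n [c [k [b fE]]]] ff sf]; split.
- exists n, c, (fun i => Mmul h m (k i)), b.
  rewrite fE mulr_sumr mulr_suml; apply: eq_bigr => i _.
  by rewrite -scalerAr -scalerAl u_pr.
- by rewrite !mulrA -(mulrA _ (star (u m)) (u m)) u_isom mulr1 -(mulrA (u m) f) ff.
- by rewrite !starM starK sf mulrA.
Qed.

Lemma Fset_s_conj a f : F f -> F (s a * f * star (s a)).
Proof.
move=> [[n [c [k [b fE]]]] ff sf]; split.
- exists n, c, (fun i => Mconj a (k i)), (fun i => Pmul h a (b i)).
  rewrite fE mulr_sumr mulr_suml; apply: eq_bigr => i _.
  rewrite -scalerAr -scalerAl; congr (_ *: _).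
  exact: (@s_pr a (k i) (b i) (Pmul h a (b i))).
- by rewrite !mulrA -(mulrA _ (star (s a)) (s a)) s_isom mulr1 -(mulrA (s a) f) ff.
- by rewrite !starM starK sf mulrA.
Qed.

Lemma erangeE a : erange s a = pr (Mone h) a.
Proof. by rewrite /pr u1 star1 mulr1 mul1r. Qed.

Lemma Fset_erange a : F (erange s a). Proof. by rewrite erangeE;
  exact: Fset_pr. Qed.

Lemma star_s_comm a f : F f -> star (s a) * f = star (s a) * f * s a * star (s a).
Proof.
move=> Ff; rewrite -[RHS]mulrA -[s a * _]/(erange s a) -mulrA.
rewrite (Fset_comm Ff (Fset_erange a)) /erange !mulrA s_isom mul1r //.
Qed.

(** The levels occurring in f need not be of the form aq, so f is first refined to such a level.
    There conjugation by s_a identifies the projections of level q with projections of level aq, and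
    the compression of f is diagonal at level q. *)
Lemma Fset_star_s_conj a f : F f -> F (star (s a) * f * s a).
Proof.
move=> Ff; have [/FspanP[c cf] ff sf] := Ff; split.
- have [[p q] /= E] := ore_right h c a.
  have df : diag (Pmul h a q) f by apply: (diag_sub (c := p)) cf; rewrite /= E.
  apply/FspanP; exists q => k; have [z [E1 E2]] := df (Mconj a k).
  rewrite -(@s_pr a k q (Pmul h a q)) // in E1 E2; exists z.
  move: (pr k q) E1 E2 => x E1 E2.
  have sK y : star (s a) * (s a * y) = y by rewrite mulrA s_isom mul1r.
  split.
    transitivity (star (s a) * (f * (s a * x * star (s a))) * s a).
      by rewrite -!mulrA s_isom mulr1.
    by rewrite E1 -scalerAr -scalerAl -!mulrA sK s_isom mulr1.
  transitivity (star (s a) * ((s a * x * star (s a)) * f) * s a).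
    by rewrite -!mulrA sK.
  by rewrite E2 -scalerAr -scalerAl -!mulrA sK s_isom mulr1.
- by rewrite [LHS]mulrA [X in X * s a]mulrA -star_s_comm // -(mulrA _ f f) ff.
- by rewrite !starM starK sf mulrA.
Qed.

(** Replacing (a, m, b) by (pa, pmp^{-1}, pb) changes neither the word nor the group element. Once
    the left entries agree, the trivial intersection of N and H makes the decomposition unique. *)
Lemma word_indep (a b c d : P) (m n : M) :
  ((val a)^-1 * val m * val b = (val c)^-1 * val n * val d)%g ->
  star (s a) * u m * s b = star (s c) * u n * s d.
Proof.
have red (p a' b' : P) (m' : M) : star (s a') * u m' * s b' =
    star (s (Pmul h p a')) * u (Mconj p m') * s (Pmul h p b').
  have E : star (s p) * u (Mconj p m') * s p = u m'.
    by rewrite -mulrA -s_u mulrA s_isom mul1r.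
  by rewrite -!s_mul starM -E !mulrA.
move=> E; have [[p q] /= E'] := ore_left h a c.
rewrite (red p a) (red q c); have -> : Pmul h p a = Pmul h q c by exact: val_inj.
have NM (k : M) : N (val k) by apply: (CL_M_sub h); exact: set_valP.
have [E1 E2] : val (Mconj p m) = val (Mconj q n) /\
               val (Pmul h p b) = val (Pmul h q d).
  apply: (NH_uniq h (NM _) (NM _) (P_H _) (P_H _)) => /=.
  have -> : (val p * val m * (val p)^-1 * (val p * val b) =
      val p * val a * ((val a)^-1 * val m * val b))%g.
    by rewrite !mulgA mulgVK mulgK.
  by rewrite E E' !mulgA mulgVK mulgK.
by rewrite (val_inj E1) (val_inj E2).
Qed.

(* The partial isometry t_g; the decomposition of g is a choice, irrelevant by
   tgE. *)
Definition tg (g : G) : A :=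
  let: (a, m, b) := sval (G_decomp h g) in star (s a) * u m * s b.

Lemma tgE (a b : P) (m : M) :
  tg ((val a)^-1 * val m * val b)%g = star (s a) * u m * s b.
Proof.
rewrite /tg; case: (G_decomp h _) => -[[c n] d] /= E.
exact: word_indep.
Qed.

Lemma tg_ind (Q : G -> Prop) :
  (forall (a b : P) (m : M), Q ((val a)^-1 * val m * val b)%g) -> forall g, Q g.
Proof. by move=> Qw g; have [[[a m] b] ->] := G_decomp h g; exact: Qw. Qed.

Lemma star_tg g : star (tg g) = tg g^-1%g.
Proof.
elim/tg_ind: g => a b m; rewrite tgE !starM starK star_u mulrA.
rewrite (_ : (_^-1)%g = ((val b)^-1 * val (Minv h m) * val a)%g) ?tgE //.
by rewrite /= !invgM invgK !mulgA.
Qed.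

Lemma Fset_tg_conj g f : F f -> F (tg g * f * star (tg g)).
Proof.
elim/tg_ind: g => a b m Ff; rewrite tgE.
have -> : star (s a) * u m * s b * f * star (star (s a) * u m * s b) =
    star (s a) * (u m * (s b * f * star (s b)) * star (u m)) * s a.
  by rewrite !starM starK !mulrA.
by apply/Fset_star_s_conj/Fset_u_conj/Fset_s_conj.
Qed.

Definition tg_range g := tg g * star (tg g).

Lemma Fset_tg_range g : F (tg_range g).
Proof. by have := Fset_tg_conj g Fset1; rewrite mulr1. Qed.

(** Here t_g is the adjoint of s_a times an isometry w. The range projections of w and s_a commute,
    and this makes t_g a partial isometry. *)
Lemma tg_rangeK g : tg_range g * tg g = tg g.
Proof.
elim/tg_ind: g => a b m; rewrite /tg_range tgE -(mulrA (star (s a))).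
have : F ((u m * s b) * star (u m * s b)) by rewrite -prE; exact: Fset_pr.
move: (u m * s b) (us_isom m b) => w ww Fw; rewrite starM starK.
transitivity (star (s a) * ((w * star w) * erange s a) * w).
  by rewrite /erange !mulrA.
rewrite (Fset_comm Fw (Fset_erange a)) /erange -!mulrA ww mulr1.
by rewrite !mulrA s_isom mul1r.
Qed.

Lemma Fset_tg_comm g f : F f -> tg g * f = (tg g * f * star (tg g)) * tg g.
Proof.
move=> Ff; have sg : star (tg g) * tg g = tg_range g^-1%g.
  by rewrite /tg_range -star_tg starK.
rewrite -[RHS]mulrA sg -[RHS]mulrA (Fset_comm Ff (Fset_tg_range _)) mulrA -sg mulrA.
by rewrite -[tg g * star (tg g)]/(tg_range g) tg_rangeK.
Qed.

(** Moving u(m) and the adjoint of s_a to the right of f conjugates f within F and leaves the bare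
    word of the product in G. *)
Lemma word_normal a a' m m' f : F f ->
  star (s a) * u m * f * u m' * s a' =
  star (s a) * (u m * f * star (u m)) * s a *
  tg ((val a)^-1 * (val m * val m') * val a')%g.
Proof.
move=> Ff; have Ff1 := Fset_u_conj m Ff.
rewrite (tgE a a' (Mmul h m m')) -u_mul.
have -> : star (s a) * u m * f * u m' * s a' =
    star (s a) * (u m * f * star (u m)) * (u m * u m') * s a'.
  by rewrite !mulrA -(mulrA _ (star (u m)) (u m)) u_isom mulr1.
by rewrite [in LHS]star_s_comm // !mulrA.
Qed.

(** Write g and g' with a common middle entry e. The product is then a word with e_e in the middle,
    and the F-part that [word_normal] extracts from it involves only g: it is the range projection
    of t_g. *)
Lemma tg_mul g g' : tg g * tg g' = tg_range g * tg (g * g')%g.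
Proof.
have [[[a m] b] /= gE] := G_decomp h g; have [[[c n] d] /= gE'] := G_decomp h g'.
have [[be ga] /= E] := ore_left h b c.
pose a' := Pmul h be a; pose e := Pmul h be b; pose d' := Pmul h ga d.
pose m' := Mconj be m; pose n' := Mconj ga n.
have {}gE : g = ((val a')^-1 * val m' * val e)%g.
  by rewrite gE /= !invgM !mulgA !mulgVK.
have {}gE' : g' = ((val e)^-1 * val n' * val d')%g.
  by rewrite gE' /= E !invgM !mulgA !mulgVK.
clearbody a' e d' m' n'.
have -> : (g * g' = (val a')^-1 * (val m' * val n') * val d')%g.
  by rewrite gE gE' -!mulgA mulVKg.
have tE : tg g = star (s a') * u m' * s e by rewrite gE; exact: tgE.
have tE' : tg g' = star (s e) * u n' * s d' by rewrite gE'; exact: tgE.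
transitivity (star (s a') * u m' * erange s e * u n' * s d').
  by rewrite tE tE' /erange !mulrA.
rewrite (word_normal _ _ _ _ (Fset_erange e)); congr (_ * _).
by rewrite /tg_range tE !starM starK /erange !mulrA.
Qed.

Lemma TsetP t : Tset s u t <-> exists f g, F f /\ t = f * tg g.
Proof.
split=> [[a [a' [m [m' [f [Ff ->]]]]]]|[f [g [Ff ->]]]].
  exists (star (s a) * (u m * f * star (u m)) * s a).
  exists ((val a)^-1 * (val m * val m') * val a')%g; split; last exact: word_normal.
  exact/Fset_star_s_conj/Fset_u_conj.
elim/tg_ind: g => a b m; rewrite tgE.
exists a, b, (Mone h), m, (s a * f * star (s a)); split; first exact: Fset_s_conj.
by rewrite u1 mulr1 !mulrA s_isom mul1r.
Qed.

Lemma Tset_tg g : Tset s u (tg g).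
Proof. by apply/TsetP; exists 1, g; rewrite mul1r; split=> //; exact: Fset1. Qed.

Section Grading.
Variable D : G -> A -> Prop.
Hypothesis gD : graded s u D.

Lemma graded_Fset f : F f -> D 1%g f.
Proof.
have D1 : D 1%g 1.
  have := gradedM gD (graded_s gD (Pone h)).2 (graded_s gD (Pone h)).1.
  by rewrite mulVg s_isom.
move=> [[n [c [k [b ->]]]] _ _]; elim/big_ind: _ => [|x y|i _].
- by rewrite -(scale0r (1 : A)); exact: (gradedZ gD).
- exact: (gradedD gD).
apply: (gradedZ gD); have [uk usk] := graded_u gD (k i).
have [sb ssb] := graded_s gD (b i); rewrite /erange.
by have := gradedM gD (gradedM gD uk (gradedM gD sb ssb)) usk;
  rewrite mulgV mulg1 mulgV.
Qed.

Lemma graded_tg g : D g (tg g).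
Proof.
elim/tg_ind: g => a b m; rewrite tgE.
exact: (gradedM gD (gradedM gD (graded_s gD a).2 (graded_u gD m).1) (graded_s
  gD b).1).
Qed.

(* The grading D is the only consequence of the universality of A that is used. *)
Lemma tg_inj f g g' k a : F f -> f * tg g = f * tg g' ->
  f * tg_range g * pr k a = pr k a -> g = g'.
Proof.
move=> Ff E fk; have [//|gg'] := pselect (g = g').
have Dt : D g (f * tg g) by have := gradedM gD (graded_Fset Ff) (graded_tg g);
  rewrite mul1g.
have Dt' : D g' (f * tg g).
  by rewrite E; have := gradedM gD (graded_Fset Ff) (graded_tg g'); rewrite mul1g.
rewrite prE in fk; move: (u k * s a) (us_isom k a) fk => v vv fk.
(* Compression with the isometry v = u(k) s_a turns f t_g, an element of two degrees, into 1. *)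
case: (@graded_uniq _ _ _ _ _ _ _ _ gD g g' (f * tg g) (star v) (star (tg g) * v)
         Dt Dt' gg').
have -> : star v * (f * tg g) * (star (tg g) * v) =
    star v * (f * tg_range g * (v * star v)) * v.
  by rewrite /tg_range -!mulrA vv mulr1.
by rewrite fk mulrA vv mul1r vv.
Qed.

End Grading.

End CuntzLiAlgebraTheory.

(** * The completion of M *)

Section Completion.
Local Open Scope group_scope.
Local Open Scope classical_set_scope.
Variables (G : groupType) (N H M : set G) (h : CuntzLi_setting N H M).
Local Notation P := (Pset H M).
Local Notation cong := (congM M).
Local Notation Mb := (Mbar H M).
Local Notation coord := Defs.coord.

Lemma lcosP a m x : lcos m (conjset a M) x <-> cong a m x.
Proof.
split=> [[k Mk <-]|Mx]; first by rewrite /congM mulKg.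
by exists (m^-1 * x) => //; rewrite mulVKg.
Qed.

Lemma coord_congP (r : Mb) (a : P) m n : coord r a m ->
  coord r a n <-> cong (val a) m n.
Proof. by move=> rm; rewrite (coordE h rm); exact: lcosP. Qed.

Lemma coord_M (r : Mb) (a : P) : exists k : M, coord r a (val k).
Proof.
have [m rm] := coord_ex h r a.
by exists (SigSub (mem_set (coord_sub h rm))).
Qed.

Lemma coord_eq (r r' : Mb) (a : P) m : coord r a m -> coord r' a m ->
  coord r a = coord r' a.
Proof. by move=> rm r'm; rewrite (coordE h rm) (coordE h r'm). Qed.

Lemma Pact_memP (a b c d : P) (r : Mb) m :
  val a * val c = val b * val d -> coord r c m ->
  coord (Pact h a r) (Pmul h b d) (val a * m * (val a)^-1).
Proof. by move=> E rm; apply: (@Pact_mem _ _ _ _ h a _ c (Pone h));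
  rewrite //= mulg1 E. Qed.

(** The coordinate of r at b is recovered from that of a r a^{-1} at ab. *)
Lemma Pact_inj (a : P) : injective (Pact h a).
Proof.
move=> r r' rr'; apply: (Mbar_eq h) => b.
have [k rk] := coord_ex h r b; have [l r'l] := coord_ex h r' b.
exists k; split=> //; apply/(coord_congP k r'l).
apply/(congM_conj M (val b) (val a)); apply: (congM_sym h).
have ak := Pact_memP (erefl (val a * val b)) rk.
have := Pact_memP (erefl (val a * val b)) r'l; rewrite -rr'.
by move/(coord_congP _ ak).
Qed.

(** Conjugation by b maps the completion onto its points with trivial b-coordinate; the c-coordinate
    of the preimage is read off from r at level bc. *)
Lemma Pact_surj (b : P) (r : Mb) : coord r b 1 -> exists y, Pact h b y = r.
Proof.
move=> r1; pose f (c : P) :=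
  [set x | coord r (Pmul h b c) (val b * x * (val b)^-1)].
have rb c n : coord r (Pmul h b c) n -> coord r b n.
  by apply: (coord_compat h) => /=.
have pull c n : coord r (Pmul h b c) n ->
    exists2 k, M k & n = val b * k * (val b)^-1.
  move=> rn; have := (coord_congP n r1).1 (rb _ _ rn).
  by rewrite /congM invg1 mul1g => -[k Mk <-]; exists k.
have fcos c : cosets M (val c) (f c).
  have [n rn] := coord_ex h r (Pmul h b c); have [k Mk nE] := pull _ _ rn.
  exists k => //; apply/seteqP; split=> x; rewrite lcosP.
    by move=> kx; apply/(coord_congP _ rn); rewrite nE; apply/(congM_conj M).
  by move=> /(coord_congP _ rn); rewrite nE => /(congM_conj M).
have fcompat (a c d : P) : val d = val a * val c -> exists2 m, f d m & f a m.
  move=> dE; have [n rn] := coord_ex h r (Pmul h b d);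
    have [k Mk nE] := pull _ _ rn.
  exists k; rewrite /f /= -nE //.
  by apply: (coord_compat h (b := c)) rn; rewrite /= dE mulgA.
exists (mk_Mbar h fcos fcompat); apply: (Mbar_eq h) => c.
have [[p q] /= E] := ore_right h b c.
have [n rn] := coord_ex h r (Pmul h b p); have [k Mk nE] := pull _ _ rn.
exists n; split.
  rewrite nE in rn *; exact: (@Pact_mem _ _ _ _ h b c p q (mk_Mbar h fcos
    fcompat) k E rn).
by apply: (coord_compat h (b := q)) rn; rewrite /= E.
Qed.

Lemma iN_inj : injective (iN h).
Proof.
move=> x y /(Ncl_eq h)[al [be [/= E1 E2]]]; apply: (@Pact_inj al).
by rewrite E2; congr (Pact h _ y); apply: val_inj; rewrite -[RHS]mulg1 E1 mulg1.
Qed.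

(* r.g = y for g = a^{-1} m b, cleared of denominators. *)
Definition moves (a : P) (m : M) (b : P) (r y : Mb) : Prop :=
  Mbar_mul h (iM h (Minv h m)) (Pact h a r) = Pact h b y.

(** As g^{-1} = b^{-1} m^{-1} a, the point r.g is the class of (m^{-1} a r a^{-1}, b), and this is
    the class of (y, 1) iff its first entry is b y b^{-1}. *)
Lemma gact_right_iN (a b : P) (m : M) (r y : Mb) :
  gact_right (iN h r) ((val a)^-1 * val m * val b) = iN h y <-> moves a m b r y.
Proof.
have -> : gact_right (iN h r) ((val a)^-1 * val m * val b) =
    Ncl h (Mbar_mul h (iM h (Minv h m)) (Pact h a r)) b.
  have E : (((val a)^-1 * val m * val b)^-1 = (val b)^-1 * val (Minv h m) * val a).
    by rewrite !invgM invgK mulgA.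
  rewrite /gact_right E gactE (@NphiE _ _ _ _ h a (Pone h) a (Pone h)); last first.
    by rewrite /= mulg1 mul1g.
  rewrite NpsiE Nphi_invE; congr (Ncl h _ _); last first.
    by apply: val_inj; rewrite /= mul1g.
  congr (Mbar_mul h (iM h _) _); apply: val_inj => /=.
  by rewrite mul1g invg1 mulg1.
split=> [/(Ncl_eq h)[al [be [/= E1 E2]]]|E].
  apply: (@Pact_inj al); rewrite E2; apply: PactM => /=.
  by rewrite -[LHS]mulg1 E1.
by apply/(Ncl_eq h); exists (Pone h), b; rewrite Pact1 /= mul1g mulg1 -E.
Qed.

Lemma moves_coord (a b c d : P) (m k l : M) (r y : Mb) :
  moves a m b r y -> val a * val c = val b * val d ->
  coord r c (val k) -> coord y d (val l) ->
  cong (val a * val c) (val a * val k * (val a)^-1) (val m * (val b * val l *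
    (val b)^-1)).
Proof.
move=> mv E rk yl; have ak := Pact_memP E rk.
have bl := Pact_memP (esym E) yl; rewrite -mv in bl.
have PE : Pmul h a c = Pmul h b d by exact: val_inj.
rewrite PE in bl; have [x xM [z zr xz]] := bl.
have {xM} mx : cong (val (Pmul h b d)) (val (Minv h m)) x by apply/lcosP; exact: xM.
have kz : cong (val (Pmul h b d)) (val a * val k * (val a)^-1) z.
  by apply/(coord_congP _ ak).
have bl' : coord (Mbar_mul h (iM h (Minv h m)) (Pact h a r)) (Pmul h b d)
    (val (Minv h m) * (val a * val k * (val a)^-1)).
  by exists (val (Minv h m)); [apply/lcosP;
    exact: (congM_refl h)|exists (val a * val k * (val a)^-1)].
have := (coord_congP _ bl').1 bl; rewrite /= -E => ml.
by apply/(congM_mull M _ (val m)^-1); rewrite mulKg.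
Qed.

(** The point m^{-1} a r a^{-1} has trivial b-coordinate, so [Pact_surj] applies. *)
Lemma moves_ex (a b : P) (m : M) (r : Mb) :
  coord (Pact h a r) b (val m) -> exists y, moves a m b r y.
Proof.
move=> rm; have [|y yE] := @Pact_surj b (Mbar_mul h (iM h (Minv h m)) (Pact h a r)).
  exists (val (Minv h m)); first by apply/lcosP; exact: (congM_refl h).
  by exists (val m) => //=; rewrite mulVg.
by exists y; rewrite /moves yE.
Qed.

(** One coordinate suffices because the coordinates at a and b are both determined by the one at a
    common multiple ap = bq. *)
Lemma Mbar_nbhs (r : Mb) (W : set Mb) : nbhs r W ->
  exists a : P, forall r', coord r' a = coord r a -> W r'.
Proof.
pose B (a : P) := [set r' | coord r' a = coord r a].
have FF : Filter (filter_from [set: P] B).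
  apply: filter_from_filter; first by exists (Pone h).
  move=> a b _ _; have [[p q] /= E] := ore_right h a b;
    exists (Pmul h a p) => // r' r'E.
  have [m rm] := coord_ex h r (Pmul h a p).
  have r'm : coord r' (Pmul h a p) m by rewrite r'E.
  split.
    by apply: (@coord_eq _ _ _ m);
      apply: (coord_compat h (b := p) (c := Pmul h a p)).
  by apply: (@coord_eq _ _ _ m); apply: (coord_compat h (b := q) (c := Pmul h a p)).
suff cvB : filter_from [set: P] B --> r.
  by move=> /cvB[a _ aW]; exists a.
suff cvB : (set_val @ filter_from [set: P] B : set_system (Mprod H M)) --> (val
  r : Mprod H M).
  move=> U /= [_ [[V oV <-] Vr VU]].
  have /cvB[a _ aV] : nbhs (val r : Mprod H M) V by apply: open_nbhs_nbhs.
  by exists a => // r' /aV /VU.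
apply/cvg_sup => a U [_ [[V oV <-]] Vr VU].
exists a => // r' r'E; apply: VU.
have e : val r' a = val r a by exact: val_inj.
by rewrite -[(_ @^-1` _) _]/(V (val r' a)) e.
Qed.

Lemma coord_open (a : P) (K : set G) : open [set r : Mb | coord r a = K].
Proof.
pose T := discrete_topology (cosets M (val a)).
have c1 : continuous (set_val : Mb -> Mprod H M) by exact: initial_continuous.
have c2 : continuous (proj a : Mprod H M -> T) by exact: proj_continuous.
pose V := [set x : T | val (x : cosets M (val a)) = K].
have oV : open V by exact: discrete_open.
have oV2 : open ((proj a : Mprod H M -> T) @^-1` V) by move/continuousP: c2; apply.
have oV1 : open ((set_val : Mb -> Mprod H M) @^-1` ((proj a : Mprod H M ->
  T) @^-1` V)).
  by move/continuousP: c1; apply.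
exact: oV1.
Qed.

Lemma Mbar_openP (W : set Mb) :
  (forall r, W r -> exists a : P, forall r', coord r' a = coord r a -> W r') ->
    open W.
Proof.
move=> WP; rewrite openE => r /WP[a aW];
  apply: (@filterS _ _ _ [set r' | coord r' a = coord r a]).
  exact: aW.
by apply: open_nbhs_nbhs; split=> //; exact: coord_open.
Qed.

(** A point that agrees with b w b^{-1} at level ba has trivial b-coordinate, hence is some b w'
    b^{-1}, and w' agrees with w at level a. *)
Lemma Pact_open (b : P) (W : set Mb) : open W -> open (Pact h b @` W).
Proof.
move=> oW; apply: Mbar_openP => _ [w Ww <-].
have [|a aW] := @Mbar_nbhs w W; first by rewrite openE in oW; exact: oW.
exists (Pmul h b a) => r' r'E.
have [k wk] := coord_ex h w a; have bk := Pact_memP (erefl (val b * val a)) wk.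
have w1 : coord r' b 1.
  have : coord r' b (val b * k * (val b)^-1).
    by apply: (coord_compat h (b := a) (c := Pmul h b a)); rewrite // r'E.
  move=> r'k; apply/(coord_congP _ r'k); apply: (congM_sym h).
  rewrite /congM invg1 mul1g; exists k => //; exact: (coord_sub h wk).
have [w' w'E] := Pact_surj w1; exists w' => //; apply: aW.
have [l w'l] := coord_ex h w' a; have bl := Pact_memP (erefl (val b * val a)) w'l.
rewrite w'E r'E in bl; apply: (@coord_eq _ _ _ l) => //.
apply/(coord_congP _ wk); apply/(congM_conj M (val a) (val b)).
exact/(coord_congP _ bk).
Qed.

Lemma Ncl_continuous (b : P) : continuous (fun r : Mb => Ncl h r b).
Proof.
move=> r; apply: (@continuous_comp _ (Npre H M) _ (fun r => (r, b) : Npre H M)).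
  move=> U [[V W] /= [rV bW] VWU]; apply: filterS rV => x Vx; apply: VWU.
  by split=> //; exact: nbhs_singleton bW.
exact: pi_continuous.
Qed.

Lemma iN_continuous : continuous (iN h). Proof. exact: Ncl_continuous. Qed.

(** The saturation of W x {1} before passing to the quotient is the union over b of the sets b W
    b^{-1} x {b}, which are open by [Pact_open]. *)
Lemma iN_open (W : set Mb) : open W -> open (iN h @` W).
Proof.
move=> oW; rewrite /open /= /quotient_open.
rewrite openE => -[y b] [w Ww E].
have /(Ncl_eq h)[al [be [/= E1 E2]]] : Ncl h w (Pone h) = Ncl h y b by [].
have yE : y = Pact h b w.
  apply: (@Pact_inj be); rewrite -E2; apply: PactM => /=; rewrite -E1 mulg1 //.
exists (Pact h b @` W, [set b]); first split => /=.
- by apply: open_nbhs_nbhs; split; [exact: Pact_open|exists w].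
- exact: discrete_set1.
move=> [_ c] [/= [w' Ww' <-] ->]; exists w' => //.
apply/(Ncl_eq h); exists b, (Pone h); split; first by rewrite /= mulg1 mul1g.
by rewrite Pact1.
Qed.

End Completion.

(** * Tight characters *)

Section Characters.
Local Open Scope classical_set_scope.
Variables (R : realType) (G : groupType) (N H M : set G).
Variable h : CuntzLi_setting N H M.
Variables (A : cstarAlgType R) (s : Pset H M -> A) (u : M -> A).
Hypothesis rel : CuntzLi_relations s u.
Local Notation P := (Pset H M).
Local Notation Mb := (Mbar H M).
Local Notation cong := (congM M).
Local Notation coord := Defs.coord.
Local Notation F := (Fset s u).
Local Notation Fch := (Fchar s u).
Local Notation pr := (pr s u).
Local Notation chr := (Mbar_char s u).

Lemma val_Pmul (a b : P) : val (Pmul h a b) = (val a * val b)%g.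
Proof. by []. Qed.

Definition mkF f (Ff : F f) : F := SigSub (mem_set Ff).

Lemma supp_Fset (x : Fch) f : supp x f -> F f.
Proof. by move=> [g _ <-]; exact: set_valP. Qed.

Lemma suppE (x : Fch) (f : F) : supp x (val f) <-> x f.
Proof. by split=> [[g xg /val_inj <-]|xf] //; exists f. Qed.

Lemma supp_mkF (x : Fch) f (Ff : F f) : supp x f <-> x (mkF Ff).
Proof. exact: (suppE x (mkF Ff)). Qed.

Lemma Fchar_ext (x y : Fch) : (forall f, F f -> supp x f <-> supp y f) -> x = y.
Proof.
move=> xy; apply: funext => f; have [E1 E2] := xy _ (set_valP f).
by apply/idP/idP => /suppE; [move/E1|move/E2] => /suppE.
Qed.

Section Fhat.
Variable x : Fch.
Hypothesis hx : Fhat x.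

Lemma supp_mul f g : F f -> F g -> supp x (f * g) <-> supp x f /\ supp x g.
Proof.
move=> Ff Fg; have [_ xM _] := hx; have Ffg := Fset_mul h rel Ff Fg.
have := xM (mkF Ff) (mkF Fg) (mkF Ffg) erefl.
rewrite (supp_mkF x Ff) (supp_mkF x Fg) (supp_mkF x Ffg) => ->.
by split=> /andP.
Qed.

Lemma supp_mulI f g : supp x f -> supp x g -> supp x (f * g).
Proof. by move=> xf xg; apply/(supp_mul (supp_Fset xf) (supp_Fset xg)). Qed.

Lemma supp1 : supp x 1.
Proof.
have [[f xf] _ _] := hx; have := (suppE x f).2 xf; rewrite -[val f]mulr1.
by move/supp_mul => []//; [exact: set_valP|exact: (Fset1 h rel)].
Qed.

Lemma supp_neq0 : ~ supp x 0.
Proof. by have [_ _ x0] := hx => /(supp_mkF _ (Fset0 h rel)); rewrite x0. Qed.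

Lemma supp_up f g : F g -> supp x f -> g * f = f -> supp x g.
Proof.
move=> Fg xf gf; have Ff := supp_Fset xf.
by rewrite -gf in xf; case: ((supp_mul Fg Ff).1 xf).
Qed.

End Fhat.

Lemma chrP (r : Mb) f : F f -> supp (chr r) f <->
  exists (a : P) (k : M), coord r a (val k) /\ f * pr k a = pr k a.
Proof. by move=> Ff; rewrite (supp_mkF _ Ff); split=> /asboolP. Qed.

Lemma chr_pr (r : Mb) (a : P) (k : M) : coord r a (val k) -> supp (chr r) (pr k a).
Proof.
move=> rk; apply/chrP; first exact: (Fset_pr h rel).
by exists a, k; rewrite (prK rel).
Qed.

Lemma chr_refine (r : Mb) f (a b c : P) (k l : M) :
  coord r a (val k) -> f * pr k a = pr k a ->
  val b = (val a * val c)%g -> coord r b (val l) -> f * pr l b = pr l b.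
Proof.
move=> rk fk bE rl; have kl : cong (val a) (val k) (val l).
  by apply/(coord_congP h _ rk); exact: (coord_compat h bE).
by rewrite -(pr_sub rel bE kl) mulrA fk.
Qed.

(** Membership of f in the character of r is decided by one coordinate of r, at a level where f is
    diagonal: a projection finer than [pr k a] cannot lie under f if f kills [pr k a]. *)
Lemma chr_coord f : F f ->
  exists a : P, forall (r : Mb) (k : M), coord r a (val k) ->
  (supp (chr r) f /\ f * pr k a = pr k a) \/ (~ supp (chr r) f /\ f * pr k a = 0).
Proof.
move=> Ff; have [a aP] := Fset_dichotomy h rel Ff; exists a => r k rk.
have aE : val a = (val a * val (Pone h))%g by rewrite /= mulg1.
have [[fk _]|[fk _]] := aP a (Pone h) k aE.
  by left; split=> //; apply/chrP => //; exists a, k.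
right; split=> // /(chrP _ Ff)[b [l [rl fl]]].
have [[p q] /= E] := ore_right h a b.
have [j rj] := coord_M h r (Pmul h a p).
have fj := chr_refine rl fl (E : val (Pmul h a p) = _) rj.
have kj : cong (val a) (val k) (val j).
  by apply/(coord_congP h _ rk); exact: (coord_compat h (val_Pmul a p) rj).
have := pr_neq0 rel j (Pmul h a p); rewrite -fj.
by rewrite -(pr_sub rel (val_Pmul a p) kj) mulrA fk mul0r eqxx.
Qed.

Lemma chr_Fhat (r : Mb) : Fhat (chr r).
Proof.
split.
- exists (mkF (Fset1 h rel)); apply/suppE/(chrP _ (Fset1 h rel)).
  by have [k rk] := coord_M h r (Pone h); exists (Pone h), k; rewrite mul1r.
- move=> f g k kE; have [Ff Fg] := (set_valP f, set_valP g).
  suff E : chr r k <-> chr r f /\ chr r g.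
    by apply/idP/andP => [/E[]|[? ?]] //; apply/E.
  rewrite -!suppE kE; have Ffg := Fset_mul h rel Ff Fg; split.
    move=> /(chrP _ Ffg)[a [l [rl fgl]]]; split.
      apply/(chrP _ Ff); exists a, l; split=> //.
      by rewrite -fgl !mulrA; case: Ff => _ -> _.
    apply/(chrP _ Fg); exists a, l; split=> //.
    by rewrite -fgl !mulrA (Fset_comm h rel Fg Ff) -(mulrA (val f) (val g) (val
      g)); case: Fg => _ -> _.
  move=> [/(chrP _ Ff)[a [l [rl fl]]] /(chrP _ Fg)[b [m [rm gm]]]].
  have [[p q] /= E] := ore_right h a b; have [j rj] := coord_M h r (Pmul h a p).
  apply/(chrP _ Ffg); exists (Pmul h a p), j; split=> //.
  rewrite -mulrA (chr_refine rm gm (E : val (Pmul h a p) = _) rj).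
  exact: (chr_refine rl fl (val_Pmul a p) rj).
move=> z z0; apply/negP => /suppE; rewrite z0 => /(chrP _ (Fset0 h rel))[a [k [_]]].
by rewrite mul0r => /esym/eqP; rewrite (negPf (pr_neq0 rel k a)).
Qed.

Lemma chr_pr_inv (r : Mb) (a : P) (k : M) : supp (chr r) (pr k a) ->
  coord r a (val k).
Proof.
move=> rk; have [l rl] := coord_M h r a; apply/(coord_congP h _ rl).
have [//|lk] := pselect (cong (val a) (val l) (val k)).
have := supp_mulI (chr_Fhat r) (chr_pr rl) rk.
by rewrite (pr_orth h rel lk) => /(supp_neq0 (chr_Fhat r)).
Qed.

Lemma chr_inj : injective chr.
Proof.
move=> r r' E; apply: (Mbar_eq h) => a; have [k rk] := coord_M h r a.
by exists (val k); split=> //; apply: chr_pr_inv; rewrite -E; exact: chr_pr.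
Qed.

(** The cosets selected at the various levels are compatible, since disjoint projections have
    product 0, and thus form a point r. By [chr_coord] its character contains the same f as x. *)
Lemma chr_of_prime (x : Fch) : Fhat x ->
  (forall a, exists k, supp x (pr k a)) -> exists r, x = chr r.
Proof.
move=> hx /choice[k kP].
pose f (a : P) : set G := lcos (val (k a)) (conjset (val a) M).
have fcos a : cosets M (val a) (f a) by exists (val (k a)) => //; exact: set_valP.
have meet (a b c : P) : val c = (val a * val b)%g ->
  cong (val a) (val (k a)) (val (k c)).
  move=> cE; have [//|ac] := pselect (cong (val a) (val (k a)) (val (k c))).
  have := supp_mulI hx (kP a) (kP c).
  by rewrite (pr_disj h rel cE ac) => /(supp_neq0 hx).
have fcompat (a b c : P) : val c = (val a * val b)%g -> exists2 m, f c m & f a m.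
  move=> /meet ac; exists (val (k c)); first by apply/lcosP; exact: (congM_refl h).
  exact/lcosP.
exists (mk_Mbar h fcos fcompat); apply: Fchar_ext => g Fg.
have rk a : coord (mk_Mbar h fcos fcompat) a (val (k a)).
  by apply/lcosP; exact: (congM_refl h).
split=> [xg|/(chrP _ Fg)[a [l [/lcosP kl gl]]]].
  have [a aP] := chr_coord Fg; have [[]//|[_ g0]] := aP _ _ (rk a).
  by have := supp_mulI hx xg (kP a); rewrite g0 => /(supp_neq0 hx).
by rewrite -(pr_congM rel kl) in gl; exact: (supp_up hx Fg (kP a) gl).
Qed.

Lemma Fmax_prime (x : Fch) a : Fmax x -> exists k, supp x (pr k a).
Proof.
(* Otherwise some k is killed by no g in x, and then x and pr k a generate a
   larger character y. *)
move=> [hx xmax]; have [//|nx] := pselect (exists k, supp x (pr k a)).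
have kill k : exists2 g, supp x g & g * pr k a = 0.
  have [//|nk] := pselect (exists2 g, supp x g & g * pr k a = 0); exfalso.
  pose y : Fch := fun f =>
    `[< exists2 g, supp x g & val f * (g * pr k a) = g * pr k a >].
  have yP f : F f -> supp y f <-> exists2 g, supp x g & f * (g * pr k a) = g *
    pr k a.
    by move=> Ff; rewrite (supp_mkF _ Ff); split=> /asboolP.
  have hy : Fhat y.
    split.
    - exists (mkF (Fset1 h rel)); apply/suppE/(yP _ (Fset1 h rel)).
      by exists 1; [exact: supp1|rewrite !mul1r].
    - move=> f g l lE; have [Ff Fg] := (set_valP f, set_valP g).
      suff E : y l <-> y f /\ y g.
        by apply/idP/andP => [/E[]|[? ?]] //; apply/E.
      rewrite -!suppE lE; have Ffg := Fset_mul h rel Ff Fg; split.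
        move=> /(yP _ Ffg)[j xj E]; split.
          apply/(yP _ Ff); exists j => //.
          by rewrite -E !mulrA; case: Ff => _ -> _.
        apply/(yP _ Fg); exists j => //.
        by rewrite -E !mulrA (Fset_comm h rel Fg Ff) -(mulrA (val f) (val g)
          (val g)); case: Fg => _ -> _.
      move=> [/(yP _ Ff)[i xi Ei] /(yP _ Fg)[j xj Ej]].
      have [Fi Fj] := (supp_Fset xi, supp_Fset xj).
      apply/(yP _ Ffg); exists (i * j); first exact: supp_mulI.
      have ij : i * j * pr k a = j * (i * pr k a).
        by rewrite (Fset_comm h rel Fi Fj) mulrA.
      rewrite {1}ij -(mulrA (val f)) (mulrA (val g)) mulrA.
      rewrite (Fset_comm h rel Ff (Fset_mul h rel Fg Fj)) -mulrA Ei -mulrA -ij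
        -mulrA.
      by rewrite mulrA (Fset_comm h rel Fg Fi) -mulrA Ej.
    move=> z z0; apply/negP => /suppE; rewrite z0 => /(yP _ (Fset0 h rel))[g xg].
    by rewrite mul0r => /esym g0; apply: nk; exists g.
  have xy : supp x `<=` supp y.
    move=> f xf; apply/(yP _ (supp_Fset xf)); exists f => //.
    by rewrite mulrA; have [_ -> _] := supp_Fset xf.
  apply: nx; exists k; rewrite (xmax y hy xy); apply/(yP _ (Fset_pr h rel k a)).
  by exists 1; [exact: supp1|rewrite mul1r (prK rel)].
(* Every [pr k a] is now killed by an element of x; the product of these elements over a transversal
   kills the sum 1 as well. *)
have [ks tks] := transversal_ex h a.
have [g xg g0] : exists2 g, supp x g & forall k, k \in ks -> g * pr k a = 0.
  elim: (ks) => [|k l [g xg g0]]; first by exists 1 => //; exact: supp1.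
  have [g' xg' g'0] := kill k; exists (g * g'); first exact: supp_mulI.
  move=> j; rewrite inE => /orP[/eqP->|jl]; first by rewrite -mulrA g'0 mulr0.
  rewrite (Fset_comm h rel (supp_Fset xg) (supp_Fset xg')) -mulrA g0 // mulr0 //.
case: (supp_neq0 hx); rewrite (_ : 0 = g) // -[g]mulr1 -(sum_pr rel tks) mulr_sumr.
by rewrite big_seq big1 // => k /g0.
Qed.

Lemma chr_Fmax (r : Mb) : Fmax (chr r).
Proof.
split=> [|y hy ry]; first exact: chr_Fhat.
apply/seteqP; split=> // f yf; have Ff := supp_Fset yf.
have [a aP] := chr_coord Ff; have [k rk] := coord_M h r a.
have [[]//|[_ f0]] := aP r k rk.
by have := supp_mulI hy yf (ry _ (chr_pr rk)); rewrite f0 => /(supp_neq0 hy).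
Qed.

Lemma Fchar_open (f : F) (b : bool) : open [set x : Fch | x f = b].
Proof.
have c : continuous (proj f : Fch -> bool) by exact: proj_continuous.
have ob : open [set b] by exact: discrete_open.
by move/continuousP: c => /(_ _ ob).
Qed.

(** To select a projection of level a is a closed condition on x, as it is decided by a finite
    transversal. It holds for maximal characters, hence on their closure. *)
Lemma Ftight_chr (x : Fch) : Ftight x -> exists r, x = chr r.
Proof.
move=> [hx cx]; apply: chr_of_prime => // a.
have [//|nx] := pselect (exists k, supp x (pr k a)); exfalso.
have [ks tks] := transversal_ex h a.
pose V (l : seq M) : set Fch := [set y | forall k, k \in l ->
  y (mkF (Fset_pr h rel k a)) = false].
have oV l : open (V l).
  elim: l => [|k l IH].
    by rewrite (_ : V [::] = setT); [exact: openT|apply/seteqP; split].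
  have -> : V (k :: l) = [set y | y (mkF (Fset_pr h rel k a)) = false] `&` V l.
    apply/seteqP; split=> y /=.
      by move=> yV; split; [apply: yV; rewrite mem_head|move=> j jl; apply: yV;
        rewrite inE jl orbT].
    by move=> [yk yl] j; rewrite inE => /orP[/eqP->|/yl].
  by apply: openI => //; exact: Fchar_open.
have xV : V ks x.
  by move=> k _; apply/negP => /supp_mkF xk; apply: nx; exists k.
have [y [ymax yV]] := cx _ (open_nbhs_nbhs (conj (oV ks) xV)).
have [k yk] := Fmax_prime a ymax; have [_ ex _] := tks; have [l lks kl] := ex k.
have : supp y (pr l a) by rewrite (pr_congM rel kl).
by move/(supp_mkF _ (Fset_pr h rel l a)); rewrite (yV l lks).
Qed.

Lemma chr_Ftight (r : Mb) : Ftight (chr r).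
Proof. by split; [exact: chr_Fhat|apply: subset_closure; exact: chr_Fmax]. Qed.

Lemma chr_continuous : continuous (chr : Mb -> Fch).
Proof.
move=> r; have FF : Filter (chr @ r) by exact/fmap_filter/nbhs_filter.
apply/cvg_sup => f U [_ [[V oV <-] Vr VU]].
have [a aP] := chr_coord (set_valP f); have [k rk] := coord_M h r a.
have nb : nbhs r [set r' | coord r' a = coord r a].
  by apply: open_nbhs_nbhs; split=> //; exact: coord_open.
apply: filterS nb => r' r'E; apply: VU.
have r'k : coord r' a (val k) by rewrite r'E.
have e : chr r' f = chr r f.
  have tr (r1 r2 : Mb) : coord r1 a (val k) -> coord r2 a (val k) ->
      supp (chr r1) (val f) -> supp (chr r2) (val f).
    move=> rk1 rk2 f1; have [[//]|[_ f0]] := aP r2 k rk2.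
    have [[_ E]|[]//] := aP r1 k rk1.
    by have := pr_neq0 rel k a; rewrite -E f0 eqxx.
  by apply/idP/idP => /suppE cf; apply/suppE; apply: tr cf.
by rewrite -[(_ @^-1` _) _]/(V (chr r' f)) e.
Qed.

(** * Action of the partial isometries t_g on characters and germs *)

Section Transport.
Variables (a b : P) (m : M).
Local Notation g := ((val a)^-1 * val m * val b)%g.
Local Notation t := (tg h s u g).

(** By [moves_coord], conjugating [pr l d] by u(m) s_b and [pr k c] by s_a yields the same
    projection of level ac = bd. *)
Lemma pr_moves (c d : P) (k l : M) (r y : Mb) : moves h a m b r y ->
  (val a * val c = val b * val d)%g -> coord r c (val k) -> coord y d (val l) ->
  t * pr l d * star t = pr k c /\ star t * pr k c * t = pr l d.
Proof.
move=> mv E rk yl; have cg := moves_coord mv E rk yl;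
  rewrite (tgE h rel) -(mulrA (star (s a)) (u m)).
have VE : (u m * s b) * pr l d * star (u m * s b) = s a * pr k c * star (s a).
  rewrite (s_pr rel k (val_Pmul a c)).
  transitivity (u m * (s b * pr l d * star (s b)) * star (u m)).
    by rewrite starM !mulrA.
  rewrite (s_pr rel l (E : val (Pmul h a c) = _)) (u_pr h rel).
  exact/esym/(pr_congM rel).
move: (u m * s b) (us_isom rel m b) VE => V VV VE; rewrite starM starK.
have sK x : star (s a) * (s a * x) = x by rewrite mulrA (s_isom rel) mul1r.
have VK x : star V * (V * x) = x by rewrite mulrA VV mul1r.
move: (pr l d) (pr k c) VE => pl pk VE; split.
  transitivity (star (s a) * (V * pl * star V) * s a); first by rewrite !mulrA.
  by rewrite VE -!mulrA sK (s_isom rel) mulr1.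
transitivity (star V * (s a * pk * star (s a)) * V); first by rewrite !mulrA.
by rewrite -VE -!mulrA VK VV mulr1.
Qed.

(** The range projection of t_g is the compression of [pr m b] by s_a. If it lies above [pr k c],
    the conjugate of [pr k c] by s_a is not orthogonal to [pr m b], which says that a r a^{-1} and m
    agree at b. *)
Lemma moves_range (r : Mb) : supp (chr r) (tg_range h s u g) ->
  exists y, moves h a m b r y.
Proof.
have FE := Fset_tg_range h rel g.
move=> /(chrP _ FE)[c0 [k0 [rk0 Ek0]]].
have [[e d] /= E] := ore_right h (Pmul h a c0) b.
pose c := Pmul h c0 e;
  have ac : (val a * val c = val b * val d)%g by rewrite /= mulgA.
have [k rk] := coord_M h r c.
have Ek := chr_refine rk0 Ek0 (val_Pmul c0 e) rk.
have ak : coord (Pact h a r) (Pmul h b d) (val a * val k * (val a)^-1)%g.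
  exact: Pact_memP ac rk.
have ab := coord_compat h (val_Pmul b d) ak.
apply: moves_ex; apply/(coord_congP h _ ab); apply: (congM_sym h).
have [//|nb] := pselect (cong (val b) (val m) (val (Mconj a k))).
have q0 : pr m b * pr (Mconj a k) (Pmul h b d) = 0 by exact: (pr_disj h rel
  (val_Pmul b d)).
have qE : s a * pr k c * star (s a) = pr (Mconj a k) (Pmul h b d).
  exact: (s_pr rel k (esym ac : val (Pmul h b d) = _)).
have := pr_neq0 rel (Mconj a k) (Pmul h b d); rewrite -qE -Ek /tg_range (tgE h rel).
have -> : star (s a) * u m * s b * star (star (s a) * u m * s b) =
    star (s a) * pr m b * s a by rewrite prE !starM starK !mulrA.
suff -> : s a * (star (s a) * pr m b * s a * pr k c) * star (s a) = 0 by
  rewrite eqxx.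
transitivity ((s a * star (s a)) * (pr m b * (s a * pr k c * star (s a)))).
  by move: (pr m b) (pr k c) => x y; rewrite !mulrA.
by rewrite qE q0 mulr0.
Qed.

End Transport.

Local Notation t := (tg h s u).
Local Notation rg := (tg_range h s u).

(** The levels can be taken finer than any prescribed c0 and d0, so that projections already known
    to lie under a given f can be transported. *)
Lemma pr_transport (g : G) (r y : Mb) (c0 d0 : P) : gact_right (iN h r) g = iN
  h y ->
  exists (c d e f : P) (k l : M),
  [/\ val c = (val c0 * val e)%g /\ val d = (val d0 * val f)%g,
      coord r c (val k), coord y d (val l),
      t g * pr l d * star (t g) = pr k c &
      star (t g) * pr k c * t g = pr l d].
Proof.
elim/(tg_ind h): g => a b m /(gact_right_iN h) mv.
have [[e f] /= EE] := ore_right h (Pmul h a c0) (Pmul h b d0).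
have ac : (val a * val (Pmul h c0 e) = val b * val (Pmul h d0 f))%g.
  by rewrite /= !mulgA.
have [k rk] := coord_M h r (Pmul h c0 e); have [l yl] := coord_M h y (Pmul h d0 f).
exists (Pmul h c0 e), (Pmul h d0 f), e, f, k, l.
by have [E1 E2] := pr_moves mv ac rk yl; split.
Qed.

Lemma tg_dom (g : G) (r : Mb) :
  supp (chr r) (rg g) <-> exists y, gact_right (iN h r) g = iN h y.
Proof.
split.
  elim/(tg_ind h): g => a b m /moves_range[y mv]; exists y.
  exact/(gact_right_iN h).
move=> [y ry]; have [c [d [e [f [k [l [_ rk yl E1 E2]]]]]]] :=
  pr_transport (Pone h) (Pone h) ry.
apply/(chrP _ (Fset_tg_range h rel g)); exists c, k; split=> //.
by rewrite -E1 !mulrA (tg_rangeK h rel).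
Qed.

Lemma char_actE (x : Fch) (g : G) f : F f ->
  supp (char_act x (t g)) f <-> supp x (t g * f * star (t g)).
Proof. by move=> Ff; rewrite (supp_mkF _ Ff); split=> /asboolP. Qed.

Lemma char_act_chr (g : G) (r y : Mb) : gact_right (iN h r) g = iN h y ->
  char_act (chr r) (t g) = chr y.
Proof.
move=> ry; apply: Fchar_ext => f Ff; rewrite char_actE //.
have Ftf := Fset_tg_conj h rel g Ff.
have tt : star (t g) * t g = rg g^-1%g by rewrite /tg_range -(star_tg h rel) starK.
have Ftt := Fset_tg_range h rel g^-1%g; rewrite -tt in Ftt.
(* The initial projection of t_g dominates [pr l d], so under [pr l d] conjugation by t_g can be
   undone. *)
have dom k c l d : t g * pr l d * star (t g) = pr k c ->
    star (t g) * pr k c * t g = pr l d -> star (t g) * t g * pr l d = pr l d.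
  move=> E1 E2; have : star (t g) * t g * pr l d * (star (t g) * t g) = pr l d.
    by rewrite -[RHS]E2 -E1; move: (pr l d) => p; rewrite !mulrA.
  have [_ tt2 _] := Ftt; move: (pr l d) (star (t g) * t g) tt2 => p q qq E.
  by rewrite -{1}E !mulrA qq.
split=> [/(chrP _ Ftf)[c0 [k0 [rk0 fk0]]]|/(chrP _ Ff)[d0 [l0 [yl0 fl0]]]].
  have [c [d [e [e' [k [l [[cE dE] rk yl E1 E2]]]]]]] :=
    pr_transport c0 (Pone h) ry.
  have fk := chr_refine rk0 fk0 cE rk; have dl := dom _ _ _ _ E1 E2.
  apply/(chrP _ Ff); exists d, l; split=> //; rewrite -[RHS]E2 -fk.
  transitivity (star (t g) * t g * f * (star (t g) * pr k c * t g)).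
    by rewrite E2 (Fset_comm h rel Ftt Ff) -mulrA dl.
  by move: (pr k c) => p; rewrite !mulrA.
have [c [d [e [e' [k [l [[cE dE] rk yl E1 E2]]]]]]] := pr_transport (Pone h) d0 ry.
have fl := chr_refine yl0 fl0 dE yl; have dl := dom _ _ _ _ E1 E2.
apply/(chrP _ Ftf); exists c, k; split=> //; rewrite -[in LHS]E1.
transitivity (t g * (f * (star (t g) * t g * pr l d)) * star (t g)).
  by move: (pr l d) => p; rewrite !mulrA.
by rewrite dl fl.
Qed.

Lemma tg_char_act_tight (g : G) (r y : Mb) : gact_right (iN h r) g = iN h y ->
  Sigma s u (chr r, t g) /\ Ftight (char_act (chr r) (t g)).
Proof.
move=> ry; rewrite (char_act_chr ry); split; last exact: chr_Ftight.
split; first exact: (Tset_tg h rel).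
by split; [exact: chr_Fhat|apply/tg_dom; exists y].
Qed.

Lemma germ_ext (x : Fch) (t1 t2 : A) f : Fhat x -> supp x f -> f * t1 = f * t2 ->
  germ s u x t1 = germ s u x t2.
Proof.
move=> hx xf E.
suff imp (t3 t4 : A) : f * t3 = f * t4 -> germ s u x t3 `<=` germ s u x t4.
  by apply/seteqP; split; apply: imp.
move=> E' [x' w] [Sw [/= xx' [g [xg gE]]]]; split=> //; split=> //=.
exists (f * g); split; first exact: supp_mulI.
have fg := Fset_comm h rel (supp_Fset xf) (supp_Fset xg).
by rewrite {1}fg -mulrA -E' mulrA -fg -mulrA gE mulrA.
Qed.

(** A class contains its own representative, with witness 1, so equality of classes as sets gives
    back the relation. *)
Lemma germ_inv (x x' : Fch) (t1 t2 : A) : Sigma s u (x, t1) ->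
  germ s u x t1 = germ s u x' t2 -> x' = x /\ exists2 f, supp x f & f * t2 = f * t1.
Proof.
move=> S1 E; have : germ s u x' t2 (x, t1).
  rewrite -E; split=> //; split=> //; exists 1; split=> //.
  by apply: supp1; have [_ []] := S1.
by move=> [_ [/= xx' [f [xf fE]]]]; split=> //; exists f => //; rewrite -xx'.
Qed.

Lemma Sigma_tg (r : Mb) (w : A) : Sigma s u (chr r, w) -> exists f g,
  [/\ w = f * t g, supp (chr r) f & supp (chr r) (rg g)].
Proof.
move=> [/= /(TsetP h rel)[f [g [Ff ->]]] [_ rw]]; exists f, g.
have FE := Fset_tg_range h rel g; have [_ ff sf] := Ff.
have : supp (chr r) (f * rg g).
  suff -> : f * rg g = f * t g * star (f * t g) by [].
  rewrite starM sf -[RHS]mulrA (mulrA (t g)) -/(rg g).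
  by rewrite (Fset_comm h rel FE Ff) mulrA ff.
by move/(supp_mul (chr_Fhat r) Ff FE) => [].
Qed.

Lemma germ_tg (r : Mb) f g : supp (chr r) f ->
  germ s u (chr r) (f * t g) = germ s u (chr r) (t g).
Proof.
move=> rf; apply: (germ_ext (chr_Fhat r) rf).
by have [_ ff _] := supp_Fset rf; rewrite mulrA ff.
Qed.

Lemma char_act_scale (r : Mb) f g : supp (chr r) f ->
  char_act (chr r) (f * t g) = char_act (chr r) (t g).
Proof.
move=> rf; have Ff := supp_Fset rf; apply: funext => k.
have Fk := Fset_tg_conj h rel g (set_valP k).
have -> : char_act (chr r) (f * t g) k =
    `[< supp (chr r) (f * (t g * val k * star (t g)) * f) >].
  by congr `[< supp _ _ >]; have [_ _ sf] := Ff; rewrite starM sf !mulrA.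
apply/asbool_equiv_eq; have Ffk := Fset_mul h rel Ff Fk.
by rewrite (supp_mul (chr_Fhat r) Ffk Ff) (supp_mul (chr_Fhat r) Ff Fk); tauto.
Qed.

End Characters.

(** * The isomorphism *)

Section GermTopology.
Local Open Scope classical_set_scope.
Variables (R : realType) (G : groupType) (H M : set G).
Variables (A : cstarAlgType R) (s : Pset H M -> A) (u : M -> A).

Lemma germ_basis_open (B : set (germs s u)) : @germ_basis R G H M A s u B -> open B.
Proof.
move=> bB; exists [set B]; last first.
  by rewrite predeqE => ?; split=> [[_ ->]|] //; exists B.
move=> _ ->; exists [fset B]%fset.
  by move=> i; rewrite inE => /eqP ->; rewrite in_setE.
by rewrite predeqE=> ?; split=> [|??]; [apply|]; rewrite /= inE // =>/eqP->.
Qed.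

Lemma germ_cvg (FF : set_system (germs s u)) (g : germs s u) : Filter FF ->
  (forall B, @germ_basis R G H M A s u B -> B g -> FF B) -> FF --> g.
Proof.
move=> fF FB W; rewrite /= nbhsE.
move=> [_ [[B sB <-] [C BC Cg] sUW]].
rewrite nbhs_filterE; apply: filterS sUW _; apply: (@filterS _ _ _ C).
  by move=> ? ?; exists C.
have /sB [D sD IDeC] := BC; rewrite -IDeC; apply: filter_bigI => E DE.
have /sD := DE; rewrite in_setE => bE; apply: FB => //.
by move: Cg; rewrite -IDeC => /(_ _ DE).
Qed.

End GermTopology.

Section Isomorphism.
Local Open Scope classical_set_scope.
Variables (R : realType) (G : groupType) (N H M : set G).
Variable h : CuntzLi_setting N H M.
Variables (A : cstarAlgType R) (s : Pset H M -> A) (u : M -> A).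
Hypothesis rel : CuntzLi_relations s u.
Variable D : G -> A -> Prop.
Hypothesis gD : graded s u D.
Local Notation P := (Pset H M).
Local Notation Mb := (Mbar H M).
Local Notation coord := Defs.coord.
Local Notation chr := (Mbar_char s u).
Local Notation t := (tg h s u).
Local Notation rg := (tg_range h s u).
Local Notation XG := (NG_restriction h).
Local Notation YG := (Gtight s u).

Lemma NG_elt (p : XG) : exists r g y,
  [/\ val p = (iN h r, g) & gact_right (iN h r) g = iN h y].
Proof.
have [[r _ rE] [y _ yE]] := set_valP p; exists r, (val p).2, y.
by split; [rewrite rE; case: (val p)|rewrite rE].
Qed.

Lemma mk_germ (r y : Mb) (g : G) : gact_right (iN h r) g = iN h y ->
  exists gamma : YG, germ_val (val gamma) = germ s u (chr r) (t g).
Proof.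
move=> ry; have [S1 T1] := tg_char_act_tight rel ry.
have im : [set germ s u p.1 p.2 | p in Sigma s u] (germ s u (chr r) (t g)).
  by exists (chr r, t g).
pose gm : germs s u := SigSub (mem_set im).
have gt : @Gtight_set R G H M A s u gm by exists (chr r), (t g); split=> //;
  exact: (chr_Ftight h rel r).
by exists (SigSub (mem_set gt)).
Qed.

Lemma phi_ex : exists phi : XG -> YG, forall p r g, val p = (iN h r, g) ->
  germ_val (val (phi p)) = germ s u (chr r) (t g).
Proof.
suff /choice[phi phiP] : forall p : XG, exists gamma : YG, forall r g,
    val p = (iN h r, g) -> germ_val (val gamma) = germ s u (chr r) (t g).
  by exists phi.
move=> p; have [r [g [y [pE ry]]]] := NG_elt p; have [gamma gE] := mk_germ ry.
by exists gamma => r' g'; rewrite pE => -[/iN_inj <- <-].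
Qed.

Lemma Gtight_eq (g1 g2 : YG) : germ_val (val g1) = germ_val (val g2) -> g1 = g2.
Proof. by move=> E; apply: val_inj; exact: val_inj. Qed.

(** The witness f of the equality, multiplied by the range projection of t_g, stays in the character
    of r and therefore lies above some [pr k a]; this is what [tg_inj] asks for. *)
Lemma germ_chr_inj (r r' y : Mb) (g g' : G) : gact_right (iN h r) g = iN h y ->
  germ s u (chr r) (t g) = germ s u (chr r') (t g') -> r = r' /\ g = g'.
Proof.
move=> ry E; have [S1 _] := tg_char_act_tight rel ry.
have [/(chr_inj h rel) rr' [f rf fE]] := germ_inv h rel S1 E; split=> //.
have Ff := supp_Fset rf.
have : supp (chr r) (f * rg g).
  by apply: (supp_mulI h rel (chr_Fhat h rel r)) => //; apply/tg_dom => //;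
    exists y.
move/(chrP _ (Fset_mul h rel Ff (Fset_tg_range h rel g))) => [a [k [_ fk]]].
exact: (tg_inj rel gD Ff (esym fE) fk).
Qed.

Lemma supp_shift (r y : Mb) (g : G) f : gact_right (iN h r) g = iN h y ->
  supp (chr r) f -> supp (chr y) (star (t g) * f * t g).
Proof.
move=> ry rf; have Ff := supp_Fset rf.
have Fs : Fset s u (star (t g) * f * t g).
  have := Fset_tg_conj h rel g^-1%g Ff.
  by rewrite -(star_tg h rel) starK.
rewrite -(char_act_chr rel ry) (char_actE h _ _ Fs).
have rE : supp (chr r) (rg g) by apply/tg_dom => //; exists y.
have := supp_mulI h rel (chr_Fhat h rel r) (supp_mulI h rel (chr_Fhat h rel r)
  rE rf) rE.
by rewrite /tg_range !mulrA.
Qed.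

(** The product equals f, times the conjugate of f' by t_g, times the range projection of t_g, times
    the partial isometry of gg'. The first three factors lie in the character of r and drop out of
    the germ. *)
Lemma germ_mul (r y : Mb) (g g' : G) f f' : gact_right (iN h r) g = iN h y ->
  supp (chr r) f -> supp (chr y) f' ->
  germ s u (chr r) (f * t g * (f' * t g')) = germ s u (chr r) (t (g * g')%g).
Proof.
move=> ry rf yf'; have Ff' := supp_Fset yf'; have hr := chr_Fhat h rel r.
have rE : supp (chr r) (rg g) by apply/tg_dom => //; exists y.
have rf' : supp (chr r) (t g * f' * star (t g)).
  by rewrite -(char_actE h _ _ Ff') (char_act_chr rel ry).
rewrite -(germ_tg h rel _ (supp_mulI h rel hr (supp_mulI h rel hr rf rf') rE)).
congr (germ s u _ _); rewrite -(mulrA _ (rg g)) -(tg_mul h rel).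
rewrite -(mulrA f (t g)) (mulrA (t g) f') [in LHS](Fset_tg_comm h rel g Ff').
by rewrite !mulrA.
Qed.

Section Phi.
Variable phi : XG -> YG.
Hypothesis phiE : forall p r g, val p = (iN h r, g) ->
  germ_val (val (phi p)) = germ s u (chr r) (t g).

Lemma phi_inj : injective phi.
Proof.
move=> p p' pp'; have [r [g [y [pE ry]]]] := NG_elt p.
have [r' [g' [y' [pE' ry']]]] := NG_elt p'.
have E : germ s u (chr r) (t g) = germ s u (chr r') (t g').
  by rewrite -(phiE pE) -(phiE pE') pp'.
by apply: val_inj; rewrite pE pE'; have [-> ->] := germ_chr_inj ry E.
Qed.

Lemma Gtight_elt (gamma : YG) : exists p : XG, phi p = gamma.
Proof.
have [x [w [S1 gE tx _]]] := set_valP gamma.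
have [r xE] := Ftight_chr h rel tx; rewrite {x tx}xE in S1 gE *.
have [f [g [wE rf /(tg_dom h rel)[y ry]]]] := Sigma_tg h rel S1.
have pX : @NG_restriction_set G N H M h (iN h r, g).
  by split=> /=; [exists r|exists y].
exists (SigSub (mem_set pX)); apply: Gtight_eq.
by rewrite (phiE (erefl : val (SigSub (mem_set pX) : XG) = _)) gE wE germ_tg.
Qed.

(** Product and inverse of germs are stated through some choice of representatives. By
    [germ_chr_inj], each representative of [phi p] has the form f t_g with the very g of p. *)
Lemma phi_rep (p : XG) r g x w : val p = (iN h r, g) -> Sigma s u (x, w) ->
  germ_val (val (phi p)) = germ s u x w ->
  [/\ x = chr r, char_act x w = char_act (chr r) (t g) &
      exists2 f, supp (chr r) f & w = f * t g].
Proof.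
move=> pE S1 E; have [r' [g' [y [pE' ry]]]] := NG_elt p.
move: pE' ry; rewrite pE => -[/iN_inj <- <-] {r' g'} ry.
have [S2 _] := tg_char_act_tight rel ry.
have [xE _] := germ_inv h rel S2 (etrans (esym (phiE pE)) E).
rewrite {x}xE in S1 E *;
  have [f [g' [wE rf /(tg_dom h rel)[y' ry']]]] := Sigma_tg h rel S1.
have E' : germ s u (chr r) (t g) = germ s u (chr r) (t g').
  by rewrite -(phiE pE) E wE (germ_tg h rel _ rf).
have [_ gg] := germ_chr_inj ry E'.
by rewrite gg wE (char_act_scale h rel _ rf); split=> //; exists f.
Qed.

Lemma phi_inv p q : @ginv XG p q <-> @ginv YG (phi p) (phi q).
Proof.
have [r [g [y [pE ry]]]] := NG_elt p; have [r' [g' [y' [qE ry']]]] := NG_elt q.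
have [S1 _] := tg_char_act_tight rel ry.
split=> [/=|/= [x [w [Sxw E1 E2]]]].
  rewrite pE /= ry => qE2; exists (chr r), (t g); split=> //; first exact: phiE.
  by rewrite (char_act_chr rel ry) (star_tg h rel); exact: phiE.
have [xE aE [f rf wE]] := phi_rep pE Sxw E1.
have [Ff Fx] := (supp_Fset rf, chr_Fhat h rel y).
have Fsh := supp_shift ry rf.
(* The adjoint of f t_g is a conjugate of f times the partial isometry of g^{-1}; that conjugate
   lies in the character of y and drops out. *)
have E3 : germ s u (chr r') (t g') = germ s u (chr y) (t g^-1%g).
  rewrite -(phiE qE) E2 aE (char_act_chr rel ry) wE starM (star_tg h rel).
  have [_ _ ->] := Ff; rewrite (Fset_tg_comm h rel _ Ff).
  have -> : star (t g^-1%g) = t g by rewrite -(star_tg h rel) starK.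
  by rewrite (star_tg h rel) in Fsh; exact: (germ_tg h rel _ Fsh).
by have [yE gE] := germ_chr_inj ry' E3; rewrite qE pE /= ry yE gE.
Qed.

Lemma phi_mul p q z : @gmul XG p q z <-> @gmul YG (phi p) (phi q) (phi z).
Proof.
have [r [g [y [pE ry]]]] := NG_elt p; have [r' [g' [y' [qE ry']]]] := NG_elt q.
have [r2 [g2 [y2 [zE rz]]]] := NG_elt z.
have [S1 _] := tg_char_act_tight rel ry; have [S2 _] := tg_char_act_tight rel ry'.
split=> [/=[]|/= [x [w1 [x' [w2 [[Sp Sq] E1 E2 yE E3]]]]]].
  rewrite pE qE zE /= ry => /iN_inj r'y [/iN_inj r2r g2g].
  exists (chr r), (t g), (chr r'), (t g'); split;
    [by []|exact: phiE pE|exact: phiE qE| |].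
    by rewrite (char_act_chr rel ry) r'y.
  rewrite (phiE zE) r2r g2g -[t g]mul1r -[t g']mul1r.
  by apply/esym/(germ_mul _ ry); apply: (supp1 h rel); exact: (chr_Fhat h rel).
have [xE aE [f rf w1E]] := phi_rep pE Sp E1.
have [xE' _ [f' rf' w2E]] := phi_rep qE Sq E2.
have r'y : r' = y.
  by apply: (chr_inj h rel); rewrite -xE' yE aE (char_act_chr rel ry).
have yf' : supp (chr y) f' by rewrite -r'y.
have E4 : germ s u (chr r2) (t g2) = germ s u (chr r) (t (g * g')%g).
  by rewrite -(phiE zE) E3 xE w1E w2E; exact: (germ_mul _ ry rf yf').
by have [rE gE] := germ_chr_inj rz E4; rewrite pE qE zE /= ry r'y rE gE.
Qed.

Lemma phi_continuous : continuous phi.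
Proof.
move=> p; have [r [g [y [pE ry]]]] := NG_elt p.
have FF : Filter ((fun p => val (phi p)) @ p) by exact/fmap_filter/nbhs_filter.
suff cv : (fun p => val (phi p)) @ p --> val (phi p).
  move=> U /= [_ [[V oV <-] Vp VU]].
  have /cv nV : nbhs (val (phi p)) V by apply: open_nbhs_nbhs.
  exact: (@filterS _ (nbhs p) _ _ _ (fun p' => VU (phi p')) nV).
apply: germ_cvg => B [w [U [V [Tw oV UE UD ->]]]] [x Ux gE].
have Sxw : Sigma s u (x, w) by split=> //; exact: UD.
have [xE _ [f rf wE]] := phi_rep pE Sxw gE.
have Ff := supp_Fset rf; have [Vx _] : (V `&` @Fhat _ _ _ _ _ s u) x by rewrite -UE.
(* Near p the group coordinate is constant, and wherever f lies in the character the germs of w = f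
   t_g and of t_g coincide. *)
pose W := chr @^-1` (V `&` [set x : Fchar s u | x (mkF Ff) = true]).
have oW : open W.
  move/continuousP: (@chr_continuous _ _ _ _ _ h _ _ _ rel); apply.
  by apply: openI => //; exact: Fchar_open.
have Wr : W r by split; [rewrite -xE|apply/supp_mkF].
have nW : nbhs (val p) [set q : NG h | (iN h @` W) q.1 /\ q.2 = g].
  exists (iN h @` W, [set g]); last by move=> [X k] [].
  split; last by rewrite pE; exact: discrete_set1.
  by apply: open_nbhs_nbhs; split; [exact: iN_open|exists r; rewrite ?pE].
have cval : continuous (val : XG -> NG h) by exact: initial_continuous.
apply: (@filterS _ (nbhs p) _ _ _ _ (cval _ _ nW)) => p' [[r' [Vr' fr'] rE] gE'].
have rf' : supp (chr r') f by apply/supp_mkF.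
exists (chr r'); first by rewrite UE; split=> //; exact: (chr_Fhat h rel).
have pE' : val p' = (iN h r', g) by rewrite [LHS]surjective_pairing -rE gE'.
by rewrite (phiE pE') wE (germ_tg h rel _ rf').
Qed.

Lemma phi_inv_continuous (psi : YG -> XG) : cancel psi phi -> continuous psi.
Proof.
move=> psiK gamma; have [r [g [y [pE ry]]]] := NG_elt (psi gamma).
suff cv : (fun c => val (psi c)) @ gamma --> val (psi gamma).
  move=> U /= [_ [[V oV <-] Vp VU]].
  have /cv nV : nbhs (val (psi gamma)) V by apply: open_nbhs_nbhs.
  exact: (@filterS _ (nbhs gamma) _ _ _ (fun c => VU (psi c)) nV).
move=> O; rewrite pE => -[[W Q] /= [nW Qg] WQ].
have /(Mbar_nbhs h)[a aW] : nbhs r (iN h @^-1` W) by exact: (@iN_continuous _ _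
  _ _ h r).
have [k rk] := coord_M h r a.
pose Fk := Fset_pr h rel k a; pose FE := Fset_tg_range h rel g.
(* The value 1 on [pr k a] fixes the a-coordinate of the preimage to that of r; the value 1 on the
   range projection puts x into the domain of t_g. *)
pose V := [set x : Fchar s u | x (mkF Fk) = true] `&` [set x | x (mkF FE) = true].
pose B := [set c : germs s u | exists2 x, (V `&` @Fhat _ _ _ _ _ s u) x &
  germ_val c = germ s u x (t g)].
have VD : V `&` @Fhat _ _ _ _ _ s u `<=` @Dset R G H M A s u (t g).
  by move=> x [[_ /= xE] hx]; split=> //; apply/(supp_mkF _ FE).
have oB : open B.
  apply: germ_basis_open; exists (t g), (V `&` @Fhat _ _ _ _ _ s u), V; split=> //.
    exact: (Tset_tg h rel).
  by apply: openI; exact: Fchar_open.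
have gamE : germ_val (val gamma) = germ s u (chr r) (t g).
  by rewrite -(phiE pE) psiK.
have Bg : B (val gamma).
  exists (chr r) => //; split; last exact: (chr_Fhat h rel).
  split; first by apply/supp_mkF; exact: (chr_pr h rel rk).
  by apply/supp_mkF/(tg_dom h rel); exists y.
have cval : continuous (val : YG -> germs s u) by exact: initial_continuous.
have nB : nbhs (val gamma) B by apply: open_nbhs_nbhs.
apply: (@filterS _ (nbhs gamma) _ _ _ _ (cval _ _ nB)) => c [x Vx cE].
have Sx : Sigma s u (x, t g) by split; [exact: (Tset_tg h rel)|exact: VD].
have [r' [g' [y' [cE' ry']]]] := NG_elt (psi c).
have E : germ s u (chr r') (t g') = germ s u x (t g) by rewrite -(phiE cE') psiK.
have [S' _] := tg_char_act_tight rel ry'.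
have [xE _] := germ_inv h rel S' E; rewrite {x}xE in E Vx Sx cE *.
have [_ gE] := germ_chr_inj ry' E; rewrite gE in cE'.
have [[/(supp_mkF _ Fk) r'k _] _] := Vx.
rewrite /= cE'; apply: WQ; split=> /=; last exact: nbhs_singleton Qg.
apply: aW; apply: (@coord_eq _ _ _ _ h _ _ _ (val k)) => //.
exact: (chr_pr_inv h rel).
Qed.

End Phi.
End Isomorphism.

Theorem theorem6p5 (R : realType) (G : groupType) (N H M : set G)
  (h : CuntzLi_setting N H M)
  (A : cstarAlgType R) (s : Pset H M -> A) (u : M -> A)
  (hA : CuntzLi_universal s u) :
  exists phi : NG_restriction h -> Gtight s u,
    (forall (x : Mbar H M) (a b : Pset H M) (m : M) (p : NG_restriction h),
       val p = (iN h x, (val a)^-1 * val m * val b)%g ->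
       Sigma s u (Mbar_char s u x, star (s a) * u m * s b) /\
       germ_val (val (phi p)) =
         germ s u (Mbar_char s u x) (star (s a) * u m * s b)) /\
    topological_groupoid_iso phi.
Proof.
have rel := CLu_relations hA; have [D gD] := CuntzLi_graded h hA.
have [phi phiE] := phi_ex h rel.
have /choice[psi psiK] := Gtight_elt rel phiE.
have phiK : cancel phi psi by move=> p; apply: (phi_inj rel gD phiE); rewrite psiK.
exists phi; split=> [x a b m p pE|].
  rewrite -(tgE h rel); split; last exact: phiE.
  have [r [g [y [pE' ry]]]] := NG_elt p.
  move: pE' ry; rewrite pE => -[/iN_inj <- <-] ry.
  by have [] := tg_char_act_tight rel ry.
split.
- by exists psi; [split|exact: (phi_inv_continuous rel gD phiE)].
- exact: (phi_continuous rel gD phiE).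
- exact: (phi_mul rel gD phiE).
- exact: (phi_inv rel gD phiE).
Qed.
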